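(* Every finite group $G$ with $[G,G]\cong\mathbb{Z}_2$ admits an indecomposable Yetter-Drinfel'd module $\tilde M$ over $G$ (over $\mathbb{C}$) whose Nichols algebra $\mathcal{B}(\tilde M)$ is finite-dimensional. In particular, for every such $G$ there exists a finite-dimensional indecomposable pointed Hopf algebra with coradical $\mathbb{C}[G]$, namely the bosonization $\mathbb{C}[G]\#\mathcal{B}(\tilde M)$.
   Context: A Yetter-Drinfel'd module over a finite group $G$ is a finite-dimensional $G$-graded complex vector space $M=\bigoplus_{g\in G}M_g$ with a $G$-action such that $g.M_h=M_{ghg^{-1}}$. It is (link-)indecomposable if its support $\{g\mid M_g\ne0\}$ generates $G$. The Nichols algebra $\mathcal{B}(M)$ is the quotient of the tensor algebra $T(M)$ by the largest homogeneous ideal in degrees $\ge2$ invariant under the skew derivations $\partial_k$ with $\partial_k(1)=0$, $\partial_k(e_l)=\delta_{kl}$, $\partial_k(xy)=\partial_k(x)(g_k.y)+x\partial_k(y)$ for a homogeneous basis $e_k\in M_{g_k}$; it is a Hopf algebra in the braided category of Yetter-Drinfel'd modules, and $\mathbb{C}[G]\#\mathcal{B}(M)$ denotes its (Radford biproduct) bosonization. A pointed Hopf algebra is indecomposable if it is not the direct sum of two nonzero subcoalgebras. *)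

(* Defs.v *)
From HB Require Import structures.
From mathcomp Require Import all_boot all_order all_algebra all_fingroup
  all_solvable all_field.
From mathcomp Require Import generic_quotient boolp reals complex finmap monalg.

Set Implicit Arguments.
Unset Strict Implicit.
Unset Printing Implicit Defensive.

Import GRing.Theory VectorInternalTheory.

Local Open Scope ring_scope.

Record ydModule (K : fieldType) (gT : finGroupType) := YDModule {
  yd_sort :> vectType K;
  yd_part : gT -> {vspace yd_sort};
  yd_act : gT -> 'End(yd_sort);
  yd_part_full : (\sum_g yd_part g = fullv)%VS;
  yd_part_direct : directv (\sum_g yd_part g)%VS;
  yd_act1 : yd_act 1%g = \1%VF;
  yd_actM : forall g h, yd_act (g * h)%g = (yd_act g \o yd_act h)%VF;
  yd_act_part : forall g h,
    (yd_act g @: yd_part h)%VS = yd_part (g * h * g^-1)%g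
}.

Definition yd_support (K : fieldType) (gT : finGroupType)
    (M : ydModule K gT) : {set gT} :=
  [set g | yd_part M g != 0%VS].

Definition yd_indecomposable (K : fieldType) (gT : finGroupType)
    (M : ydModule K gT) : Prop :=
  <<yd_support M>>%g = [set: gT].

(* The homogeneous basis e_k \in M_(g_k) used to define the skew derivations;  *)
(* up to isomorphism, the Nichols algebra of M does not depend on it.         *)
Record hbasis (K : fieldType) (gT : finGroupType) (M : ydModule K gT) :=
  HBasis {
    hsize : nat;
    hvec : hsize.-tuple M;
    hdeg : 'I_hsize -> gT;
    hvec_basis : basis_of fullv hvec;
    hvec_part : forall i, tnth hvec i \in yd_part M (hdeg i)
  }.

(* The free module {malg K[W]} on W, which is an algebra if W is a monoid,    *)
(* with locked operations: left transparent, those of malg make unification   *)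
(* diverge.                                                                   *)
Section FreeModule.
Variables (K : fieldType) (W : choiceType).

Record freemod := FreeMod { freemod_val :> {malg K[W]} }.

HB.instance Definition _ := [isNew for freemod_val].
HB.instance Definition _ := [Choice of freemod by <:].

Implicit Types x y z : freemod.

Fact freemod_key : unit. Proof. by []. Qed.

Definition fm_opp : freemod -> freemod :=
  locked_with freemod_key (fun x => FreeMod (- freemod_val x)).
Definition fm_add : freemod -> freemod -> freemod :=
  locked_with freemod_key (fun x y => FreeMod (freemod_val x + freemod_val y)).
Definition fm_scale : K -> freemod -> freemod :=
  locked_with freemod_key (fun c x => FreeMod (c *: freemod_val x)).

Canonical fm_opp_unlockable := [unlockable of fm_opp].
Canonical fm_add_unlockable := [unlockable of fm_add].
Canonical fm_scale_unlockable := [unlockable of fm_scale].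

Lemma fm_addA : associative fm_add.
Proof. by move=> x y z; rewrite unlock; congr FreeMod; exact: addrA. Qed.

Lemma fm_addC : commutative fm_add.
Proof. by move=> x y; rewrite unlock; congr FreeMod; exact: addrC. Qed.

Lemma fm_add0 : left_id (FreeMod 0) fm_add.
Proof. by case=> x; rewrite unlock; congr FreeMod; exact: add0r. Qed.

Lemma fm_addN : left_inverse (FreeMod 0) fm_opp fm_add.
Proof. by case=> x; rewrite !unlock; congr FreeMod; exact: addNr. Qed.

HB.instance Definition _ :=
  GRing.isZmodule.Build freemod fm_addA fm_addC fm_add0 fm_addN.

Lemma fm_addE x y : x + y = fm_add x y. Proof. by []. Qed.

Lemma fm_scaleA a b x : fm_scale a (fm_scale b x) = fm_scale (a * b) x.
Proof. by rewrite unlock; congr FreeMod; exact: scalerA. Qed.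

Lemma fm_scale1 : left_id 1 fm_scale.
Proof. by case=> x; rewrite unlock; congr FreeMod; exact: scale1r. Qed.

Lemma fm_scaleDr : right_distributive fm_scale +%R.
Proof.
by move=> a x y; rewrite !fm_addE !unlock; congr FreeMod; exact: scalerDr.
Qed.

Lemma fm_scaleDl x : {morph fm_scale^~ x : a b / a + b}.
Proof.
by move=> a b; rewrite !fm_addE !unlock; congr FreeMod; exact: scalerDl.
Qed.

HB.instance Definition _ := GRing.Zmodule_isLmodule.Build K freemod
  fm_scaleA fm_scale1 fm_scaleDr fm_scaleDl.

Definition fgen (w : W) : freemod := FreeMod << w >>.

Definition fcoef (w : W) (x : freemod) : K := (freemod_val x)@_w.

Lemma fcoefP x y : (forall w, fcoef w x = fcoef w y) -> x = y.
Proof. by case: x y => [x] [y] xy; congr FreeMod; exact/malgP. Qed.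

Lemma fcoef_is_linear w : linear_for *%R (fcoef w).
Proof.
move=> a x y; rewrite fm_addE -[a *: x]/(fm_scale a x) /fcoef !unlock /=.
by rewrite mcoeffD mcoeffZ.
Qed.

HB.instance Definition _ w :=
  GRing.isLinear.Build K freemod K _ (fcoef w) (fcoef_is_linear w).

Lemma fcoefU v w : fcoef w (fgen v) = (v == w)%:R.
Proof. exact: mcoeffU. Qed.

(* The linear extension of f : W -> V. *)
Definition mlin (V : lmodType K) : (W -> V) -> freemod -> V :=
  locked_with freemod_key (fun f x => \sum_(w <- msupp x) fcoef w x *: f w).

Lemma mlinE (V : lmodType K) (f : W -> V) x :
  mlin f x = \sum_(w <- msupp x) fcoef w x *: f w.
Proof. by rewrite /mlin; case: freemod_key. Qed.

Lemma mlinEw (V : lmodType K) (f : W -> V) x (D : {fset W}) :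
  (msupp x `<=` D)%fset -> mlin f x = \sum_(w <- D) fcoef w x *: f w.
Proof.
move=> sxD; rewrite mlinE (big_fset_incl _ sxD) // => w _ wNx.
by rewrite /fcoef mcoeff_outdom // scale0r.
Qed.

Lemma mlin_is_linear (V : lmodType K) (f : W -> V) : linear (mlin f).
Proof.
move=> a x y; pose z := a *: x + y.
pose D := (msupp x `|` msupp y `|` msupp z)%fset.
have sx : (msupp x `<=` D)%fset by rewrite /D -fsetUA fsubsetUl.
have sy : (msupp y `<=` D)%fset by rewrite /D fsetUAC fsubsetUr.
have sz : (msupp z `<=` D)%fset by rewrite fsubsetUr.
rewrite (mlinEw _ sx) (mlinEw _ sy) (mlinEw _ sz) scaler_sumr -big_split /=.
by apply: eq_bigr => w _; rewrite linearD linearZ scalerDl -scalerA.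
Qed.

HB.instance Definition _ (V : lmodType K) (f : W -> V) :=
  GRing.isLinear.Build K freemod V _ (mlin f) (mlin_is_linear f).

Lemma mlinU (V : lmodType K) (f : W -> V) w : mlin f (fgen w) = f w.
Proof.
have sw : (msupp (fgen w) `<=` [fset w])%fset by exact: msuppU_le.
by rewrite (mlinEw f sw) big_seq_fset1 fcoefU eqxx scale1r.
Qed.

Lemma freemodE x : x = \sum_(w <- msupp x) fcoef w x *: fgen w.
Proof.
apply: fcoefP => v; rewrite linear_sum /= /fcoef {1}[freemod_val x]monalgE.
rewrite raddf_sum; apply: eq_bigr => w _ /=.
by rewrite -[RHS]/(fcoef v _) linearZ /= fcoefU mcoeffU mulr_natr.
Qed.

Lemma linear_freemod_ext (V : lmodType K) (f g : {linear freemod -> V}) :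
  (forall w, f (fgen w) = g (fgen w)) -> f =1 g.
Proof.
move=> fg x; rewrite [x]freemodE !linear_sum; apply: eq_bigr => w _.
by rewrite !linearZ fg.
Qed.

End FreeModule.

Section FreeAlgebra.
Variables (K : fieldType) (W : monomType).
Local Notation A := (freemod K W).
Implicit Types x y z : A.

Definition fm_mul : A -> A -> A :=
  locked_with freemod_key (fun x y => FreeMod (freemod_val x * freemod_val y)).

Canonical fm_mul_unlockable := [unlockable of fm_mul].

Lemma fm_mulA : associative fm_mul.
Proof. by move=> x y z; rewrite unlock; congr FreeMod; exact: mulrA. Qed.

Lemma fm_mul1 : left_id (fgen K mone) fm_mul.
Proof. by case=> x; rewrite unlock; congr FreeMod; exact: mul1r. Qed.

Lemma fm_mulr1 : right_id (fgen K mone) fm_mul.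
Proof. by case=> x; rewrite unlock; congr FreeMod; exact: mulr1. Qed.

Lemma fm_mulDl : left_distributive fm_mul +%R.
Proof.
by move=> x y z; rewrite !fm_addE !unlock; congr FreeMod; exact: mulrDl.
Qed.

Lemma fm_mulDr : right_distributive fm_mul +%R.
Proof.
by move=> x y z; rewrite !fm_addE !unlock; congr FreeMod; exact: mulrDr.
Qed.

Lemma fm_oner_neq0 : fgen K (mone : W) != 0.
Proof.
apply/eqP => /(congr1 (fcoef mone)) /eqP.
by rewrite linear0 fcoefU eqxx oner_eq0.
Qed.

HB.instance Definition _ := GRing.Zmodule_isNzRing.Build A
  fm_mulA fm_mul1 fm_mulr1 fm_mulDl fm_mulDr fm_oner_neq0.

Lemma fm_scaleAl (c : K) x y : c *: (x * y) = (c *: x : A) * y.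
Proof.
rewrite -[c *: (x * y)]/(fm_scale c (fm_mul x y)).
rewrite -[RHS]/(fm_mul (fm_scale c x) y) !unlock; congr FreeMod.
exact: scalerAl.
Qed.

HB.instance Definition _ := GRing.Lmodule_isLalgebra.Build K A fm_scaleAl.

Lemma fm_scaleAr (c : K) x y : c *: (x * y) = x * (c *: y).
Proof.
rewrite -[c *: (x * y)]/(fm_scale c (fm_mul x y)).
rewrite -[RHS]/(fm_mul x (fm_scale c y)) !unlock; congr FreeMod => /=.
rewrite -!mul_malgC !mulrA; congr (_ * _).
rewrite [freemod_val x]monalgE mulr_suml mulr_sumr; apply: eq_bigr => w _.
by rewrite !malgM_def !fgmulUU mul1m mulm1 mulrC.
Qed.

HB.instance Definition _ := GRing.Lalgebra_isAlgebra.Build K A fm_scaleAr.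

Lemma fgen1 : fgen K (mone : W) = 1.
Proof. by []. Qed.

Lemma fgenM (v w : W) : fgen K v * fgen K w = fgen K (mmul v w).
Proof.
rewrite -[LHS]/(fm_mul _ _) unlock; congr FreeMod => /=.
by rewrite malgM_def fgmulUU mulr1.
Qed.

Lemma freemod_mulE x y :
  x * y = \sum_(v <- msupp x) \sum_(w <- msupp y)
            (fcoef v x * fcoef w y) *: fgen K (mmul v w).
Proof.
rewrite {1}[x]freemodE {1}[y]freemodE mulr_suml.
apply: eq_bigr => v _; rewrite mulr_sumr; apply: eq_bigr => w _.
by rewrite -scalerAl -scalerAr scalerA fgenM.
Qed.

End FreeAlgebra.

(* T(M) is the free algebra on a homogeneous basis e_0, ..., e_(n-1) of M:     *)
(* its basis is the monoid of words in 'I_n. G acts by algebra automorphisms. *)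
Section TensorAlgebra.
Variables (K : fieldType) (gT : finGroupType) (M : ydModule K gT).
Variable e : hbasis M.

Local Notation word := {fmonom 'I_(hsize e)}.
Local Notation T := (freemod K word).

Definition wdeg (w : word) : gT := (\prod_(i <- (w : seq _)) hdeg i)%g.

Definition tgen (i : 'I_(hsize e)) : T := fgen K (fmu i).

Definition tact_gen (g : gT) (i : 'I_(hsize e)) : T :=
  \sum_j coord (hvec e) j (yd_act M g (tnth (hvec e) i)) *: tgen j.

Definition tact_word (g : gT) (s : seq 'I_(hsize e)) : T :=
  \prod_(i <- s) tact_gen g i.

Definition tact (g : gT) : T -> T := mlin (fun w : word => tact_word g w).

HB.instance Definition _ g := GRing.Linear.on (tact g).

(* tder k is the skew derivation characterized by tder1, tder_gen and tderM. *)
Fixpoint tder_word (k : 'I_(hsize e)) (s : seq 'I_(hsize e)) : T :=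
  if s is i :: s' then
    (k == i)%:R *: tact_word (hdeg k) s' + tgen i * tder_word k s'
  else 0.

Definition tder (k : 'I_(hsize e)) : T -> T :=
  mlin (fun w : word => tder_word k w).

HB.instance Definition _ k := GRing.Linear.on (tder k).

Definition thomog (d : nat) : T -> T :=
  mlin (fun w : word => if fdeg w == d then fgen K w else 0).

HB.instance Definition _ d := GRing.Linear.on (thomog d).

Lemma tactU g (w : word) : tact g (fgen K w) = tact_word g w.
Proof. by rewrite /tact mlinU. Qed.

Lemma tderU k (w : word) : tder k (fgen K w) = tder_word k w.
Proof. by rewrite /tder mlinU. Qed.

Lemma tactM g (x y : T) : tact g (x * y) = tact g x * tact g y.
Proof.
rewrite freemod_mulE [in RHS](freemodE x) [in RHS](freemodE y).
rewrite !linear_sum mulr_suml; apply: eq_bigr => v _.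
rewrite linear_sum mulr_sumr; apply: eq_bigr => w _.
rewrite !linearZ /= -scalerAl -scalerAr scalerA !tactU.
by rewrite /mmul /= fmmulE /tact_word big_cat.
Qed.

Lemma tact1 g : tact g 1 = 1.
Proof. by rewrite tactU /tact_word fm1 big_nil. Qed.

Lemma tder1 k : tder k 1 = 0.
Proof. by rewrite tderU fm1. Qed.

Lemma tder_gen k l : tder k (tgen l) = (k == l)%:R.
Proof.
rewrite tderU fmuE /= mulr0 addr0 /tact_word big_nil.
by case: eqP => _; rewrite ?scale1r ?scale0r.
Qed.

Lemma tgen_word (s : seq 'I_(hsize e)) :
  \prod_(i <- s) tgen i = fgen K (FMonom s : word).
Proof.
elim: s => [|i s IHs]; first by rewrite big_nil -fmoneE.
by rewrite big_cons IHs fgenM /mmul /= fmmulE fmuE.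
Qed.

Lemma tder_word_cat k s t :
  tder_word k (s ++ t) = tder_word k s * tact_word (hdeg k) t
    + \prod_(i <- s) tgen i * tder_word k t.
Proof.
elim: s => [|i s IHs] /=; first by rewrite mul0r add0r big_nil mul1r.
rewrite IHs mulrDr mulrDl big_cons -scalerAl -!mulrA -addrA.
by rewrite /tact_word big_cat.
Qed.

Lemma tderM k (x y : T) :
  tder k (x * y) = tder k x * tact (hdeg k) y + x * tder k y.
Proof.
rewrite freemod_mulE [in RHS](freemodE x) [in RHS](freemodE y).
rewrite !linear_sum !mulr_suml -big_split /=; apply: eq_bigr => v _.
rewrite linear_sum !mulr_sumr -big_split /=; apply: eq_bigr => w _.
rewrite !linearZ /= -!scalerAl -!scalerAr !scalerA -scalerDr !tderU tactU.
by congr (_ *: _); rewrite /mmul /= fmmulE tder_word_cat tgen_word fmK.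
Qed.

(* T (x) T has basis word * word. Its product is twisted by the braiding      *)
(* c (v (x) u) = (deg v).u (x) v.                                             *)
Local Notation T2 := (freemod K (word * word)%type).

Definition tbrmul (X Y : T2) : T2 :=
  mlin (fun p : word * word =>
    mlin (fun q : word * word =>
      mlin (fun u : word =>
        fgen K (mmul p.1 u, mmul p.2 q.2))
        (tact_word (wdeg p.2) q.1)) Y) X.

(* The braided comultiplication is the algebra morphism from T to T (x) T     *)
(* (with the product tbrmul) sending e_i to e_i (x) 1 + 1 (x) e_i.            *)
Definition tcop_gen (i : 'I_(hsize e)) : T2 :=
  fgen K (fmu i, mone) + fgen K (mone, fmu i).

Definition tcop : T -> T2 :=
  mlin (fun w : word =>
    foldr (fun i X => tbrmul (tcop_gen i) X) (fgen K (mone, mone)) w).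

HB.instance Definition _ := GRing.Linear.on tcop.

Record nichols_admissible (J : T -> Prop) : Prop := {
  adm0 : J 0;
  admB : forall x y, J x -> J y -> J (x - y);
  admMl : forall a x, J x -> J (a * x);
  admMr : forall a x, J x -> J (x * a);
  adm_homog : forall d x, J x -> J (thomog d x);
  adm_deg : forall x (w : word), J x -> (fdeg w < 2)%N -> fcoef w x = 0;
  adm_der : forall k x, J x -> J (tder k x)
}.

(* The union of all admissible ideals; it is the largest one, see             *)
(* nichols_ideal_admissible and nichols_ideal_max.                            *)
Definition nichols_ideal (x : T) : Prop :=
  exists2 J, nichols_admissible J & J x.

Lemma nichols_admissible0 : nichols_admissible (eq 0).
Proof.
split=> // [x y <- <-|a x <-|a x <-|d x <-|x w <- _|k x <-].
- by rewrite subr0.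
- by rewrite mulr0.
- by rewrite mul0r.
- by rewrite linear0.
- by rewrite linear0.
- by rewrite linear0.
Qed.

Lemma nichols_admissibleD (I J : T -> Prop) :
  nichols_admissible I -> nichols_admissible J ->
  nichols_admissible (fun z => exists x y, [/\ I x, J y & z = x + y]).
Proof.
move=> hI hJ; split.
- by exists 0, 0; rewrite addr0; split; [exact: adm0 | exact: adm0 |].
- move=> _ _ [x [y [Ix Jy ->]]] [x' [y' [Ix' Jy' ->]]].
  exists (x - x'), (y - y'); split; [exact: admB|exact: admB|].
  by rewrite opprD addrACA.
- move=> a _ [x [y [Ix Jy ->]]]; exists (a * x), (a * y).
  by split; [exact: admMl|exact: admMl|rewrite mulrDr].
- move=> a _ [x [y [Ix Jy ->]]]; exists (x * a), (y * a).
  by split; [exact: admMr|exact: admMr|rewrite mulrDl].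
- move=> d _ [x [y [Ix Jy ->]]]; exists (thomog d x), (thomog d y).
  by split; [exact: adm_homog|exact: adm_homog|rewrite linearD].
- move=> _ w [x [y [Ix Jy ->]]] hw.
  by rewrite linearD /= (adm_deg hI Ix hw) (adm_deg hJ Jy hw) addr0.
- move=> k _ [x [y [Ix Jy ->]]]; exists (tder k x), (tder k y).
  by split; [exact: adm_der|exact: adm_der|rewrite linearD].
Qed.

Lemma nichols_ideal_max J :
  nichols_admissible J -> forall x, J x -> nichols_ideal x.
Proof. by move=> hJ x Jx; exists J. Qed.

Lemma nichols_ideal_admissible : nichols_admissible nichols_ideal.
Proof.
split.
- by exists (eq 0) => //; exact: nichols_admissible0.
- move=> x y [I hI Ix] [J hJ Jy].
  apply: ex_intro2 (nichols_admissibleD hI hJ) _.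
  exists x, (- y); split=> //.
  by rewrite -(sub0r y); apply: admB => //; exact: adm0.
- by move=> a x [I hI Ix]; exists I => //; exact: admMl.
- by move=> a x [I hI Ix]; exists I => //; exact: admMr.
- by move=> d x [I hI Ix]; exists I => //; exact: adm_homog.
- by move=> x w [I hI Ix] hw; exact: (adm_deg hI Ix hw).
- by move=> k x [I hI Ix]; exists I => //; exact: adm_der.
Qed.

Definition nichols_pred : {pred T} := fun x => `[< nichols_ideal x >].

Lemma nichols_predP x : reflect (nichols_ideal x) (x \in nichols_pred).
Proof. exact: asboolP. Qed.

Lemma nichols_pred_zmod_closed : zmod_closed nichols_pred.
Proof.
split; first exact/nichols_predP/(adm0 nichols_ideal_admissible).
move=> x y /nichols_predP Ix /nichols_predP Iy.
exact/nichols_predP/(admB nichols_ideal_admissible).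
Qed.

HB.instance Definition _ :=
  GRing.isZmodClosed.Build T nichols_pred nichols_pred_zmod_closed.

Definition nichols : Type := {ideal_quot nichols_pred}.

HB.instance Definition _ := GRing.Zmodule.on nichols.

Definition npi (x : T) : nichols := (\pi_{ideal_quot nichols_pred} x)%qT.

Definition nrepr (u : nichols) : T :=
  generic_quotient.repr (u : {ideal_quot nichols_pred}).

Lemma nreprK : cancel nrepr npi.
Proof. exact: reprK. Qed.

Lemma npi_is_zmod_morphism : zmod_morphism npi.
Proof. exact: pi_is_zmod_morphism. Qed.

HB.instance Definition _ :=
  GRing.isZmodMorphism.Build T nichols npi npi_is_zmod_morphism.

Lemma npi_eq x y : npi x = npi y <-> nichols_ideal (x - y).
Proof.
have E : (x - y \in nichols_pred) = (npi x == npi y).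
  exact: Quotient.idealrBE.
split=> [xy|/nichols_predP]; last by rewrite E => /eqP.
by apply/nichols_predP; rewrite E xy.
Qed.

Definition nichols_one : nichols := npi 1.

Definition nichols_mul (u v : nichols) : nichols := npi (nrepr u * nrepr v).

Definition nichols_scale (c : K) (u : nichols) : nichols := npi (c *: nrepr u).

Lemma npiM x y : npi (x * y) = nichols_mul (npi x) (npi y).
Proof.
have hI := nichols_ideal_admissible.
have /npi_eq hx : npi x = npi (nrepr (npi x)) by rewrite nreprK.
have /npi_eq hy : npi y = npi (nrepr (npi y)) by rewrite nreprK.
set x' := nrepr _ in hx; set y' := nrepr _ in hy.
apply/npi_eq; have -> : x * y - x' * y' = x * (y - y') - (x' - x) * y'.
  by rewrite mulrBr mulrBl opprB addrA subrK.
apply: (admB hI); first exact: (admMl hI).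
rewrite -opprB -sub0r; apply/(admMr hI)/(admB hI) => //; exact: (adm0 hI).
Qed.

Lemma npiZ c x : npi (c *: x) = nichols_scale c (npi x).
Proof.
have hI := nichols_ideal_admissible.
have /npi_eq hx : npi x = npi (nrepr (npi x)) by rewrite nreprK.
apply/npi_eq; rewrite -scalerBr -[_ - _]mul1r scalerAl; exact: (admMl hI).
Qed.

Lemma nichols_mulA : associative nichols_mul.
Proof.
by move=> u v w; rewrite -(nreprK u) -(nreprK v) -(nreprK w) -!npiM mulrA.
Qed.

Lemma nichols_mul1 : left_id nichols_one nichols_mul.
Proof. by move=> u; rewrite -(nreprK u) -npiM mul1r. Qed.

Lemma nichols_mulr1 : right_id nichols_one nichols_mul.
Proof. by move=> u; rewrite -(nreprK u) -npiM mulr1. Qed.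

Lemma nichols_mulDl : left_distributive nichols_mul +%R.
Proof.
move=> u v w; rewrite -(nreprK u) -(nreprK v) -(nreprK w).
by rewrite -raddfD -!npiM mulrDl raddfD.
Qed.

Lemma nichols_mulDr : right_distributive nichols_mul +%R.
Proof.
move=> u v w; rewrite -(nreprK u) -(nreprK v) -(nreprK w).
by rewrite -raddfD -!npiM mulrDr raddfD.
Qed.

Lemma nichols_oner_neq0 : nichols_one != 0.
Proof.
apply/eqP; rewrite -(raddf0 npi) => /npi_eq; rewrite subr0 => I1.
have mone2 : (fdeg (mone : word) < 2)%N by rewrite /fdeg fm1.
have /eqP := adm_deg nichols_ideal_admissible I1 mone2.
by rewrite fcoefU eqxx oner_eq0.
Qed.

HB.instance Definition _ := GRing.Zmodule_isNzRing.Build nichols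
  nichols_mulA nichols_mul1 nichols_mulr1 nichols_mulDl nichols_mulDr
  nichols_oner_neq0.

Lemma nichols_scaleA a b u :
  nichols_scale a (nichols_scale b u) = nichols_scale (a * b) u.
Proof. by rewrite -(nreprK u) -!npiZ scalerA. Qed.

Lemma nichols_scale1 : left_id 1 nichols_scale.
Proof. by move=> u; rewrite -(nreprK u) -npiZ scale1r. Qed.

Lemma nichols_scaleDr : right_distributive nichols_scale +%R.
Proof.
move=> a u v; rewrite -(nreprK u) -(nreprK v).
by rewrite -raddfD -!npiZ scalerDr raddfD.
Qed.

Lemma nichols_scaleDl u : {morph nichols_scale^~ u : a b / a + b}.
Proof. by move=> a b; rewrite -(nreprK u) -!npiZ scalerDl raddfD. Qed.

HB.instance Definition _ := GRing.Zmodule_isLmodule.Build K nichols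
  nichols_scaleA nichols_scale1 nichols_scaleDr nichols_scaleDl.

Lemma nichols_scaleAl (a : K) (u v : nichols) : a *: (u * v) = a *: u * v.
Proof.
rewrite -(nreprK u) -(nreprK v).
by rewrite -[_ * _ in LHS]npiM -[LHS]npiZ -[a *: _]npiZ -[RHS]npiM scalerAl.
Qed.

HB.instance Definition _ :=
  GRing.Lmodule_isLalgebra.Build K nichols nichols_scaleAl.

Lemma nichols_scaleAr (a : K) (u v : nichols) : a *: (u * v) = u * (a *: v).
Proof.
rewrite -(nreprK u) -(nreprK v).
rewrite -[_ * _ in LHS]npiM -[LHS]npiZ -[a *: _]npiZ -[RHS]npiM.
by rewrite scalerAr.
Qed.

HB.instance Definition _ :=
  GRing.Lalgebra_isAlgebra.Build K nichols nichols_scaleAr.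

Lemma npi_is_monoid_morphism : monoid_morphism npi.
Proof. by split=> // x y; rewrite npiM. Qed.

HB.instance Definition _ :=
  GRing.isMonoidMorphism.Build T nichols npi npi_is_monoid_morphism.

Lemma npi_is_scalable : scalable npi.
Proof. by move=> a x; rewrite npiZ. Qed.

HB.instance Definition _ :=
  GRing.isScalable.Build K T nichols *:%R npi npi_is_scalable.

End TensorAlgebra.

Definition finite_dimensional (K : fieldType) (V : lmodType K) : Prop :=
  exists s : seq V, forall v : V,
    exists c : 'I_(size s) -> K, v = \sum_i c i *: s`_i.

Section Tensor.
Variable K : fieldType.

(* The matrix t : tens U V stands for the sum of the t i j *: (u_i (x) v_j),  *)
(* where u_i and v_j are the coordinate bases of U and V.                     *)
Definition tens (U V : vectType K) : vectType K := 'M[K]_(dim U, dim V).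

Definition pure (U V : vectType K) (u : U) (v : V) : tens U V :=
  (v2r u)^T *m v2r v.

Definition vbase (U : vectType K) (i : 'I_(dim U)) : U :=
  r2v (delta_mx 0 i).

(* The linear map with u (x) v |-> F u v, for a bilinear F; in Sweedler's     *)
(* notation, tlift F (Delta x) is the sum of the F x_(1) x_(2).               *)
Definition tlift (U V W : vectType K) (F : U -> V -> W) (t : tens U V) : W :=
  \sum_i \sum_j t i j *: F (vbase i) (vbase j).

Lemma tlift_pure (U V W : vectType K) (F : U -> V -> W) u v :
  (forall x, linear (F x)) -> (forall y, linear (F^~ y)) ->
  tlift F (pure u v) = F u v.
Proof.
move=> Flinr Flinl.
have exp (X : vectType K) (x : X) : x = \sum_i v2r x 0 i *: vbase i.
  apply: v2r_inj; rewrite linear_sum /= [LHS]row_sum_delta.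
  by apply: eq_bigr => i _; rewrite linearZ /= r2vK.
pose fr x := GRing.isLinear.Build K V W _ (F x) (Flinr x).
pose fl y := GRing.isLinear.Build K U W _ (F^~ y) (Flinl y).
pose Fr x : {linear V -> W} := HB.pack (F x) (fr x).
pose Fl y : {linear U -> W} := HB.pack (F^~ y) (fl y).
rewrite /tlift [in RHS](exp _ u) -[RHS]/(Fl v _) linear_sum.
apply: eq_bigr => i _; rewrite linearZ /= [in RHS](exp _ v).
rewrite -[F _ _ in RHS]/(Fr _ _) linear_sum scaler_sumr.
apply: eq_bigr => j _; rewrite linearZ /= scalerA; congr (_ *: _).
by rewrite /pure mxE big_ord1 !mxE.
Qed.

Lemma tlift_pure_id (U V : vectType K) (t : tens U V) :
  tlift (@pure U V) t = t.
Proof.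
rewrite [RHS]matrix_sum_delta; do 2![apply: eq_bigr => ? _].
by rewrite /pure /vbase !r2vK trmx_delta mul_delta_mx.
Qed.

End Tensor.

Record hopfAlgebra (K : fieldType) := HopfAlgebra {
  hopf_sort :> falgType K;
  comul : 'Hom(hopf_sort, tens hopf_sort hopf_sort);
  counit : 'Hom(hopf_sort, K^o);
  antipode : 'End(hopf_sort);
  comulA : forall x,
    tlift (fun a b => tlift (fun a1 a2 => pure a1 (pure a2 b)) (comul a))
          (comul x)
    = tlift (fun a b => pure a (comul b)) (comul x);
  counitl : forall x,
    tlift (fun a b => (counit a : K) *: b) (comul x) = x;
  counitr : forall x,
    tlift (fun a b => (counit b : K) *: a) (comul x) = x;
  comul1 : comul 1 = pure 1 1;
  comulM : forall x y,
    comul (x * y) =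
      tlift (fun a b => tlift (fun c d => pure (a * c) (b * d)) (comul y))
            (comul x);
  counit1 : counit 1 = 1;
  counitM : forall x y, counit (x * y) = (counit x : K) * counit y;
  antipodel : forall x,
    tlift (fun a b => antipode a * b) (comul x) = (counit x : K) *: 1;
  antipoder : forall x,
    tlift (fun a b => a * antipode b) (comul x) = (counit x : K) *: 1
}.

Section Coalgebra.
Variables (K : fieldType) (H : hopfAlgebra K).
Implicit Types D E : {vspace H}.

Definition vtens2 D : {vspace tens H H} :=
  <<[seq pure x y | x <- vbasis D, y <- vbasis D]>>%VS.

Definition subcoalgebra D : Prop := (comul H @: D <= vtens2 D)%VS.

Definition simple_subcoalgebra D : Prop :=
  [/\ subcoalgebra D, D != 0%VS &
      forall E, subcoalgebra E -> (E <= D)%VS -> E = 0%VS \/ E = D].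

(* Membership in the coradical, the sum of all simple subcoalgebras. *)
Definition coradical (x : H) : Prop :=
  exists2 Ds : seq {vspace H},
    forall D, D \in Ds -> simple_subcoalgebra D &
    x \in (\sum_(D <- Ds) D)%VS.

Definition pointed : Prop :=
  forall D, simple_subcoalgebra D -> \dim D = 1%N.

Definition coalgebra_indecomposable : Prop :=
  ~ exists D E,
      [/\ subcoalgebra D, subcoalgebra E, D != 0%VS, E != 0%VS &
          (D + E = fullv)%VS /\ directv (D + E)].

(* gamma extends linearly to an isomorphism of Hopf algebras from the group   *)
(* algebra K[G] onto the coradical of H.                                      *)
Definition coradical_group_algebra (gT : finGroupType) (gamma : gT -> H) :
    Prop :=
  [/\ gamma 1%g = 1,
      forall g h, gamma (g * h)%g = gamma g * gamma h,
      forall g, comul H (gamma g) = pure (gamma g) (gamma g) /\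
                counit H (gamma g) = 1,
      free (codom gamma) &
      forall x, coradical x <-> x \in <<codom gamma>>%VS].

End Coalgebra.

(* theta x g stands for x # g. The group factor is written on the right: the  *)
(* product g x in K[G] # B(M) is (g.x) # g here. The condition bos_bij says   *)
(* that H, as a vector space, is the tensor product of the Nichols algebra    *)
(* and K[G]; the other ones are the structure maps of the Radford biproduct,  *)
(*   (x # g) (y # h) = x (g.y) # gh,                                          *)
(*   Delta (x # g) = (x^(1) # (x^(2))_(-1) g) (x) ((x^(2))_(0) # g).          *)
(* Action, grading and braided comultiplication of the Nichols algebra are    *)
(* those induced from the tensor algebra, in which words are homogeneous.     *)
Record is_bosonization (K : fieldType) (gT : finGroupType)
    (M : ydModule K gT) (e : hbasis M) (H : hopfAlgebra K)
    (theta : nichols e -> gT -> H) : Prop := {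
  bos_linear : forall g, linear (theta^~ g);
  bos_bij : bijective (fun f : {ffun gT -> nichols e} => \sum_g theta (f g) g);
  bos_one : theta 1 1%g = 1;
  bos_mul : forall x y g h,
    theta (npi x) g * theta (npi y) h = theta (npi (x * tact g y)) (g * h)%g;
  bos_comul : forall x g,
    comul H (theta (npi x) g) =
      mlin (fun p => pure (theta (npi (fgen K p.1)) (wdeg p.2 * g)%g)
                          (theta (npi (fgen K p.2)) g)) (tcop x);
  bos_counit : forall x g, counit H (theta (npi x) g) = fcoef mone x
}.

(* Main.v *)
Require Import Defs.
From HB Require Import structures.
From mathcomp Require Import all_boot all_order all_algebra all_fingroup
  all_solvable all_field.
From mathcomp Require Import boolp reals complex finmap monalg.

(** Let [ep] generate the commutator subgroup. It is central of order two, so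
    the commutator is an alternating bilinear form on [G] with values in a group
    of order two. By a Gram-Schmidt argument ([symplectic_family]), [G] is the
    product of its center and of a subgroup [H] generated by pairs of elements
    [x (i, false)], [x (i, true)] whose only nontrivial commutators are those
    within a pair. The abelian group [G / H] has generators that lift to central
    elements [z j], with characters [chi j] trivial on the other generators
    ([abelian_dual_basis]).

    The module has basis vectors of degrees [x a] and [ep * x a], on which [G]
    acts by conjugation of the degrees and by the sign character [qc] with value
    -1 on all [x a], and a vector of degree [z j] on which [G] acts by [chi j].
    Its support generates [G]. The commutator [ep] acts trivially, hence sums
    and differences of the vectors of degrees [x a] and [ep * x a] are
    eigenvectors for [G], and in this new basis the braiding is diagonal. Its
    generalized Dynkin diagram is a disjoint union of points, with a root of
    unity other than 1, and of diagrams of type A_2 with all parameters -1, two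
    for each pair.

    The Nichols ideal consists of the tensors whose iterated skew derivatives
    have no constant term ([nichols_idealP]), so relations can be checked by
    differentiating. Letters of different blocks commute up to scalars
    ([letterC]), the letter of a point is nilpotent ([letterX]), and so are
    words in the two letters of a block of type A_2 ([letter_block]). Hence all
    long words vanish and the Nichols algebra has finite dimension
    ([nichols_finite_dimensional]).

    For the bosonization, the smash product of a finite-dimensional Nichols
    algebra with [K[G]], the skew derivations are extended to operators [sder k]
    obtained from the coproduct by contracting its second factor. Since they
    commute with the coproduct on the second factor and separate points together
    with the projections to the group components, the Nichols ideal is a coideal
    ([scop_kills]). The antipode exists because convolution with the identity is
    injective ([conv_id_inj]). Every subcoalgebra is stable under [sder k] and
    under the projections. Differentiating as often as possible shows that a
    nonzero subcoalgebra contains a group element ([subco_has_sgrp]), so the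
    simple subcoalgebras are the lines spanned by the elements of [G]. If a
    direct summand contains [g], it contains the whole component of [g], hence
    also [s * g] for every [s] in the support of the module; since the support
    generates [G], there is only one summand ([bosonization_indecomposable]). *)

Set Implicit Arguments.
Unset Strict Implicit.
Unset Printing Implicit Defensive.

Import GRing.Theory VectorInternalTheory.
Local Open Scope ring_scope.

(** * Supports in free modules *)

Section Supports.
Variables (K : fieldType) (W : choiceType).
Implicit Types (P : W -> Prop) (x y : freemod K W).

Definition supported P x := forall w, fcoef w x != 0 -> P w.

Lemma supported0 P : supported P 0.
Proof. by move=> w; rewrite linear0 eqxx. Qed.

Lemma supportedD P x y : supported P x -> supported P y -> supported P (x + y).
Proof.
move=> hx hy w; rewrite linearD /=.
by have [->|/hx //] := eqVneq (fcoef w x) 0; rewrite add0r => /hy.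
Qed.

Lemma supportedZ P a x : (a != 0 -> supported P x) -> supported P (a *: x).
Proof.
by move=> hx w; rewrite linearZ /= mulf_eq0 negb_or => /andP[/hx h /h].
Qed.

Lemma supported_sum P (I : Type) (r : seq I) (Q : pred I) F :
  (forall i, Q i -> supported P (F i)) ->
  supported P (\sum_(i <- r | Q i) F i).
Proof.
move=> hF; elim/big_rec: _ => [|i x Qi hx]; first exact: supported0.
by apply: supportedD => //; apply: hF.
Qed.

Lemma supported_fgen P w : P w -> supported P (fgen K w).
Proof. by move=> Pw v; rewrite fcoefU; have [<-//|_] := eqVneq w v;
  rewrite eqxx. Qed.

Lemma supportedE P x : supported P x ->
  x = \sum_(w <- msupp x | `[< P w >]) fcoef w x *: fgen K w.
Proof.
move=> hx; rewrite {1}[x]freemodE [LHS](bigID (fun w => `[< P w >])) /=.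
rewrite [X in _ + X]big1 ?addr0// => w /asboolP Pw.
by have [->|/hx //] := eqVneq (fcoef w x) 0; rewrite scale0r.
Qed.

Lemma supportedW P Q x : supported P x ->
  (forall w, P w -> Q w) -> supported Q x.
Proof. by move=> hx PQ w /hx/PQ. Qed.

Lemma freemod_ind (Q : freemod K W -> Prop) :
  Q 0 -> (forall k x y, Q x -> Q y -> Q (k *: x + y)) ->
  (forall w, Q (fgen K w)) ->
  forall x, Q x.
Proof.
move=> Q0 Qlin Qw x; rewrite [x]freemodE; elim/big_rec: _ => // w y _ Qy.
exact: Qlin.
Qed.

End Supports.

Lemma supportedM (K : fieldType) (W : monomType) (P Q R : W -> Prop)
    (x y : freemod K W) : supported P x -> supported Q y ->
  (forall v w, P v -> Q w -> R (mmul v w)) -> supported R (x * y).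
Proof.
move=> hx hy PQR; rewrite (supportedE hx) (supportedE hy) mulr_suml.
apply: supported_sum => v /asboolP Pv; rewrite mulr_sumr.
apply: supported_sum => w /asboolP Qw.
rewrite -scalerAl -scalerAr fgenM; apply: supportedZ => _;
  apply: supportedZ => _.
by apply: supported_fgen; apply: PQR.
Qed.

(** * Group action and skew derivations on the tensor algebra *)

Section TensorAlgebraTheory.
Variables (K : fieldType) (gT : finGroupType) (M : ydModule K gT).
Variable e : hbasis M.

Local Notation I := 'I_(hsize e).
Local Notation word := {fmonom I}.
Local Notation T := (freemod K word).
Local Notation d := (@hdeg _ _ _ e).

Definition acoef g (i j : I) : K :=
  coord (hvec e) j (yd_act M g (tnth (hvec e) i)).

Lemma hvec_free : free (hvec e).
Proof. exact: basis_free (hvec_basis e). Qed.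

Lemma hvec_expand (v : M) : v = \sum_j coord (hvec e) j v *: tnth (hvec e) j.
Proof.
have /coord_basis H : basis_of fullv (hvec e) by exact: hvec_basis.
rewrite {1}(H v (memvf _)); apply: eq_bigr => j _.
by rewrite (tnth_nth 0).
Qed.

Lemma act_hvec g i :
  yd_act M g (tnth (hvec e) i) = \sum_j acoef g i j *: tnth (hvec e) j.
Proof. exact: hvec_expand. Qed.

Lemma coord_hvec (i j : I) : coord (hvec e) j (tnth (hvec e) i) = (i == j)%:R.
Proof.
by rewrite (tnth_nth 0) coord_free ?hvec_free// eq_sym.
Qed.

Lemma acoefM g h i j : acoef (g * h)%g i j = \sum_k acoef h i k * acoef g k j.
Proof.
rewrite {1}/acoef yd_actM lfunE /= act_hvec !linear_sum.
by apply: eq_bigr => k _; rewrite !linearZ.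
Qed.

Lemma acoef1 i j : acoef 1%g i j = (i == j)%:R.
Proof. by rewrite /acoef yd_act1 lfunE /= coord_hvec. Qed.

Lemma coord_part (v : M) g j : v \in yd_part M g ->
  coord (hvec e) j v != 0 -> d j = g.
Proof.
move=> vg; apply: contraNeq => djg.
pose u h := \sum_(k | d k == h) coord (hvec e) k v *: tnth (hvec e) k.
have uh h : u h \in yd_part M h.
  apply: memv_suml => k /eqP <-; apply: memvZ; exact: hvec_part.
pose w h := if h == g then v else 0.
have wh h : w h \in yd_part M h.
  by rewrite /w; case: eqP => [->|_]; rewrite ?mem0v.
have uw : \sum_h u h = \sum_h w h.
  rewrite [RHS](bigD1 g)//= [in RHS]big1 => [|h /negPf hg]; last first.
    by rewrite /w hg.
  rewrite /w eqxx addr0 [RHS]hvec_expand /u.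
  by rewrite [RHS](partition_big d predT).
have /directv_sum_independent D := yd_part_direct M.
have Z : \sum_h (u h - w h) = 0 by rewrite sumrB uw subrr.
have D' h : true -> u h - w h \in yd_part M h by rewrite rpredB.
have := D _ D' Z (d j) isT; rewrite /w (negPf djg) subr0.
move=> /(congr1 (coord (hvec e) j)).
rewrite linear0 linear_sum (bigD1 j)//= linearZ /= coord_hvec eqxx mulr1.
rewrite big1 => [|k /andP[_ /negPf kj]].
  by rewrite addr0 => ->.
by rewrite linearZ /= coord_hvec kj mulr0.
Qed.

Lemma acoef_deg g i j : acoef g i j != 0 -> d j = (g * d i * g^-1)%g.
Proof.
apply: coord_part; rewrite -yd_act_part; apply: memv_img; exact: hvec_part.
Qed.

Lemma tact_genE g (i : I) : tact_gen g i = \sum_j acoef g i j *: tgen j.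
Proof. by []. Qed.

Lemma tact_tgen g (i : I) : tact g (tgen i) = tact_gen g i.
Proof. by rewrite tactU /tact_word fmuE big_seq1. Qed.

Lemma fgenS i (s : seq I) :
  fgen K (FMonom (i :: s) : word) = tgen i * fgen K (FMonom s).
Proof. by rewrite -!tgen_word big_cons. Qed.

(** Comultiplications and derivations are determined by how they behave when a
    letter is prepended, hence this form of induction. *)
Lemma tensor_ind (P : T -> Prop) : P 1 ->
  (forall a x y, P x -> P y -> P (a *: x + y)) ->
  (forall i x, P x -> P (tgen i * x)) -> forall x, P x.
Proof.
move=> P1 PD PM x; rewrite [x]freemodE.
have P0 : P 0 by rewrite -(addNr 1) -scaleN1r; exact: PD.
elim/big_rec: _ => [//|w y _ Py]; apply: PD => //.
rewrite -(fmK w); elim: (w : seq _) => [|i s IHs].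
  by rewrite -fmoneE.
by rewrite fgenS; exact: PM.
Qed.

Lemma tactMg g h (x : T) : tact (g * h)%g x = tact g (tact h x).
Proof.
elim/tensor_ind: x => [|a x y IHx IHy|i x IHx]; first by rewrite !tact1.
  by rewrite !linearP /= IHx IHy.
rewrite !tactM IHx; congr (_ * _); rewrite !tact_tgen !tact_genE linear_sum.
under eq_bigr => j _ do rewrite acoefM scaler_suml.
rewrite exchange_big; apply: eq_bigr => k _ /=.
rewrite linearZ /= tact_tgen tact_genE scaler_sumr.
by apply: eq_bigr => j _; rewrite scalerA.
Qed.

Lemma tact1g (x : T) : tact 1%g x = x.
Proof.
elim/tensor_ind: x => [|a x y IHx IHy|i x IHx]; first by rewrite tact1.
  by rewrite linearP /= IHx IHy.
rewrite tactM IHx tact_tgen tact_genE (bigD1 i)//= acoef1 eqxx scale1r.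
by rewrite big1 ?addr0// => j /negPf ji; rewrite acoef1 eq_sym ji scale0r.
Qed.

Lemma tder_cons (k i : I) x :
  tder k (tgen i * x) = (k == i)%:R *: tact (d k) x + tgen i * tder k x.
Proof. by rewrite tderM tder_gen mulr_natl scaler_nat. Qed.

(** The skew derivations transform under [G] like the dual basis of [M]. The
    twists [d k] and [g * d i * g^-1] produced by the two sides agree because
    [G] permutes the homogeneous components of [M] by conjugation. *)
Lemma tder_tact g (k : I) x :
  tder k (tact g x) = \sum_l acoef g l k *: tact g (tder l x).
Proof.
elim/tensor_ind: x => [|a x y IHx IHy|i x IHx].
- by rewrite tact1 tder1 big1// => l _; rewrite tder1 linear0 scaler0.
- rewrite !linearP /= IHx IHy scaler_sumr -big_split; apply: eq_bigr => l _ /=.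
  by do 2!rewrite linearP /=; rewrite scalerDr !scalerA mulrC.
rewrite tactM tderM IHx tact_tgen.
under [RHS]eq_bigr => l _ do rewrite tder_cons linearD /= tactM tact_tgen
  scalerDr.
rewrite big_split /= mulr_sumr; congr (_ + _); last first.
  by apply: eq_bigr => l _; rewrite scalerAr.
rewrite (bigD1 i)//= eqxx scale1r [X in _ + X]big1 => [|l /negPf li];
  last first.
  by rewrite li scale0r linear0 scaler0.
rewrite addr0 tact_genE linear_sum (bigD1 k)//= big1 => [|j /negPf jk];
  last first.
  by rewrite linearZ /= tder_gen eq_sym jk scaler0.
rewrite addr0 linearZ /= tder_gen eqxx -scalerAl mul1r.
have [->|/acoef_deg ->] := eqVneq (acoef g i k) 0; first by rewrite !scale0r.
by rewrite -!tactMg mulgKV.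
Qed.

Lemma supported_tact_word g (s : seq I) :
  supported (fun w : word => fdeg w = size s) (tact_word g s).
Proof.
elim: s => [|i s IHs].
  by rewrite /tact_word big_nil; apply: supported_fgen; rewrite /fdeg fm1.
rewrite /tact_word big_cons.
apply: (@supportedM _ _ (fun w : word => fdeg w = 1%N) _ _ _ _ _ IHs).
  apply: supported_sum => j _; apply: supportedZ => _.
  by apply: supported_fgen; rewrite /fdeg fmuE.
by move=> v w sv sw; rewrite fdegM sv sw.
Qed.

Lemma supported_tder_word (k : I) (s : seq I) :
  supported (fun w : word => (fdeg w).+1 = size s) (tder_word k s).
Proof.
elim: s => [|i s IHs]; first exact: supported0.
apply: supportedD.
  apply: supportedZ => _.
  by apply: supportedW (@supported_tact_word (d k) s) _ => w ->.
apply: (@supportedM _ _ (fun w : word => fdeg w = 1%N) _ _ _ _ _ IHs).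
  by apply: supported_fgen; rewrite /fdeg fmuE.
by move=> v w vs ws; rewrite fdegM vs add1n ws.
Qed.

End TensorAlgebraTheory.

(** * The Nichols ideal as the radical of the skew derivations *)

Section NicholsTheory.
Variables (K : fieldType) (gT : finGroupType) (M : ydModule K gT).
Variable e : hbasis M.

Local Notation I := 'I_(hsize e).
Local Notation word := {fmonom I}.
Local Notation T := (freemod K word).
Local Notation d := (@hdeg _ _ _ e).
Local Notation eps := (@fcoef K word mone).

Lemma eps_tgen (i : I) (x : T) : eps (tgen i * x) = 0.
Proof.
have: supported (fun w : word => fdeg w != 0%N) (tgen i * x).
  apply: (@supportedM _ _ (fun w => w = fmu i) (fun=> True)) => //.
    exact: supported_fgen.
  by move=> v w -> _; rewrite fdegM fdegU.
move=> h; apply/eqP; apply: contraT => /h.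
by rewrite fdeg1.
Qed.

Lemma eps1 : eps (1 : T) = 1.
Proof. by rewrite fcoefU eqxx. Qed.

Lemma epsM (x y : T) : eps (x * y) = eps x * eps y.
Proof.
elim/tensor_ind: x => [|a x z IHx IHz|i x IHx].
- by rewrite mul1r eps1 mul1r.
- by rewrite mulrDl -scalerAl !linearP /= IHx IHz mulrDl mulrA.
- by rewrite -mulrA !eps_tgen mul0r.
Qed.

Lemma eps_tact g (x : T) : eps (tact g x) = eps x.
Proof.
elim/tensor_ind: x => [|a x z IHx IHz|i x IHx].
- by rewrite tact1.
- by rewrite !linearP /= IHx IHz.
rewrite tactM epsM tact_tgen tact_genE linear_sum big1 => [|j _].
  by rewrite mul0r eps_tgen.
by rewrite linearZ /= -[tgen j]mulr1 eps_tgen mulr0.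
Qed.

Definition tders (ks : seq I) (x : T) : T := foldl (fun y k => tder k y) x ks.

Lemma tders_is_linear ks : linear (tders ks).
Proof.
elim: ks => [//|k ks IHks] a x y.
by rewrite /tders /= linearP; exact: IHks.
Qed.

HB.instance Definition _ ks :=
  GRing.isLinear.Build K T T _ (tders ks) (tders_is_linear ks).

Lemma tders_cons k ks x : tders (k :: ks) x = tders ks (tder k x).
Proof. by []. Qed.

Lemma supported_tder (n : nat) k (x : T) :
  supported (fun w : word => fdeg w < n.+1)%N x ->
  supported (fun w : word => fdeg w < n)%N (tder k x).
Proof.
move=> hx; rewrite (supportedE hx) linear_sum; apply: supported_sum => w.
move=> /asboolP wn; rewrite linearZ /=; apply: supportedZ => _.
rewrite tderU; apply: supportedW (@supported_tder_word _ _ _ e k w) _ => v vw.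
by rewrite -ltnS vw; exact: wn.
Qed.

Lemma fcoef_fmu (i : I) (x : T) : fcoef (fmu i) x = eps (tder i x).
Proof.
rewrite [x]freemodE !linear_sum; apply: eq_bigr => w _; rewrite !linearZ /=.
congr (_ * _); rewrite -(fmK w); case: (w : seq _) => [|j s].
  rewrite -fmoneE tder1 linear0 fcoefU fmuE.
  by rewrite fmoneE -val_eqE.
rewrite fgenS tder_cons linearD linearZ /= eps_tgen addr0 eps_tact -fgenS.
rewrite !fcoefU fmuE [mone]fmoneE -!val_eqE /= eqseq_cons eq_sym.
by rewrite -mulnb natrM.
Qed.

(** The radical of the pairing of the tensor algebra with the sequences of skew
    derivations. *)
Definition nkernel (x : T) : Prop := forall ks, eps (tders ks x) = 0.

Lemma nkernel_tact g x : nkernel x -> nkernel (tact g x).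
Proof.
move=> Jx ks; elim: ks x Jx => [|k ks IHks] x Jx.
  by rewrite /tders /= eps_tact; exact: (Jx [::]).
rewrite tders_cons tder_tact !linear_sum big1// => l _.
rewrite !linearZ /= IHks ?mulr0// => ls; exact: (Jx (l :: ls)).
Qed.

Lemma nkernelMr x y : nkernel x -> nkernel (x * y).
Proof.
move=> Jx ks; elim: ks x y Jx => [|k ks IHks] x y Jx.
  by rewrite /tders /= epsM (Jx [::]) mul0r.
rewrite tders_cons tderM !linearD /=.
rewrite (IHks (tder k x)) ?(IHks x) ?addr0// => ls; exact: (Jx (k :: ls)).
Qed.

(** Stability on the left uses that the radical is stable under [G], since the
    Leibniz rule twists the right factor. *)
Lemma nkernelMl x y : nkernel y -> nkernel (x * y).
Proof.
move=> Jy ks; elim: ks x y Jy => [|k ks IHks] x y Jy.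
  by rewrite /tders /= epsM (Jy [::]) mulr0.
rewrite tders_cons tderM !linearD /=.
rewrite (IHks (tder k x)); last exact: nkernel_tact.
rewrite (IHks x) ?addr0// => ls; exact: (Jy (k :: ls)).
Qed.

Lemma thomogU n (w : word) :
  thomog n (fgen K w) = if fdeg w == n then fgen K w else 0 :> T.
Proof. exact: mlinU. Qed.

Lemma thomog_supported m n (x : T) : supported (fun w : word => fdeg w = m) x ->
  thomog n x = if m == n then x else 0.
Proof.
move=> hx; rewrite (supportedE hx) linear_sum.
have [->|/negPf mn] := eqVneq m n; last first.
  rewrite big1// => w /asboolP wm.
  by rewrite linearZ /= thomogU wm mn scaler0.
by apply: eq_bigr => w /asboolP wm; rewrite linearZ /= thomogU wm eqxx.
Qed.

Lemma tder_deg (k : I) (w : word) :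
  supported (fun v : word => (fdeg v).+1 = fdeg w) (tder k (fgen K w)).
Proof. by rewrite tderU; exact: supported_tder_word. Qed.

Lemma tder_thomogS (k : I) n (x : T) : tder k (thomog n.+1 x) = thomog n (tder
  k x).
Proof.
move: x; apply: (linear_freemod_ext (f := tder k \o @thomog _ _ _ e n.+1 :
  {linear T -> T})
   (g := @thomog _ _ _ e n \o tder k : {linear T -> T})) => w /=.
have hw := @tder_deg k w.
rewrite thomogU; case: (fdeg w) (erefl (fdeg w)) hw => [|m] wm hw.
  rewrite linear0; have ->: tder k (fgen K w) = 0.
    by apply: fcoefP => v; rewrite linear0; apply/eqP; apply: contraT => /hw.
  by rewrite linear0.
rewrite eqSS (@thomog_supported m); last by apply: supportedW hw _ => v [].
by case: ifP; rewrite ?linear0.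
Qed.

Lemma tder_thomog0 (k : I) (x : T) : tder k (thomog 0 x) = 0.
Proof.
move: x; apply: (linear_freemod_ext (f := tder k \o @thomog _ _ _ e 0 : {linear
  T -> T})
   (g := \0 : {linear T -> T})) => w /=.
rewrite thomogU; case: eqP => [w0|_]; last by rewrite linear0.
apply: fcoefP => v; rewrite linear0; apply/eqP; apply: contraT => /tder_deg.
by rewrite w0.
Qed.

Lemma eps_thomog n (x : T) : eps (thomog n x) = if 0%N == n then eps x else 0.
Proof.
rewrite [x]freemodE !linear_sum /=.
have H (w : word) : eps (thomog n (fgen K w)) = if 0%N == n then eps (fgen K w)
  else 0.
  rewrite thomogU fcoefU; have [<-|wn] := eqVneq (fdeg w) n.
    by rewrite fcoefU [0%N == _]eq_sym fdeg_eq0; case: eqP.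
  rewrite linear0; case: eqP => // n0; case: eqP => // w1.
  by rewrite -n0 w1 fdeg1 eqxx in wn.
case: ifP H => n0 H; last first.
  by rewrite big1// => w _; rewrite !linearZ /= H mulr0.
by apply: eq_bigr => w _; rewrite !linearZ /= H.
Qed.

Lemma eps_tders_thomog n ks (x : T) :
  eps (tders ks (thomog n x)) = if size ks == n then eps (tders ks x) else 0.
Proof.
elim: ks n x => [|k ks IHks] n x /=; first exact: eps_thomog.
case: n => [|n].
  by rewrite tder_thomog0 linear0 linear0.
by rewrite tder_thomogS IHks.
Qed.

Lemma tders_long ks (x : T) n : (forall w : word, fcoef w x != 0 ->
  (fdeg w < n)%N) ->
  (n <= size ks)%N -> tders ks x = 0.
Proof.
elim: ks n x => [|k ks IHks] n x hx.
  rewrite leqn0 => /eqP n0; apply: fcoefP => w; rewrite linear0.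
  by apply/eqP; apply: contraT => /hx; rewrite n0.
case: n hx => [|n] hx nks.
  suff -> : x = 0 by rewrite linear0.
  by apply: fcoefP => w; rewrite linear0; apply/eqP; apply: contraT => /hx.
apply: (IHks n) => //; exact: supported_tder.
Qed.

Lemma nkernel_admissible : nichols_admissible nkernel.
Proof.
split.
- by move=> ks; rewrite !linear0.
- by move=> x y Jx Jy ks; rewrite !linearB /= Jx Jy subrr.
- by move=> a x; apply: nkernelMl.
- by move=> a x; apply: nkernelMr.
- by move=> n x Jx ks; rewrite eps_tders_thomog Jx if_same.
- move=> x w Jx; rewrite /fdeg -(fmK w); case: (w : seq _) => [|i [|//]] _.
    by have := Jx [::]; rewrite -fmoneE.
  have := Jx [:: i]; rewrite /tders /= -fmuE => <-; exact: fcoef_fmu.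
- by move=> k x Jx ks; exact: (Jx (k :: ks)).
Qed.

(** An admissible ideal contains no constants and is stable under the skew
    derivations, so it lies in the radical, which is admissible itself. *)
Lemma nichols_idealP (x : T) : @nichols_ideal _ _ _ e x <-> nkernel x.
Proof.
split=> [[J hJ Jx] ks|]; last by exists nkernel => //;
  exact: nkernel_admissible.
elim: ks x Jx => [|k ks IHks] x Jx.
  by apply: (adm_deg hJ Jx); rewrite fdeg1.
by apply: IHks; exact: adm_der.
Qed.

(** All relations of the Nichols algebra below are verified in this way. *)
Lemma nichols_ideal_der (x : T) : eps x = 0 ->
  (forall k, nichols_ideal (tder k x)) -> nichols_ideal x.
Proof.
move=> x0 Jx; apply/nichols_idealP => -[//|k ks].
by have /nichols_idealP/(_ ks) := Jx k.
Qed.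

End NicholsTheory.

(** * Coordinates on finite-dimensional modules *)

Section FiniteDimension.
Variable K : fieldType.

Lemma finite_dimensional_surjP (V : lmodType K) : finite_dimensional V ->
  exists n (f : {linear 'rV[K]_n -> V}), forall v, exists u, v = f u.
Proof.
case=> s hs; exists (size s).
pose f (u : 'rV[K]_(size s)) := \sum_i u 0 i *: s`_i.
have lf : linear f.
  move=> a u v; rewrite /f scaler_sumr -big_split; apply: eq_bigr => i _ /=.
  by rewrite !mxE scalerDl scalerA.
pose F : {linear 'rV[K]_(size s) -> V} :=
  HB.pack f (GRing.isLinear.Build K _ V _ f lf).
exists F => v; have [c ->] := hs v; exists (\row_i c i).
by apply: eq_bigr => i _; rewrite mxE.
Qed.

(** A surjection from a coordinate space that is not injective factors through a
    hyperplane, which has smaller dimension. *)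
Lemma finite_dimensional_axiom (V : lmodType K) : finite_dimensional V ->
  exists n, inhabited (Vector.axiom n V).
Proof.
move/finite_dimensional_surjP => [n].
elim/ltn_ind: n => n IHn [f fsurj].
have [fK|/existsNP[u]] := pselect (forall u, f u = 0 -> u = 0).
  have [g fg] := boolp.choice fsurj.
  have gf u : g (f u) = u.
    by apply/eqP; rewrite -subr_eq0; apply/eqP/fK; rewrite linearB /= -fg subrr.
  exists n; constructor; exists g; last by exists f.
  move=> a u v; apply/eqP; rewrite -subr_eq0; apply/eqP/fK.
  by rewrite linearB linearP /= -!fg subrr.
move=> /not_implyP[fu0 /eqP u0].
have ru : (\rank (u^C)%MS < n)%N.
  rewrite mxrank_compl rank_rV u0 subn1 ltn_predL.
  by case: (n) (u) u0 => // u'; rewrite thinmx0 eqxx.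
apply: IHn ru _; exists (f \o mulmxr (row_base u^C)%MS).
move=> v; have [w ->] := fsurj v.
have /sub_addsmxP[c wE] : (w <= u + u^C)%MS.
  by apply: submx_full; exact: addsmx_compl_full.
have /submxP[c' cE] : (c.2 *m u^C <= row_base (u^C))%MS.
  by rewrite eq_row_base submxMl.
exists c'; rewrite /= -cE wE (mx11_scalar c.1) mul_scalar_mx linearD linearZ /=.
by rewrite fu0 scaler0 add0r.
Qed.

End FiniteDimension.

(** * Action and skew derivations on the Nichols algebra *)

Section Descent.
Variables (K : fieldType) (gT : finGroupType) (M : ydModule K gT).
Variable e : hbasis M.

Local Notation I := 'I_(hsize e).
Local Notation word := {fmonom I}.
Local Notation T := (freemod K word).
Local Notation B := (nichols e).
Local Notation d := (@hdeg _ _ _ e).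
Local Notation eps := (@fcoef K word mone).

Local Notation npi := (@npi K gT M e).

Lemma npi_eq0 x : npi x = 0 <-> nichols_ideal x.
Proof.
rewrite -{2}(subr0 x); split; first by rewrite -(raddf0 (npi)) => /npi_eq.
by move=> /npi_eq ->; rewrite raddf0.
Qed.

Definition ndesc (V : lmodType K) (f : T -> V) (u : B) : V := f (nrepr u).

Section LinearDescent.
Variables (V : lmodType K) (f : {linear T -> V}).
Hypothesis f0 : forall x, nichols_ideal x -> f x = 0.

Lemma ndescE x : ndesc f (npi x) = f x.
Proof.
apply/eqP; rewrite -subr_eq0 -linearB; apply/eqP/f0/npi_eq.
by rewrite nreprK.
Qed.

Lemma ndesc_is_linear : linear (ndesc f).
Proof.
move=> a u v; rewrite -(nreprK u) -(nreprK v) -linearP !ndescE.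
exact: linearP.
Qed.

End LinearDescent.

Lemma nichols_ideal_tact g x : @nichols_ideal _ _ _ e x ->
  nichols_ideal (tact g x).
Proof. by move=> /nichols_idealP Jx; apply/nichols_idealP/nkernel_tact. Qed.

Lemma nichols_ideal_tder k x : @nichols_ideal _ _ _ e x ->
  nichols_ideal (tder k x).
Proof. by apply: adm_der; exact: nichols_ideal_admissible. Qed.

Lemma npi_tact_kills g x : nichols_ideal x -> (npi \o tact g) x = 0.
Proof. by move=> Jx; apply/npi_eq0; exact: nichols_ideal_tact. Qed.

Lemma npi_tder_kills k x : nichols_ideal x -> (npi \o tder k) x = 0.
Proof. by move=> Jx; apply/npi_eq0; exact: nichols_ideal_tder. Qed.

Definition tpair ks (x : T) : K^o := eps (tders ks x).

Lemma tpair_is_linear ks : linear (tpair ks).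
Proof. by move=> a x y; rewrite /tpair !linearP. Qed.

HB.instance Definition _ ks :=
  GRing.isLinear.Build K T K^o _ (tpair ks) (tpair_is_linear ks).

Lemma tpair_kills ks x : @nichols_ideal _ _ _ e x -> tpair ks x = 0.
Proof. by move/nichols_idealP => Jx; exact: Jx. Qed.

Definition nact g : B -> B := ndesc (npi \o tact g).
Definition nder k : B -> B := ndesc (npi \o tder k).
Definition npair ks : B -> K^o := ndesc (tpair ks).

HB.instance Definition _ g :=
  GRing.isLinear.Build K B B _ (nact g) (ndesc_is_linear (@npi_tact_kills g)).
HB.instance Definition _ k :=
  GRing.isLinear.Build K B B _ (nder k) (ndesc_is_linear (@npi_tder_kills k)).
HB.instance Definition _ ks :=
  GRing.isLinear.Build K B K^o _ (npair ks) (ndesc_is_linear (@tpair_kills ks)).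

Lemma nact_pi g x : nact g (npi x) = npi (tact g x).
Proof. by rewrite /nact (ndescE (@npi_tact_kills g)). Qed.

Lemma nder_pi k x : nder k (npi x) = npi (tder k x).
Proof. by rewrite /nder (ndescE (@npi_tder_kills k)). Qed.

Lemma npair_pi ks x : npair ks (npi x) = eps (tders ks x).
Proof. by rewrite /npair (ndescE (@tpair_kills ks)). Qed.

Lemma nactM g u v : nact g (u * v) = nact g u * nact g v.
Proof.
by rewrite -(nreprK u) -(nreprK v) -rmorphM !nact_pi tactM rmorphM.
Qed.

Lemma nact1 g : nact g 1 = 1.
Proof. by rewrite -(rmorph1 (npi)) nact_pi tact1. Qed.

Lemma nact1g u : nact 1%g u = u.
Proof. by rewrite -(nreprK u) nact_pi tact1g. Qed.

Lemma nactMg g h u : nact (g * h)%g u = nact g (nact h u).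
Proof. by rewrite -(nreprK u) !nact_pi tactMg. Qed.

Lemma npair_cons k ks u : npair (k :: ks) u = npair ks (nder k u).
Proof. by rewrite -(nreprK u) nder_pi !npair_pi. Qed.

Lemma npair_sep u : (forall ks, npair ks u = 0) -> u = 0.
Proof.
rewrite -(nreprK u) => u0; apply/npi_eq0/nichols_idealP => ks.
by rewrite -npair_pi u0.
Qed.

(** The difference of the two sides pairs to zero with every sequence of skew
    derivations: the empty one reads off the constant term, and the others kill
    both sides. *)
Lemma nder0_scalar u : (forall k, nder k u = 0) ->
  u = (npair [::] u : K) *: (1 : B).
Proof.
move=> u0; apply/eqP; rewrite -subr_eq0; apply/eqP/npair_sep => ks.
rewrite linearB linearZ /= -(rmorph1 npi) npair_pi; case: ks => [|k ks].
  by rewrite /tders /= eps1 [_ *: _]mulr1 subrr.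
rewrite npair_cons u0 linear0 tders_cons tder1 !linear0.
by rewrite addr0.
Qed.

End Descent.

(** * The smash product with the group algebra *)

(** In the smash product of the Nichols algebra with [K[G]], [theta u g] stands
    for [u # g], and [gcoef g] reads off the coefficient of [g]. The Hopf
    structure is derived from these equations alone. *)
Record smash_product (K : fieldType) (gT : finGroupType) (M : ydModule K gT)
    (e : hbasis M) := SmashProduct {
  smash_alg :> falgType K;
  theta : nichols e -> gT -> smash_alg;
  gcoef : gT -> smash_alg -> nichols e;
  theta_is_linear : forall g, linear (theta^~ g);
  gcoef_is_linear : forall g, linear (gcoef g);
  gcoef_theta : forall h u g, gcoef h (theta u g) = if h == g then u else 0;
  theta_expand : forall a, a = \sum_g theta (gcoef g a) g;
  theta_one : theta 1 1%g = 1;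
  theta_mul : forall u g v h,
    theta u g * theta v h = theta (u * nact g v) (g * h)%g
}.

Section SmashProduct.
Variables (K : fieldType) (gT : finGroupType) (M : ydModule K gT).
Variable e : hbasis M.

Local Notation I := 'I_(hsize e).
Local Notation B := (nichols e).
Local Notation d := (@hdeg _ _ _ e).
Local Notation npi := (@npi K gT M e).

Definition smash of finite_dimensional B : Type := {ffun gT -> B}.

Variable fd : finite_dimensional B.
Local Notation H := (smash fd).

HB.instance Definition _ := GRing.Lmodule.on H.

Implicit Types a b c : H.

Definition scoord (g : gT) (a : H) : B := (a : {ffun gT -> B}) g.

Lemma scoord_is_linear g : linear (scoord g).
Proof. by move=> k a b; rewrite /scoord !ffunE. Qed.

HB.instance Definition _ g :=
  GRing.isLinear.Build K H B _ (scoord g) (scoord_is_linear g).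

Lemma scoordP a b : (forall g, scoord g a = scoord g b) -> a = b.
Proof. by move=> ab; apply/ffunP. Qed.

Definition smash_mul a b : H :=
  [ffun k => \sum_g scoord g a * nact g (scoord (g^-1 * k)%g b)].

Definition smash_one : H := [ffun k => if k == 1%g then 1 else 0].

Lemma scoord_mul k a b :
  scoord k (smash_mul a b) = \sum_g scoord g a * nact g (scoord (g^-1 * k)%g b).
Proof. by rewrite /scoord ffunE. Qed.

Lemma scoord_one k : scoord k smash_one = if k == 1%g then 1 else 0.
Proof. by rewrite /scoord ffunE. Qed.

Lemma smash_mulA : associative smash_mul.
Proof.
move=> a b c; apply: scoordP => k; rewrite !scoord_mul.
under eq_bigr => g _ do rewrite scoord_mul linear_sum mulr_sumr.
under [RHS]eq_bigr => g _ do rewrite scoord_mul mulr_suml.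
rewrite [RHS]exchange_big; apply: eq_bigr => g _ /=.
rewrite [RHS](reindex_inj (mulgI g)); apply: eq_bigr => h _.
by rewrite nactM -nactMg mulrA mulKg invMg mulgA.
Qed.

Lemma smash_mul1 : left_id smash_one smash_mul.
Proof.
move=> a; apply: scoordP => k; rewrite scoord_mul (bigD1 1%g)//= big1 =>
  [|g /negPf g1].
  by rewrite addr0 /scoord ffunE eqxx mul1r nact1g invg1 mul1g.
by rewrite {1}/scoord ffunE g1 mul0r.
Qed.

Lemma smash_mulr1 : right_id smash_one smash_mul.
Proof.
move=> a; apply: scoordP => k; rewrite scoord_mul (bigD1 k)//= big1 =>
  [|g /negPf gk].
  by rewrite addr0 {2}/scoord ffunE mulVg eqxx nact1 mulr1.
by rewrite {2}/scoord ffunE -eq_invg_mul invgK gk linear0 mulr0.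
Qed.

Lemma smash_mulDl : left_distributive smash_mul +%R.
Proof.
move=> a b c; apply: scoordP => k; rewrite linearD /= !scoord_mul -big_split.
by apply: eq_bigr => g _; rewrite linearD mulrDl.
Qed.

Lemma smash_mulDr : right_distributive smash_mul +%R.
Proof.
move=> a b c; apply: scoordP => k; rewrite linearD /= !scoord_mul -big_split.
by apply: eq_bigr => g _; rewrite !linearD mulrDr.
Qed.

Lemma smash_oner_neq0 : smash_one != 0.
Proof.
apply/eqP => /(congr1 (scoord 1%g)); rewrite linear0 /scoord ffunE eqxx.
exact/eqP/oner_neq0.
Qed.

HB.instance Definition _ := GRing.Zmodule_isNzRing.Build H
  smash_mulA smash_mul1 smash_mulr1 smash_mulDl smash_mulDr smash_oner_neq0.

Lemma smash_scaleAl (k : K) a b : k *: (a * b) = k *: a * b.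
Proof.
apply: scoordP => h; rewrite linearZ /= [a * b]/(smash_mul a b).
rewrite -[k *: a * b]/(smash_mul (k *: a) b) !scoord_mul scaler_sumr.
by apply: eq_bigr => g _; rewrite linearZ /= scalerAl.
Qed.

HB.instance Definition _ := GRing.Lmodule_isLalgebra.Build K H smash_scaleAl.

Lemma smash_scaleAr (k : K) a b : k *: (a * b) = a * (k *: b).
Proof.
apply: scoordP => h; rewrite linearZ /= [a * b]/(smash_mul a b).
rewrite -[a * (k *: b)]/(smash_mul a (k *: b)) !scoord_mul scaler_sumr.
by apply: eq_bigr => g _; rewrite !linearZ /= scalerAr.
Qed.

HB.instance Definition _ := GRing.Lalgebra_isAlgebra.Build K H smash_scaleAr.

Lemma smash_vector_axiom : exists n, inhabited (Vector.axiom n H).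
Proof.
have [n [ax]] := finite_dimensional_axiom fd.
pose BV : vectType K := HB.pack B (Lmodule_hasFinDim.Build K B ax).
exists (dim {ffun gT -> BV}); constructor.
exists (@v2r K {ffun gT -> BV}).
  move=> k u v; exact: (linearP (@v2r K {ffun gT -> BV}) k u v).
exists (@r2v K {ffun gT -> BV}); first exact: (@v2rK K {ffun gT -> BV}).
exact: (@r2vK K {ffun gT -> BV}).
Qed.

Definition smash_dim : nat := sval (cid smash_vector_axiom).

Lemma smash_dim_axiom : inhabited (Vector.axiom smash_dim H).
Proof. exact: svalP (cid smash_vector_axiom). Qed.

HB.instance Definition _ :=
  Lmodule_hasFinDim.Build K H (inhabited_witness smash_dim_axiom).
HB.instance Definition _ := Algebra_isFalgebra.Build K H.

Definition stheta (u : B) (g : gT) : H := [ffun h => if h == g then u else 0].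

Lemma scoord_theta h u g : scoord h (stheta u g) = if h == g then u else 0.
Proof. by rewrite /scoord ffunE. Qed.

Lemma stheta_is_linear g : linear (stheta^~ g).
Proof.
move=> k u v; apply: scoordP => h; rewrite linearP /= !scoord_theta.
by case: ifP; rewrite ?scaler0 ?addr0.
Qed.

Lemma stheta_expand a : a = \sum_g stheta (scoord g a) g.
Proof.
apply: scoordP => h; rewrite linear_sum (bigD1 h)//= scoord_theta eqxx big1
  ?addr0//.
by move=> g /negPf gh; rewrite scoord_theta eq_sym gh.
Qed.

Lemma stheta_one : stheta 1 1%g = 1.
Proof. by apply: scoordP => h; rewrite scoord_theta; rewrite -scoord_one. Qed.

Lemma stheta_mul u g v h : stheta u g * stheta v h = stheta (u * nact g v) (g *
  h)%g.
Proof.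
apply: scoordP => k; rewrite [_ * _ in LHS]/(smash_mul _ _) scoord_mul.
rewrite (bigD1 g)//= big1 ?addr0 => [|g' /negPf g'g]; last first.
  by rewrite scoord_theta g'g mul0r.
rewrite !scoord_theta eqxx -(inj_eq (mulgI g)) mulKVg; case: ifP => // _.
by rewrite linear0 mulr0.
Qed.

Definition concrete_smash : smash_product e :=
  SmashProduct stheta_is_linear scoord_is_linear scoord_theta stheta_expand
    stheta_one stheta_mul.

End SmashProduct.

(** * Operators on the smash product *)

Section SmashStructure.
Variables (K : fieldType) (gT : finGroupType) (M : ydModule K gT).
Variable e : hbasis M.
Variable H : smash_product e.

Local Notation I := 'I_(hsize e).
Local Notation B := (nichols e).
Local Notation d := (@hdeg _ _ _ e).
Local Notation npi := (@npi K gT M e).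
Local Notation theta := (@theta K gT M e H).
Local Notation gcoef := (@gcoef K gT M e H).
Implicit Types a b : H.

HB.instance Definition _ g :=
  GRing.isLinear.Build K H B _ (gcoef g)
    (@gcoef_is_linear K gT M e H g).

Lemma gcoefP a b : (forall g, gcoef g a = gcoef g b) -> a = b.
Proof.
move=> ab; rewrite (theta_expand a) (theta_expand b).
by apply: eq_bigr => g _; rewrite ab.
Qed.

Fact smash_key : unit. Proof. by []. Qed.

Definition sgen : I -> H :=
  locked_with smash_key (fun i => theta (npi (tgen i)) 1%g).
Definition sgrp : gT -> H := locked_with smash_key (theta 1).

Lemma sgenE i : sgen i = theta (npi (tgen i)) 1%g.
Proof. by rewrite /sgen unlock. Qed.

Lemma sgrpE g : sgrp g = theta 1 g.
Proof. by rewrite /sgrp unlock. Qed.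

Lemma thetaP g k u v : theta (k *: u + v) g = k *: theta u g + theta v g.
Proof. exact: theta_is_linear. Qed.

Lemma theta0 g : theta 0 g = 0.
Proof. by apply: gcoefP => h; rewrite gcoef_theta linear0 if_same. Qed.

Lemma sgrp1 : sgrp 1%g = 1.
Proof. by rewrite sgrpE theta_one. Qed.

Lemma sgrp_theta h x g : sgrp h * theta (npi x) g = theta (npi (tact h x)) (h *
  g)%g.
Proof. by rewrite sgrpE theta_mul mul1r nact_pi. Qed.

Lemma sgrpM g h : sgrp g * sgrp h = sgrp (g * h)%g.
Proof. by rewrite !sgrpE theta_mul nact1 mulr1. Qed.

Lemma sgen_theta i x g : sgen i * theta (npi x) g = theta (npi (tgen i * x)) g.
Proof. by rewrite sgenE theta_mul mul1g nact1g rmorphM. Qed.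

Lemma smash_theta_ind (P : H -> Prop) :
  (forall k a b, P a -> P b -> P (k *: a + b)) ->
  (forall x g, P (theta (npi x) g)) -> forall a, P a.
Proof.
move=> Plin Pth a; rewrite (theta_expand a); elim/big_rec: _ => [|g b _ Pb].
  by rewrite -(theta0 1%g) -(raddf0 npi); exact: Pth.
by rewrite -[theta _ g]scale1r; apply: Plin => //;
  rewrite -(nreprK (gcoef g a)); exact: Pth.
Qed.

(** The commutation of group elements with generators moves all the group
    elements of a word to its right end. *)
Lemma smash_ind (P : H -> Prop) :
  (forall k a b, P a -> P b -> P (k *: a + b)) ->
  (forall g, P (sgrp g)) -> (forall i a, P a -> P (sgen i * a)) ->
    forall a, P a.
Proof.
move=> Plin Pg Pe; apply: smash_theta_ind => // x g.
elim/tensor_ind: x => [|k x y Px Py|i x Px].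
- by rewrite rmorph1 -sgrpE; exact: Pg.
- by rewrite linearP /= thetaP; exact: Plin.
- by rewrite -sgen_theta; exact: Pe.
Qed.

Lemma sgrp_gen g i : sgrp g * sgen i = \sum_j acoef g i j *: (sgen j * sgrp g).
Proof.
rewrite sgenE sgrp_theta mulg1 tact_tgen tact_genE.
apply: gcoefP => h; rewrite gcoef_theta !linear_sum /=.
have E j : gcoef h (acoef g i j *: (sgen j * sgrp g)) =
   if h == g then acoef g i j *: npi (tgen j) else 0.
  rewrite linearZ /= sgrpE -(rmorph1 npi) sgen_theta mulr1 gcoef_theta.
  by case: ifP => //; rewrite scaler0.
under [RHS]eq_bigr => j _ do rewrite E.
case: ifP => _; last by rewrite big1.
by apply: eq_bigr => j _; rewrite linearZ.
Qed.

(** This extension of the skew derivation is [id (x) e_k^*] after the coproduct,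
    where [e_k^*] is the coordinate of [e_k # g] summed over [g]; this explains
    the factor [d k], and why [sder k] preserves subcoalgebras. *)
Definition sder k a : H := \sum_h theta (nder k (gcoef h a)) (d k * h)%g.

Lemma gcoef_sder h k a : gcoef h (sder k a) = nder k (gcoef ((d k)^-1 * h)%g a).
Proof.
rewrite /sder linear_sum (bigD1 ((d k)^-1 * h)%g)//= gcoef_theta mulKVg eqxx.
rewrite big1 ?addr0// => g /negPf gh; rewrite gcoef_theta.
by rewrite -(inj_eq (mulgI (d k)^-1%g)) mulKg eq_sym gh.
Qed.

Lemma sder_is_linear k : linear (sder k).
Proof. by move=> c a b; apply: gcoefP => h;
  rewrite !linearP /= !gcoef_sder !linearP. Qed.

HB.instance Definition _ k := GRing.isLinear.Build K H H _ (sder k)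
  (sder_is_linear k).

Lemma sder_theta k u g : sder k (theta u g) = theta (nder k u) (d k * g)%g.
Proof.
apply: gcoefP => h; rewrite gcoef_sder !gcoef_theta -(inj_eq (mulgI (d k)))
  mulKVg.
by case: ifP => // _; rewrite linear0.
Qed.

Lemma sder_grp k g : sder k (sgrp g) = 0.
Proof. by rewrite sgrpE sder_theta -(rmorph1 npi) nder_pi tder1 raddf0 theta0.
  Qed.

Lemma sder_gen k i a :
  sder k (sgen i * a) = (k == i)%:R *: (sgrp (d k) * a) + sgen i * sder k a.
Proof.
elim/smash_theta_ind: a => [c a b IHa IHb|x g].
  rewrite mulrDr -scalerAr !linearP /= IHa IHb mulrDr -scalerAr mulrDr
    -scalerAr.
  by rewrite !scalerDr !scalerA [_ * c]mulrC addrACA.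
rewrite sgen_theta !sder_theta !nder_pi tder_cons sgrp_theta sgen_theta.
by rewrite linearP thetaP.
Qed.

Definition sproj g a : H := theta (gcoef g a) g.

Lemma sproj_is_linear g : linear (sproj g).
Proof. by move=> c a b; rewrite /sproj linearP thetaP. Qed.

HB.instance Definition _ g := GRing.isLinear.Build K H H _ (sproj g)
  (sproj_is_linear g).

Lemma sproj_theta g u h : sproj g (theta u h) = if g == h then theta u h else 0.
Proof. by rewrite /sproj gcoef_theta; case: eqP => [->|]; rewrite ?theta0. Qed.

Lemma sproj_grp g h : sproj g (sgrp h) = if g == h then sgrp h else 0.
Proof. by rewrite sgrpE; exact: sproj_theta. Qed.

Lemma sproj_gen g i a : sproj g (sgen i * a) = sgen i * sproj g a.
Proof.
elim/smash_theta_ind: a => [c a b IHa IHb|x h].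
  by rewrite mulrDr -scalerAr !linearP /= IHa IHb mulrDr -scalerAr.
by rewrite sgen_theta !sproj_theta; case: ifP; rewrite ?sgen_theta ?mulr0.
Qed.

Lemma sproj_sum a : a = \sum_g sproj g a.
Proof. exact: theta_expand. Qed.

Lemma sproj_sproj g h a : sproj g (sproj h a) = if g == h then sproj h a else 0.
Proof. exact: sproj_theta. Qed.

Lemma sproj_sder k g a : sproj (d k * g)%g (sder k a) = sder k (sproj g a).
Proof. by rewrite /sproj sder_theta gcoef_sder mulKg. Qed.

Definition seps a : K^o := \sum_g npair [::] (gcoef g a).

Lemma seps_is_linear : linear seps.
Proof.
move=> c a b; rewrite /seps scaler_sumr -big_split; apply: eq_bigr => g _ /=.
by rewrite !linearP.
Qed.

HB.instance Definition _ := GRing.isLinear.Build K H K^o _ seps seps_is_linear.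

Lemma seps_theta u g : seps (theta u g) = npair [::] u.
Proof.
rewrite /seps (bigD1 g)//= gcoef_theta eqxx big1 ?addr0// => h /negPf hg.
by rewrite gcoef_theta hg linear0.
Qed.

Lemma seps_grp g : seps (sgrp g) = 1.
Proof. by rewrite sgrpE seps_theta -(rmorph1 npi) npair_pi /tders /= eps1. Qed.

Lemma seps_gen i a : seps (sgen i * a) = 0.
Proof.
elim/smash_theta_ind: a => [c a b IHa IHb|x h].
  by rewrite mulrDr -scalerAr linearP /= IHa IHb scaler0 addr0.
by rewrite sgen_theta seps_theta npair_pi /tders /= eps_tgen.
Qed.

Definition sders ks a : H := foldl (fun b k => sder k b) a ks.

Lemma sders_is_linear ks : linear (sders ks).
Proof.
elim: ks => [//|k ks IHks] c a b.
by rewrite /sders /= linearP; exact: IHks.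
Qed.

HB.instance Definition _ ks :=
  GRing.isLinear.Build K H H _ (sders ks) (sders_is_linear ks).

Lemma sders_cat ks ls a : sders (ks ++ ls) a = sders ls (sders ks a).
Proof. exact: foldl_cat. Qed.

Lemma sders_cons k ks a : sders (k :: ks) a = sders ks (sder k a).
Proof. by []. Qed.

Lemma sders_rcons k ks a : sders (rcons ks k) a = sder k (sders ks a).
Proof. by rewrite -cats1 sders_cat. Qed.

Lemma seps_sders ks u g : seps (sders ks (theta u g)) = npair ks u.
Proof.
elim: ks u g => [|k ks IHks] u g; first exact: seps_theta.
by rewrite sders_cons sder_theta IHks npair_cons.
Qed.

Lemma smash_sep a : (forall ks g, seps (sders ks (sproj g a)) = 0) -> a = 0.
Proof.
move=> a0; apply: gcoefP => g; rewrite linear0; apply: npair_sep => ks.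
by rewrite -(seps_sders ks (gcoef g a) g); exact: a0.
Qed.

Lemma sder0_grp a : (forall k, sder k a = 0) ->
  a = \sum_g (seps (sproj g a) : K) *: sgrp g.
Proof.
move=> a0; rewrite {1}(sproj_sum a); apply: eq_bigr => g _.
rewrite seps_theta sgrpE /sproj; set u := gcoef g a.
have {1}-> : u = (npair [::] u : K) *: (1 : B).
  apply: nder0_scalar => k; rewrite -(mulKg (d k) g) in u *.
  by rewrite /u -gcoef_sder a0 linear0.
apply: gcoefP => h; rewrite linearZ /= !gcoef_theta.
by case: ifP => // _; rewrite scaler0.
Qed.

Lemma sders_theta ks x g :
  exists h, sders ks (theta (npi x) g) = theta (npi (tders ks x)) h.
Proof.
elim: ks x g => [|k ks IHks] x g; first by exists g.
by rewrite sders_cons sder_theta nder_pi; exact: IHks.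
Qed.

Lemma sders_finite a : exists n, forall ks, (n <= size ks)%N -> sders ks a = 0.
Proof.
elim/smash_theta_ind: a => [c a b [m am] [n bn]|x g].
  exists (maxn m n) => ks; rewrite geq_max => /andP[mk nk].
  by rewrite linearP /= am ?bn// scaler0 addr0.
exists (\max_(w <- msupp x) fdeg w).+1 => ks hn.
have [h ->] := sders_theta ks x g.
rewrite (tders_long (x := x) _ hn) ?raddf0 ?theta0// => w w0.
rewrite ltnS; apply: (leq_bigmax_seq (F := fun w : {fmonom I} => fdeg w)) => //.
by rewrite -mcoeff_neq0.
Qed.

End SmashStructure.

(** * Tensor products of linear maps *)

Definition lmul (K : fieldType) (A : algType K) (a x : A) : A := a * x.

Lemma lmul_is_linear (K : fieldType) (A : algType K) (a : A) : linear (lmul a).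
Proof. by move=> k x y; rewrite /lmul mulrDr scalerAr. Qed.

HB.instance Definition _ (K : fieldType) (A : algType K) (a : A) :=
  GRing.isLinear.Build K A A _ (lmul a) (lmul_is_linear a).

Section TensorMaps.
Variable K : fieldType.
Implicit Types U V W : vectType K.

Lemma tlift_is_linear U V W (F : U -> V -> W) : linear (tlift F).
Proof.
move=> k s t; rewrite /tlift scaler_sumr -big_split; apply: eq_bigr => i _ /=.
rewrite scaler_sumr -big_split; apply: eq_bigr => j _ /=.
by rewrite !mxE scalerDl scalerA.
Qed.

HB.instance Definition _ U V W (F : U -> V -> W) :=
  GRing.isLinear.Build K (tens U V) W _ (tlift F) (tlift_is_linear F).

Lemma pure_linr U V (u : U) : linear (@pure K U V u).
Proof. by move=> k v w; rewrite /pure linearP /= mulmxDr scalemxAr. Qed.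

Lemma pure_linl U V (v : V) : linear ((@pure K U V)^~ v).
Proof. by move=> k u w; rewrite /pure !linearP /= mulmxDl scalemxAl. Qed.

Lemma pureZl U V k (u : U) (v : V) : pure (k *: u) v = k *: pure u v.
Proof. by rewrite /pure !linearZ /= scalemxAl. Qed.

Lemma pureZr U V k (u : U) (v : V) : pure u (k *: v) = k *: pure u v.
Proof. by rewrite /pure linearZ /= scalemxAr. Qed.

Lemma pureDl U V (u u' : U) (v : V) : pure (u + u') v = pure u v + pure u' v.
Proof. by rewrite /pure !linearD mulmxDl. Qed.

Lemma pureDr U V (u : U) (v v' : V) : pure u (v + v') = pure u v + pure u v'.
Proof. by rewrite /pure linearD mulmxDr. Qed.

Lemma pure_suml U V (J : finType) (F : J -> U) (v : V) :
  pure (\sum_j F j) v = \sum_j pure (F j) v.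
Proof. by rewrite /pure !linear_sum mulmx_suml. Qed.

Lemma pure_sumr U V (J : finType) (F : J -> V) (u : U) :
  pure u (\sum_j F j) = \sum_j pure u (F j).
Proof. by rewrite /pure linear_sum mulmx_sumr. Qed.

Lemma pure0r U V (u : U) : pure u (0 : V) = 0.
Proof. by rewrite /pure linear0 mulmx0. Qed.

Lemma pure0l U V (v : V) : pure (0 : U) v = 0.
Proof. by rewrite -(scale0r 0) pureZl scale0r. Qed.

Lemma tens_ind U V (P : tens U V -> Prop) :
  (forall k s t, P s -> P t -> P (k *: s + t)) -> (forall u v, P (pure u v)) ->
  forall t, P t.
Proof.
move=> Plin Pp t; rewrite -(tlift_pure_id t) /tlift.
have P0 : P 0.
  by rewrite -(addNr (pure 0 0)) -scaleN1r; exact: Plin.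
have PD s s' : P s -> P s' -> P (s + s').
  by move=> Ps Ps'; rewrite -[s]scale1r; exact: Plin.
elim/big_rec: _ => [//|i s _ Ps]; apply: PD => //.
elim/big_rec: _ => [//|j s' _ Ps']; exact: Plin.
Qed.

Definition bilin U V W (F : U -> V -> W) :=
  (forall u, linear (F u)) /\ (forall v, linear (F^~ v)).

Lemma tliftE U V W (F : U -> V -> W) u v :
  bilin F -> tlift F (pure u v) = F u v.
Proof. by case=> *; apply: tlift_pure. Qed.

Lemma eq_tlift U V W (F G : U -> V -> W) : (forall u v, F u v = G u v) ->
  tlift F =1 tlift G.
Proof. by move=> FG t; apply: eq_bigr => i _; apply: eq_bigr => j _;
  rewrite FG. Qed.

(** Expanded in the basis of the first factor, [t] has coefficients in the
    second one, and all the functionals vanish on them. *)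
Lemma tens_sep U V (A : Type) (psi : A -> V -> K^o) (t : tens U V) :
  (forall a, linear (psi a)) ->
  (forall v, (forall a, psi a v = 0) -> v = 0) ->
  (forall a, tlift (fun u v => (psi a v : K) *: u) t = 0) -> t = 0.
Proof.
move=> lpsi sep t0; apply/matrixP => i j; rewrite mxE.
pose v := \sum_j t i j *: vbase j : V.
have v0 : v = 0.
  apply: sep => a.
  pose L : {linear V -> K^o} := HB.pack (psi a) (GRing.isLinear.Build K V _ _
    (psi a) (lpsi a)).
  have := congr1 (fun u : U => v2r u 0 i) (t0 a); rewrite linear0 mxE => <-.
  have E i' : v2r (\sum_j t i' j *: ((psi a (vbase j) : K) *: vbase i')) 0 i =
      \sum_j t i' j * (psi a (vbase j) : K) * (i == i')%:R.
    rewrite linear_sum summxE; apply: eq_bigr => j' _.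
    by rewrite !linearZ /= /vbase r2vK !mxE eqxx mulrA.
  rewrite /tlift linear_sum summxE; under eq_bigr => i' _ do rewrite E.
  rewrite (bigD1 i)//= [X in _ + X]big1 => [|i' /negPf i'i]; last first.
    by rewrite big1// => j' _; rewrite eq_sym i'i mulr0.
  rewrite addr0 -[psi a v]/(L v) /v linear_sum; apply: eq_bigr => j' _.
  by rewrite linearZ eqxx mulr1.
have := congr1 (fun u : V => v2r u 0 j) v0; rewrite linear0 mxE => <-.
rewrite /v linear_sum summxE (bigD1 j)//= big1 => [|j' /negPf j'j]; last first.
  by rewrite linearZ /= /vbase r2vK !mxE eq_sym j'j andbF mulr0.
by rewrite addr0 linearZ /= /vbase r2vK !mxE !eqxx mulr1.
Qed.

Lemma tlift_linF U V W (F G J : U -> V -> W) k t :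
  (forall u v, F u v = k *: G u v + J u v) ->
  tlift F t = k *: tlift G t + tlift J t.
Proof.
move=> FGJ; rewrite /tlift scaler_sumr -big_split; apply: eq_bigr => i _ /=.
rewrite scaler_sumr -big_split; apply: eq_bigr => j _ /=.
by rewrite FGJ scalerDr !scalerA [k * _]mulrC.
Qed.

Fact tmap_key : unit. Proof. by []. Qed.

Definition tmap U V U' V' (f : U -> U') (g : V -> V') : tens U V ->
  tens U' V' :=
  locked_with tmap_key (tlift (fun u v => pure (f u) (g v))).

Lemma tmap_tlift U V U' V' (f : U -> U') (g : V -> V') t :
  tmap f g t = tlift (fun u v => pure (f u) (g v)) t.
Proof. by rewrite /tmap unlock. Qed.

Lemma tmap_is_linear U V U' V' (f : U -> U') (g : V -> V') : linear (tmap f g).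
Proof. by move=> k s t; rewrite !tmap_tlift linearP. Qed.

HB.instance Definition _ U V U' V' (f : U -> U') (g : V -> V') :=
  GRing.isLinear.Build K (tens U V) (tens U' V') _ (tmap f g)
    (tmap_is_linear f g).

Lemma bilin_comp U V W U' V' (F : U' -> V' -> W) (f : {linear U -> U'})
  (g : {linear V -> V'}) : bilin F -> bilin (fun u v => F (f u) (g v)).
Proof. by move=> [Fr Fl]; split=> [u|v] k x y; rewrite linearP ?Fr ?Fl. Qed.

Lemma bilin_pure U V : bilin (@pure K U V).
Proof. by split; [exact: pure_linr|exact: pure_linl]. Qed.

Lemma tmapE U V U' V' (f : {linear U -> U'}) (g : {linear V -> V'}) u v :
  tmap f g (pure u v) = pure (f u) (g v).
Proof. by rewrite tmap_tlift tliftE//; apply: bilin_comp;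
  exact: bilin_pure. Qed.

Lemma tlift_tmap U V W U' V' (F : U' -> V' -> W) (f : {linear U -> U'})
    (g : {linear V -> V'}) t : bilin F ->
  tlift F (tmap f g t) = tlift (fun u v => F (f u) (g v)) t.
Proof.
move=> bF; elim/tens_ind: t => [k s t IHs IHt|u v];
  first by rewrite !linearP /= IHs IHt.
by rewrite tmapE !tliftE//; exact: bilin_comp.
Qed.

End TensorMaps.

(** * The coproduct on words *)

Section BraidedComultiplication.
Variables (K : fieldType) (gT : finGroupType) (M : ydModule K gT).
Variable e : hbasis M.
Variable H : smash_product e.

Local Notation I := 'I_(hsize e).
Local Notation word := {fmonom I}.
Local Notation T := (freemod K word).
Local Notation T2 := (freemod K (word * word)%type).
Local Notation B := (nichols e).
Local Notation d := (@hdeg _ _ _ e).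
Local Notation npi := (@npi K gT M e).
Local Notation theta := (@theta K gT M e H).
Local Notation sgen := (@sgen K gT M e H).
Local Notation sgrp := (@sgrp K gT M e H).

Lemma eq_mlin (W : choiceType) (V : lmodType K) (f g : W -> V) :
  f =1 g -> mlin f =1 mlin g.
Proof. by move=> fg x; rewrite !mlinE; apply: eq_bigr => w _; rewrite fg. Qed.

Lemma tcop1 : tcop (1 : T) = fgen K (mone, mone).
Proof. by rewrite /tcop mlinU fm1. Qed.

Lemma tbrmul_is_linear X : linear (@tbrmul K gT M e X).
Proof.
move=> k Y Z; rewrite /tbrmul !mlinE scaler_sumr -big_split.
by apply: eq_bigr => p _ /=; rewrite linearP scalerDr !scalerA mulrC.
Qed.

Lemma tcop_cons i (x : T) : tcop (tgen i * x) = tbrmul (tcop_gen i) (tcop x).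
Proof.
pose L := GRing.isLinear.Build K T2 T2 _ _ (tbrmul_is_linear (tcop_gen i)).
pose F : {linear T2 -> T2} := HB.pack (tbrmul (tcop_gen i)) L.
elim/freemod_ind: x => [|k x y IHx IHy|w].
  by rewrite mulr0 !linear0 -[tbrmul _ _]/(F _) linear0.
  by rewrite mulrDr -scalerAr !linearP /= IHx IHy -[tbrmul _ _ in RHS]/(F _)
    linearP.
by rewrite /tgen fgenM /tcop !mlinU /mmul /= fmmulE fmuE.
Qed.

Definition braid_step i (q : word * word) : T2 :=
  fgen K (mmul (fmu i) q.1, q.2) +
  mlin (fun u : word => fgen K (u, mmul (fmu i) q.2)) (tact_word (d i) q.1).

Lemma tbrmul_gen i Y : tbrmul (tcop_gen i) Y = mlin (braid_step i) Y.
Proof.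
have -> : mlin (braid_step i) Y =
    mlin (fun q : word * word => fgen K (mmul (fmu i) q.1, q.2)) Y +
    mlin (fun q : word * word => mlin (fun u : word =>
      fgen K (u, mmul (fmu i) q.2))
                        (tact_word (d i) q.1)) Y.
  by rewrite !mlinE -big_split; apply: eq_bigr => q _ /=; rewrite -scalerDr.
rewrite /tbrmul linearD /=; congr (_ + _); rewrite mlinU;
  apply: eq_mlin => q /=.
  by rewrite -tactU /wdeg fm1 big_nil tact1g mlinU /= mul1m.
by rewrite /wdeg fmuE big_seq1; apply: eq_mlin => u /=; rewrite mul1m.
Qed.

(** The coproduct of [x # g] before passing to the quotient in [x]. *)
Definition scop g (x : T) : tens H H :=
  mlin (fun p : word * word => pure (theta (npi (fgen K p.1)) (wdeg p.2 * g)%g)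
                      (theta (npi (fgen K p.2)) g)) (tcop x).

Lemma scop_is_linear g : linear (scop g).
Proof. by move=> k x y; rewrite /scop !linearP. Qed.

HB.instance Definition _ g := GRing.isLinear.Build K T (tens H H) _ (scop g)
  (scop_is_linear g).

Lemma scop1 g : scop g 1 = pure (sgrp g) (sgrp g).
Proof. by rewrite /scop tcop1 mlinU /= /wdeg fm1 big_nil mul1g rmorph1 sgrpE.
  Qed.

(** Left multiplication by the coproduct of the [i]-th generator. *)
Definition cgen i (t : tens H H) : tens H H :=
  tmap (lmul (sgen i)) idfun t + tmap (lmul (sgrp (d i))) (lmul (sgen i)) t.

Lemma cgen_is_linear i : linear (cgen i).
Proof.
move=> k s t; rewrite /cgen.
have -> := linearP (tmap (lmul (sgen i)) idfun) k s t.
have -> := linearP (tmap (lmul (sgrp (d i))) (lmul (sgen i))) k s t.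
by rewrite scalerDr addrACA.
Qed.

HB.instance Definition _ i := GRing.isLinear.Build K _ _ _ (cgen i)
  (cgen_is_linear i).

Lemma cgenE i a b : cgen i (pure a b) = pure (sgen i * a) b + pure (sgrp (d i)
  * a) (sgen i * b).
Proof. by rewrite /cgen !tmapE. Qed.

Lemma scop_gen g i x : scop g (tgen i * x) = cgen i (scop g x).
Proof.
rewrite /scop tcop_cons tbrmul_gen; move: (tcop x) => Y.
elim/freemod_ind: Y => [|k Y Z IHY IHZ|[p q]]; first by rewrite !linear0.
  by rewrite !linearP /= IHY IHZ.
rewrite !mlinU /= cgenE sgen_theta fgenM linearD /= mlinU /=; congr (_ + _).
rewrite sgen_theta fgenM sgrp_theta tactU.
elim/freemod_ind: (tact_word _ _) => [|k Y Z IHY IHZ|u].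
- by rewrite !linear0 theta0 pure0l.
- by rewrite !linearP /= IHY IHZ thetaP pure_linl.
rewrite !mlinU /= -[mmul (fmu i) q]/(fmmul _ _) mulgA;
  congr (pure (theta _ _) _).
by rewrite /wdeg fmmulE big_cat fmuE big_seq1.
Qed.

Lemma scop_tact h g x : scop (h * g)%g (tact h x) =
  tmap (lmul (sgrp h)) (lmul (sgrp h)) (scop g x).
Proof.
elim/tensor_ind: x => [|k x y IHx IHy|i x IHx].
- by rewrite tact1 !scop1 tmapE /= /lmul !sgrpM.
- by rewrite !linearP /= IHx IHy.
rewrite tactM tact_tgen tact_genE mulr_suml linear_sum scop_gen /=.
under eq_bigr => j _ do rewrite -scalerAl linearZ /= scop_gen IHx.
move: (scop g x) => t; elim/tens_ind: t => [k s t IHs IHt|a b].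
  rewrite ![in RHS]linearP /= -IHs -IHt scaler_sumr -[RHS]big_split /=.
     by apply: eq_bigr => j _; do 2!rewrite linearP /=;
       rewrite scalerDr !scalerA mulrC.
under eq_bigr => j _ do rewrite tmapE /= cgenE scalerDr.
rewrite cgenE linearD /= !tmapE /= /lmul.
rewrite big_split /= !mulrA sgrp_gen !mulr_suml pure_suml pure_sumr.
congr (_ + _); apply: eq_bigr => j _.
  by rewrite -scalerAl pureZl -mulrA.
rewrite -scalerAl pureZr !mulrA !sgrpM; have [->|/acoef_deg ->] :=
  eqVneq (acoef h i j) 0.
  by rewrite !scale0r.
by rewrite mulgKV.
Qed.

End BraidedComultiplication.

(** * Descent of the coproduct *)

Section Coproduct.
Variables (K : fieldType) (gT : finGroupType) (M : ydModule K gT).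
Variable e : hbasis M.
Variable H : smash_product e.

Local Notation I := 'I_(hsize e).
Local Notation word := {fmonom I}.
Local Notation T := (freemod K word).
Local Notation B := (nichols e).
Local Notation d := (@hdeg _ _ _ e).
Local Notation npi := (@npi K gT M e).
Local Notation theta := (@theta K gT M e H).
Local Notation sgen := (@sgen K gT M e H).
Local Notation sgrp := (@sgrp K gT M e H).
Local Notation scop := (@scop K gT M e H).
Local Notation cgen := (@cgen K gT M e H).
Implicit Types a b : H.

Lemma cgen_sder k i t : tmap idfun (sder k) (cgen i t) =
  (k == i)%:R *: tmap (lmul (sgrp (d k))) (lmul (sgrp (d k))) t
    + cgen i (tmap idfun (sder k) t).
Proof.
elim/tens_ind: t => [c s t IHs IHt|a b].
  rewrite !linearP /= IHs IHt !linearP /= !scalerDr !scalerA [c * _]mulrC.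
  by rewrite addrACA.
rewrite cgenE linearD /= !tmapE /= cgenE sder_gen pureDr pureZr /lmul.
rewrite addrCA; congr (_ + _).
by have [->|] := eqVneq k i; rewrite ?scale0r.
Qed.

(** Both sides come from the coproduct by splitting off letters on the right, so
    this is an instance of coassociativity. *)
Lemma scop_sder k g x :
  tmap idfun (sder k) (scop g x) = scop (d k * g)%g (tder k x).
Proof.
elim/tensor_ind: x => [|c x y IHx IHy|i x IHx].
- by rewrite tder1 linear0 scop1 tmapE /= sder_grp pure0r.
- by rewrite !linearP /= IHx IHy.
by rewrite scop_gen cgen_sder IHx tder_cons linearP /= scop_tact scop_gen.
Qed.

Lemma cgen_sproj h i t : tmap idfun (sproj h) (cgen i t) =
  cgen i (tmap idfun (sproj h) t).
Proof.
elim/tens_ind: t => [c s t IHs IHt|a b].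
  by rewrite !linearP /= IHs IHt.
by rewrite cgenE linearD /= !tmapE /= cgenE sproj_gen.
Qed.

Lemma scop_sproj h g x :
  tmap idfun (sproj h) (scop g x) = if h == g then scop g x else 0.
Proof.
elim/tensor_ind: x => [|c x y IHx IHy|i x IHx].
- by rewrite scop1 tmapE /= sproj_grp; case: ifP; rewrite ?pure0r.
- by rewrite !linearP /= IHx IHy; case: ifP; rewrite ?scaler0 ?addr0.
by rewrite scop_gen cgen_sproj IHx; case: ifP; rewrite ?linear0.
Qed.

Definition counr : tens H H -> H := tlift (fun a b => (seps b : K) *: a).
Definition counl : tens H H -> H := tlift (fun a b => (seps a : K) *: b).

HB.instance Definition _ := GRing.Linear.on counr.
HB.instance Definition _ := GRing.Linear.on counl.

Lemma counrE a b : counr (pure a b) = (seps b : K) *: a.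
Proof.
apply: tliftE; split=> [u|v] k x y; first by rewrite linearP scalerDl scalerA.
by rewrite scalerDr !scalerA mulrC.
Qed.

Lemma counlE a b : counl (pure a b) = (seps a : K) *: b.
Proof.
apply: tliftE; split=> [u|v] k x y; last by rewrite linearP scalerDl scalerA.
by rewrite scalerDr !scalerA mulrC.
Qed.

Lemma counr_gen i t : counr (cgen i t) = sgen i * counr t.
Proof.
elim/tens_ind: t => [c s t IHs IHt|a b].
  by rewrite !linearP /= IHs IHt mulrDr -scalerAr.
by rewrite cgenE linearD /= !counrE seps_gen scale0r addr0 -scalerAr.
Qed.

Lemma seps_lgrp h a : seps (sgrp h * a) = seps a.
Proof.
elim/smash_theta_ind: a => [c a b IHa IHb|x g].
  by rewrite mulrDr -scalerAr !linearP /= IHa IHb.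
by rewrite sgrp_theta !seps_theta !npair_pi /tders /= eps_tact.
Qed.

Lemma sepsM a b : seps (a * b) = (seps a : K) * seps b.
Proof.
elim/smash_ind: a => [c a a' IHa IHb|g|i a IHa].
- rewrite mulrDl -scalerAl !linearP /= IHa IHb [RHS]mulrDl; congr (_ + _).
  exact: mulrA.
- by rewrite seps_lgrp seps_grp mul1r.
- by rewrite -mulrA !seps_gen mul0r.
Qed.

Lemma counl_gen i t : counl (cgen i t) = sgen i * counl t.
Proof.
elim/tens_ind: t => [c s t IHs IHt|a b].
  by rewrite !linearP /= IHs IHt mulrDr -scalerAr.
rewrite cgenE linearD /= !counlE seps_gen seps_lgrp scale0r add0r.
by rewrite -scalerAr.
Qed.

Lemma counr_scop g x : counr (scop g x) = theta (npi x) g.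
Proof.
elim/tensor_ind: x => [|c x y IHx IHy|i x IHx].
- by rewrite scop1 counrE seps_grp scale1r sgrpE rmorph1.
- by rewrite !linearP /= IHx IHy thetaP.
- by rewrite scop_gen counr_gen IHx sgen_theta.
Qed.

Lemma tmap_sders ks g x :
  exists h, tmap idfun (sders ks) (scop g x) = scop h (tders ks x).
Proof.
elim: ks g x => [|k ks IHks] g x.
  by exists g; elim/tens_ind: (scop g x) => [c s t IHs IHt|a b];
    rewrite ?linearP /= ?IHs ?IHt ?tmapE.
have [h hE] := IHks (d k * g)%g (tder k x); exists h.
rewrite tders_cons -hE -scop_sder; move: (scop g x) => t.
elim/tens_ind: t => [c s t IHs IHt|a b]; first by rewrite !linearP /= IHs IHt.
by rewrite !tmapE.
Qed.

(** The Nichols ideal is a coideal: contracting the second factor of the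
    coproduct with a sequence of skew derivations amounts to applying them to
    [x], and these contractions separate points. *)
Lemma scop_kills g x : nichols_ideal x -> scop g x = 0.
Proof.
move=> Jx; pose psi (p : seq I * gT) b := seps (sders p.1 (sproj p.2 b)).
apply: (@tens_sep _ _ _ _ psi) => [p|b b0|[ks h]].
- by move=> c a b; rewrite /psi !linearP.
- by apply: smash_sep => ks h; exact: (b0 (ks, h)).
have -> : tlift (fun u v => (psi (ks, h) v : K) *: u) (scop g x) =
    counr (tmap idfun (sders ks) (tmap idfun (sproj h) (scop g x))).
  elim/tens_ind: (scop g x) => [c s t IHs IHt|a b].
    by rewrite !linearP /= IHs IHt.
  rewrite !tmapE /= counrE tliftE//; split=> [u|v] c a' b'.
    by rewrite /psi !linearP /= scalerDl scalerA.
  by rewrite scalerDr !scalerA mulrC.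
rewrite scop_sproj; case: ifP => _; last by rewrite !linear0.
have [h' ->] := tmap_sders ks g x; rewrite counr_scop.
suff -> : npi (tders ks x) = 0 by rewrite theta0.
apply/npi_eq0; elim: ks x Jx => [//|k ks IHks] x Jx.
by rewrite tders_cons; apply: IHks; exact: nichols_ideal_tder.
Qed.

Definition scomul a : tens H H := \sum_g ndesc (scop g) (gcoef g a).

Lemma scomul_is_linear : linear scomul.
Proof.
move=> c a b; rewrite /scomul scaler_sumr -big_split; apply: eq_bigr => g _ /=.
rewrite linearP /=; exact: (ndesc_is_linear (@scop_kills g)).
Qed.

HB.instance Definition _ :=
  GRing.isLinear.Build K H (tens H H) _ scomul scomul_is_linear.

Lemma scomul_theta x g : scomul (theta (npi x) g) = scop g x.
Proof.
rewrite /scomul (bigD1 g)//= gcoef_theta eqxx (ndescE (@scop_kills g)).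
rewrite big1 ?addr0// => h /negPf hg; rewrite gcoef_theta hg -(raddf0 npi).
by rewrite (ndescE (@scop_kills h)) linear0.
Qed.

Lemma scomul_grp g : scomul (sgrp g) = pure (sgrp g) (sgrp g).
Proof. by rewrite {1}sgrpE -(rmorph1 npi) scomul_theta scop1. Qed.

Lemma scomul_gen i a : scomul (sgen i * a) = cgen i (scomul a).
Proof.
elim/smash_theta_ind: a => [c a b IHa IHb|x g].
  by rewrite mulrDr -scalerAr !linearP /= IHa IHb.
by rewrite sgen_theta !scomul_theta scop_gen.
Qed.

Lemma scomul_lgrp h a :
  scomul (sgrp h * a) = tmap (lmul (sgrp h)) (lmul (sgrp h)) (scomul a).
Proof.
elim/smash_theta_ind: a => [c a b IHa IHb|x g].
  by rewrite mulrDr -scalerAr !linearP /= IHa IHb.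
by rewrite sgrp_theta !scomul_theta scop_tact.
Qed.

Lemma scomul_sder k a : scomul (sder k a) = tmap idfun (sder k) (scomul a).
Proof.
elim/smash_theta_ind: a => [c a b IHa IHb|x g];
  first by rewrite !linearP /= IHa IHb.
by rewrite sder_theta nder_pi !scomul_theta scop_sder.
Qed.

Lemma scomul_sproj g a : scomul (sproj g a) = tmap idfun (sproj g) (scomul a).
Proof.
elim/smash_theta_ind: a => [c a b IHa IHb|x h];
  first by rewrite !linearP /= IHa IHb.
rewrite sproj_theta scomul_theta scop_sproj.
by case: ifP; rewrite ?scomul_theta ?linear0.
Qed.

Lemma counr_scomul a : counr (scomul a) = a.
Proof.
elim/smash_theta_ind: a => [c a b IHa IHb|x h];
  first by rewrite !linearP /= IHa IHb.
by rewrite scomul_theta counr_scop.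
Qed.

Lemma counl_scomul a : counl (scomul a) = a.
Proof.
elim/smash_ind: a => [c a b IHa IHb|g|i a IHa].
- by rewrite !linearP /= IHa IHb.
- by rewrite scomul_grp counlE seps_grp scale1r.
- by rewrite scomul_gen counl_gen IHa.
Qed.

End Coproduct.

(** * Coassociativity, multiplicativity and convolution *)

Section HopfStructure.
Variables (K : fieldType) (gT : finGroupType) (M : ydModule K gT).
Variable e : hbasis M.
Variable H : smash_product e.

Local Notation I := 'I_(hsize e).
Local Notation word := {fmonom I}.
Local Notation T := (freemod K word).
Local Notation B := (nichols e).
Local Notation d := (@hdeg _ _ _ e).
Local Notation npi := (@npi K gT M e).
Local Notation theta := (@theta K gT M e H).
Local Notation sgen := (@sgen K gT M e H).
Local Notation sgrp := (@sgrp K gT M e H).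
Local Notation scop := (@scop K gT M e H).
Local Notation cgen := (@cgen K gT M e H).
Local Notation scomul := (@scomul K gT M e H).
Implicit Types a b : H.

Local Notation tens3 := (tens H (tens H H)).

Definition assocl b : tens H H -> tens3 := tlift (fun a1 a2 =>
  pure a1 (pure a2 b)).

HB.instance Definition _ b := GRing.Linear.on (assocl b).

Lemma assoclE a1 a2 b : assocl b (pure a1 a2) = pure a1 (pure a2 b).
Proof.
by apply: tliftE; split=> u k x y; rewrite ?pureDl ?pureZl ?pureDr ?pureZr.
Qed.

Lemma assocl_linr s : linear (assocl^~ s).
Proof.
by move=> k a b; apply: tlift_linF => u v; rewrite pureDr pureZr pureDr pureZr.
Qed.

Definition coassl : tens H H -> tens3 := tlift (fun a b => assocl b (scomul a)).
Definition coassr : tens H H -> tens3 := tlift (fun a b => pure a (scomul b)).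

HB.instance Definition _ := GRing.Linear.on coassl.
HB.instance Definition _ := GRing.Linear.on coassr.

Lemma coasslE a b : coassl (pure a b) = assocl b (scomul a).
Proof.
apply: tliftE; split=> [u|v] k x y; first exact: assocl_linr.
by rewrite !linearP.
Qed.

Lemma coassrE a b : coassr (pure a b) = pure a (scomul b).
Proof.
apply: tliftE; split=> [u|v] k x y; first by rewrite linearP pureDr pureZr.
by rewrite pureDl pureZl.
Qed.

(** Left multiplication by the iterated coproduct of the [i]-th generator. *)
Definition cgen3 i (t : tens3) : tens3 :=
  tmap (lmul (sgen i)) idfun t + tmap (lmul (sgrp (d i))) (cgen i) t.

Lemma cgen3_is_linear i : linear (cgen3 i).
Proof.
move=> k s t; rewrite /cgen3 (linearP (tmap _ idfun)) (linearP (tmap _ (cgen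
  i))).
by rewrite scalerDr addrACA.
Qed.

HB.instance Definition _ i := GRing.isLinear.Build K _ _ _ (cgen3 i)
  (cgen3_is_linear i).

Lemma cgen3E i a t : cgen3 i (pure a t) =
  pure (sgen i * a) t + pure (sgrp (d i) * a) (cgen i t).
Proof. by rewrite /cgen3 !tmapE. Qed.

Lemma coassr_gen i t : coassr (cgen i t) = cgen3 i (coassr t).
Proof.
elim/tens_ind: t => [c s t IHs IHt|a b]; first by rewrite !linearP /= IHs IHt.
by rewrite cgenE linearD /= !coassrE cgen3E scomul_gen.
Qed.

Lemma assocl_gen i b s : assocl b (cgen i s) +
    assocl (sgen i * b) (tmap (lmul (sgrp (d i))) (lmul (sgrp (d i))) s)
  = cgen3 i (assocl b s).
Proof.
elim/tens_ind: s => [c s t IHs IHt|a1 a2].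
  by rewrite !linearP /= -IHs -IHt scalerDr addrACA.
rewrite tmapE cgenE linearD /= !assoclE cgen3E cgenE pureDr.
by rewrite addrA.
Qed.

Lemma coassl_gen i t : coassl (cgen i t) = cgen3 i (coassl t).
Proof.
elim/tens_ind: t => [c s t IHs IHt|a b]; first by rewrite !linearP /= IHs IHt.
by rewrite cgenE linearD /= !coasslE scomul_gen scomul_lgrp assocl_gen.
Qed.

Lemma scomulA a : coassl (scomul a) = coassr (scomul a).
Proof.
elim/smash_ind: a => [c a b IHa IHb|g|i a IHa].
- by rewrite !linearP /= IHa IHb.
- by rewrite scomul_grp coasslE coassrE scomul_grp assoclE.
- by rewrite scomul_gen coassl_gen coassr_gen IHa.
Qed.

Definition tmul2 a b : tens H H -> tens H H :=
  tlift (fun a' b' => pure (a * a') (b * b')).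

HB.instance Definition _ a b := GRing.Linear.on (tmul2 a b).

Lemma tmul2_tmap a b t : tmul2 a b t = tmap (lmul a) (lmul b) t.
Proof. by rewrite tmap_tlift. Qed.

Lemma tmul2E a b a' b' : tmul2 a b (pure a' b') = pure (a * a') (b * b').
Proof. by rewrite tmul2_tmap tmapE. Qed.

Definition tmul (s t : tens H H) : tens H H := tlift (fun a b => tmul2 a b t) s.

Lemma tmulE a b t : tmul (pure a b) t = tmul2 a b t.
Proof.
apply: tliftE; split=> [u|v] k x y; apply: tlift_linF => a' b'.
  by rewrite mulrDl -scalerAl pureDr pureZr.
by rewrite mulrDl -scalerAl pureDl pureZl.
Qed.

Lemma tmulP k r s t : tmul (k *: r + s) t = k *: tmul r t + tmul s t.
Proof. exact: (tlift_is_linear (fun a b => tmul2 a b t)). Qed.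

Lemma tmul_gen i s t : tmul (cgen i s) t = cgen i (tmul s t).
Proof.
elim/tens_ind: s => [c s s' IHs IHs'|a b].
  by rewrite linearP !tmulP IHs IHs' linearP.
rewrite cgenE -[X in X + _]scale1r tmulP scale1r !tmulE.
elim/tens_ind: t => [c s s' IHs IHs'|a' b']; last first.
  by rewrite !tmul2E cgenE !mulrA.
by rewrite !linearP /= -IHs -IHs' scalerDr addrACA.
Qed.

Lemma scomulM a b : scomul (a * b) = tmul (scomul a) (scomul b).
Proof.
elim/smash_ind: a => [c a a' IHa IHb|g|i a IHa].
- by rewrite mulrDl -scalerAl !linearP /= tmulP IHa IHb.
- by rewrite scomul_lgrp scomul_grp tmulE tmul2_tmap.
- by rewrite -mulrA !scomul_gen tmul_gen IHa.
Qed.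

(** The antipode is found by induction on the length of these words. *)
Definition sword (s : seq I) g : H := foldr (fun i a => sgen i * a) (sgrp g) s.

Lemma sword_theta (s : seq I) g : sword s g = theta (npi (fgen K (FMonom s :
  word))) g.
Proof.
elim: s => [|i s IHs] /=; first by rewrite -fmoneE sgrpE -(rmorph1 npi).
by rewrite IHs sgen_theta fgenS.
Qed.

Lemma sword_ind (P : H -> Prop) : (forall k a b, P a -> P b ->
  P (k *: a + b)) ->
  (forall s g, P (sword s g)) -> forall a, P a.
Proof.
move=> Plin Pw; apply: smash_theta_ind => // x g.
elim/freemod_ind: x => [|k x y Px Py|w].
- rewrite raddf0 theta0 -(addNr (sgrp 1%g)) -scaleN1r; apply: Plin;
  exact: (Pw [::]).
- by rewrite linearP /= thetaP; exact: Plin.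
- by rewrite -(fmK w) -sword_theta; exact: Pw.
Qed.

(** The coproduct of a word is [sgrp u (x) word] up to terms whose second factor
    is a shorter word; [F] ranges over the bilinear maps that ignore the latter,
    so as to express this without a filtration. *)
Lemma scomul_sword (s : seq I) g : exists u,
  forall (F : H -> H -> H), bilin F ->
  (forall a s' g', (size s' < size s)%N -> F a (sword s' g') = 0) ->
  tlift F (scomul (sword s g)) = F (sgrp u) (sword s g).
Proof.
elim: s => [|i s [u IHs]] /=.
  by exists g => F bF _; rewrite scomul_grp tliftE.
exists (d i * u)%g => F bF F0; rewrite scomul_gen.
rewrite /cgen linearD /= !tlift_tmap//= IHs; last 2 first.
- exact: (@bilin_comp _ _ _ _ _ _ F (lmul (sgen i)) idfun).
- by move=> a s' g' s's; apply: F0; rewrite ltnS ltnW.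
rewrite F0// add0r IHs; last 2 first.
- exact: (@bilin_comp _ _ _ _ _ _ F (lmul (sgrp (d i))) (lmul (sgen i))).
- by move=> a s' g' s's; apply: (F0 _ (i :: s')).
by rewrite /lmul sgrpM.
Qed.

Definition conv (f g : H -> H) a : H := tlift (fun x y => f x * g y) (scomul a).

Lemma bilin_conv (f g : {linear H -> H}) : bilin (fun x y => f x * g y).
Proof.
split=> [u|v] k x y; rewrite linearP; first by rewrite mulrDr scalerAr.
by rewrite mulrDl scalerAl.
Qed.

(** On a word, the leading term of [id * f] is [sgrp u] times the value of [f],
    and [sgrp u] is invertible. *)
Lemma conv_id_inj (f : {linear H -> H}) : (forall a, conv idfun f a = 0) ->
  forall a, f a = 0.
Proof.
move=> f0; apply: sword_ind => [k a b fa fb|s g].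
  by rewrite linearP /= fa fb scaler0 addr0.
have [n] := ubnP (size s); elim: n s g => // n IHn s g; rewrite ltnS => sn.
have [u hu] := scomul_sword s g.
have := f0 (sword s g); rewrite /conv (hu (fun x y => x * f y)).
- move=> /(congr1 ( *%R (sgrp u^-1%g))).
  by rewrite mulr0 mulrA sgrpM mulVg sgrp1 mul1r.
- exact: (bilin_conv idfun f).
- by move=> a s' g' s's; rewrite IHn ?mulr0// (leq_trans s's).
Qed.

End HopfStructure.

(** * The antipode and the bosonization *)

Section Bosonization.
Variables (K : fieldType) (gT : finGroupType) (M : ydModule K gT).
Variable e : hbasis M.
Variable H : smash_product e.

Local Notation I := 'I_(hsize e).
Local Notation word := {fmonom I}.
Local Notation T := (freemod K word).
Local Notation B := (nichols e).
Local Notation d := (@hdeg _ _ _ e).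
Local Notation npi := (@npi K gT M e).
Local Notation theta := (@theta K gT M e H).
Local Notation sgen := (@sgen K gT M e H).
Local Notation sgrp := (@sgrp K gT M e H).
Local Notation scop := (@scop K gT M e H).
Local Notation cgen := (@cgen K gT M e H).
Local Notation scomul := (@scomul K gT M e H).
Local Notation conv := (@conv K gT M e H).
Implicit Types a b : H.

Definition sunit a : H := (seps a : K) *: 1.

Lemma sunit_is_linear : linear sunit.
Proof. by move=> k a b; rewrite /sunit linearP scalerDl scalerA. Qed.

HB.instance Definition _ := GRing.isLinear.Build K H H _ sunit sunit_is_linear.

Lemma conv_is_linear (f g : H -> H) : linear (conv f g).
Proof. by move=> k a b; rewrite /conv !linearP. Qed.

HB.instance Definition _ f g := GRing.isLinear.Build K H H _ (conv f g)
  (conv_is_linear f g).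

Lemma conv_linr (f g h : H -> H) k a : (forall x, f x = k *: g x + h x) ->
  conv idfun f a = k *: conv idfun g a + conv idfun h a.
Proof.
by move=> fgh; apply: tlift_linF => u v; rewrite fgh mulrDr scalerAr.
Qed.

Lemma conv_unitr (f : {linear H -> H}) a : conv f sunit a = f a.
Proof.
rewrite -{2}(counr_scomul a) /conv; elim/tens_ind: (scomul a) =>
  [c s t IHs IHt|x y].
  by rewrite !linearP /= IHs IHt.
rewrite tliftE; last exact: bilin_conv.
by rewrite counrE linearZ /sunit /= -scalerAr mulr1.
Qed.

Lemma conv_unitl (f : {linear H -> H}) a : conv sunit f a = f a.
Proof.
rewrite -{2}(counl_scomul a) /conv; elim/tens_ind: (scomul a) =>
  [c s t IHs IHt|x y].
  by rewrite !linearP /= IHs IHt.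
rewrite tliftE; last exact: bilin_conv.
by rewrite counlE linearZ /sunit /= -scalerAl mul1r.
Qed.

Lemma convA (f g h : {linear H -> H}) a :
  conv f (conv g h) a = conv (conv f g) h a.
Proof.
pose m2 : {linear tens H H -> H} := tlift (fun y z => g y * h z).
pose m3 : {linear tens H (tens H H) -> H} := tlift (fun x t => f x * m2 t).
have m3E x t : m3 (pure x t) = f x * m2 t.
  apply: tliftE; split=> [u|v] k y z; first by rewrite linearP mulrDr scalerAr.
  by rewrite linearP mulrDl scalerAl.
have E1 t : tlift (fun x y => f x * conv g h y) t = m3 (coassr t).
  elim/tens_ind: t => [c s t IHs IHt|x y]; first by rewrite !linearP /= IHs IHt.
  by rewrite coassrE m3E tliftE//; exact: bilin_conv.
have E2 t : tlift (fun x y => conv f g x * h y) t = m3 (coassl t).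
  elim/tens_ind: t => [c s t IHs IHt|x y]; first by rewrite !linearP /= IHs IHt.
  rewrite coasslE tliftE; last exact: bilin_conv.
  rewrite /conv; elim/tens_ind: (scomul x) => [c s t IHs IHt|x1 x2].
    by rewrite !linearP /= mulrDl -scalerAl IHs IHt.
  by rewrite assoclE m3E /m2 /= (tliftE _ _ (bilin_conv g h)) (tliftE _ _
    (bilin_conv f g)) mulrA.
by rewrite /conv E1 E2 scomulA.
Qed.

(** Convolution with the identity is an injective endomorphism of the finite
    dimensional space [End(H)], so the convolution unit has a preimage [S]. It
    is inverse on the other side as well, for [id * (S * id) = (id * S) * id =
    id] and injectivity applies again. *)
Lemma antipode_exists : exists S : 'End(H),
  (forall a, conv idfun S a = sunit a) /\ (forall a, conv S idfun a = sunit a).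
Proof.
pose L0 (f : 'End(H)) : 'End(H) := linfun (conv idfun f).
have lL0 : linear L0.
  move=> k f g; apply/lfunP => a; rewrite lfunE /= add_lfunE scale_lfunE !lfunE
    /=.
  by apply: conv_linr => x; rewrite add_lfunE scale_lfunE.
pose L : 'End('End(H)) := linfun (HB.pack L0 (GRing.isLinear.Build K _ _ _ L0
  lL0) : {linear 'End(H) -> 'End(H)}).
have L_inj : lker L == 0%VS.
  rewrite -subv0; apply/subvP => f; rewrite memv_ker memv0 lfunE /= => /eqP Lf0.
  apply/eqP/lfunP => a; rewrite zero_lfunE; apply: conv_id_inj => {}a.
  by have := congr1 (fun F : 'End(H) => F a) Lf0; rewrite /= lfunE zero_lfunE.
pose S := (L^-1%VF) (linfun sunit).
have idS a : conv idfun S a = sunit a.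
  have : L S = linfun sunit by rewrite lker0_lfunVK.
  by move/(congr1 (fun F : 'End(H) => F a)); rewrite lfunE /= !lfunE.
exists S; split=> // a; apply/eqP; rewrite -subr_eq0; apply/eqP.
pose f : {linear H -> H} := HB.pack (conv S idfun) (GRing.isLinear.Build K _ _
  _ _ (conv_is_linear S idfun)).
pose f' : 'End(H) := linfun f - linfun sunit.
have f'E x : f' x = conv S idfun x - sunit x.
  by rewrite /f' add_lfunE opp_lfunE !lfunE.
rewrite -f'E; apply: conv_id_inj => {}a.
have fE : forall x, f' x = (-1) *: sunit x + f x by move=> x;
  rewrite f'E scaleN1r addrC.
rewrite (conv_linr _ fE) conv_unitr scaleN1r (convA idfun S idfun).
suff -> : conv (conv idfun S) idfun a = a by rewrite addNr.
rewrite -[RHS](conv_unitl idfun a); apply: eq_tlift => x y /=.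
by rewrite idS.
Qed.

Definition antip : 'End(H) := sval (cid antipode_exists).

Lemma antipP : (forall a, conv idfun antip a = sunit a) /\
  (forall a, conv antip idfun a = sunit a).
Proof. exact: svalP (cid antipode_exists). Qed.

Definition bos_comulf : 'Hom(H, tens H H) := linfun scomul.
Definition bos_counitf : 'Hom(H, K^o) := linfun (@seps K gT M e H).

Lemma bos_comulE a : bos_comulf a = scomul a. Proof. exact: lfunE. Qed.
Lemma bos_counitE a : bos_counitf a = seps a. Proof. exact: lfunE. Qed.

Lemma bos_comulA x :
  tlift (fun a b => tlift (fun a1 a2 => pure a1 (pure a2 b)) (bos_comulf a))
          (bos_comulf x)
  = tlift (fun a b => pure a (bos_comulf b)) (bos_comulf x).
Proof.
rewrite bos_comulE; transitivity (coassl (scomul x)).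
  by apply: eq_tlift => a b; rewrite bos_comulE.
by rewrite scomulA; apply: eq_tlift => a b; rewrite bos_comulE.
Qed.

Lemma bos_counitl x : tlift (fun a b => (bos_counitf a : K) *: b) (bos_comulf
  x) = x.
Proof.
rewrite bos_comulE -[RHS]counl_scomul; apply: eq_tlift => a b.
by rewrite bos_counitE.
Qed.

Lemma bos_counitr x : tlift (fun a b => (bos_counitf b : K) *: a) (bos_comulf
  x) = x.
Proof.
rewrite bos_comulE -[RHS]counr_scomul; apply: eq_tlift => a b.
by rewrite bos_counitE.
Qed.

Lemma bos_comul1 : bos_comulf 1 = pure 1 1.
Proof. by rewrite bos_comulE -(sgrp1 H) scomul_grp. Qed.

Lemma bos_comulM x y : bos_comulf (x * y) =
      tlift (fun a b => tlift (fun c d => pure (a * c) (b * d)) (bos_comulf y))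
            (bos_comulf x).
Proof. by rewrite !bos_comulE scomulM. Qed.

Lemma bos_counit1 : bos_counitf 1 = 1.
Proof. by rewrite bos_counitE -(sgrp1 H) seps_grp. Qed.

Lemma bos_counitM x y : bos_counitf (x * y) = (bos_counitf x : K) * bos_counitf
  y.
Proof. by rewrite !bos_counitE sepsM. Qed.

Lemma bos_antipodel x :
  tlift (fun a b => antip a * b) (bos_comulf x) = (bos_counitf x : K) *: 1.
Proof. by rewrite bos_comulE bos_counitE; apply: antipP.2. Qed.

Lemma bos_antipoder x :
  tlift (fun a b => a * antip b) (bos_comulf x) = (bos_counitf x : K) *: 1.
Proof. by rewrite bos_comulE bos_counitE; apply: antipP.1. Qed.

Definition bosonization : hopfAlgebra K :=
  HopfAlgebra bos_comulA bos_counitl bos_counitr bos_comul1 bos_comulM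
    bos_counit1 bos_counitM bos_antipodel bos_antipoder.

Lemma bosonizationP : @is_bosonization K gT M e bosonization theta.
Proof.
split.
- exact: theta_is_linear.
- exists (fun a : H => [ffun g => @gcoef K gT M e H g a]) => [f|a].
    apply/ffunP => g; rewrite ffunE linear_sum (bigD1 g)//= gcoef_theta eqxx.
    rewrite big1 ?addr0// => h /negPf hg; rewrite gcoef_theta eq_sym hg.
    by [].
  by rewrite [RHS](theta_expand a); apply: eq_bigr => g _; rewrite ffunE.
- exact: theta_one.
- by move=> x y g h; rewrite theta_mul nact_pi -rmorphM.
- by move=> x g; rewrite [LHS]bos_comulE scomul_theta.
- by move=> x g; rewrite [LHS]bos_counitE seps_theta npair_pi.
Qed.

End Bosonization.

(** * Subcoalgebras of the bosonization *)

Section Coradical.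
Variables (K : fieldType) (gT : finGroupType) (M : ydModule K gT).
Variable e : hbasis M.
Variable H : smash_product e.

Local Notation I := 'I_(hsize e).
Local Notation word := {fmonom I}.
Local Notation T := (freemod K word).
Local Notation B := (nichols e).
Local Notation d := (@hdeg _ _ _ e).
Local Notation npi := (@npi K gT M e).
Local Notation theta := (@theta K gT M e H).
Local Notation sgen := (@sgen K gT M e H).
Local Notation sgrp := (@sgrp K gT M e H).
Local Notation scop := (@scop K gT M e H).
Local Notation cgen := (@cgen K gT M e H).
Local Notation scomul := (@scomul K gT M e H).
Local Notation HB := (bosonization H).
Implicit Types a b : H.

Definition contrR (psi : H -> K^o) : tens H H -> H :=
  tlift (fun a b => (psi b : K) *: a).
Definition contrL (psi : H -> K^o) : tens H H -> H :=
  tlift (fun a b => (psi a : K) *: b).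

HB.instance Definition _ psi := GRing.Linear.on (contrR psi).
HB.instance Definition _ psi := GRing.Linear.on (contrL psi).

Lemma bilin_contrR (psi : {linear H -> K^o}) :
  bilin (fun a b : H => (psi b : K) *: a).
Proof.
split=> [u|v] k x y; first by rewrite linearP scalerDl scalerA.
by rewrite scalerDr !scalerA mulrC.
Qed.

Lemma contrRE (psi : {linear H -> K^o}) a b :
  contrR psi (pure a b) = (psi b : K) *: a.
Proof. exact/tliftE/bilin_contrR. Qed.

Lemma contrLE (psi : {linear H -> K^o}) a b :
  contrL psi (pure a b) = (psi a : K) *: b.
Proof.
apply: tliftE; split=> [u|v] k x y; last by rewrite linearP scalerDl scalerA.
by rewrite scalerDr !scalerA mulrC.
Qed.

Implicit Types D E : {vspace H}.

Local Notation subco D := (@subcoalgebra K HB D).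

Definition tens_span D : {vspace tens H H} :=
  <<[seq pure x y | x <- vbasis D, y <- vbasis D]>>%VS.

Lemma tens_span_contrR D (psi : {linear H -> K^o}) t :
  t \in tens_span D -> contrR psi t \in D.
Proof.
have: (tens_span D <= linfun (contrR psi) @^-1: D)%VS.
  apply/span_subvP => _ /allpairsP[[x y] /= [/vbasis_mem Dx _ ->]].
  by rewrite -memv_preim lfunE /= contrRE rpredZ.
by move/subvP => h /h; rewrite -memv_preim lfunE.
Qed.

Lemma tens_span_contrL D (psi : {linear H -> K^o}) t :
  t \in tens_span D -> contrL psi t \in D.
Proof.
have: (tens_span D <= linfun (contrL psi) @^-1: D)%VS.
  apply/span_subvP => _ /allpairsP[[x y] /= [_ /vbasis_mem Dy ->]].
  by rewrite -memv_preim lfunE /= contrLE rpredZ.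
by move/subvP => h /h; rewrite -memv_preim lfunE.
Qed.

Lemma tens_span_pure D a b : a \in D -> b \in D -> pure a b \in tens_span D.
Proof.
move=> Da Db; rewrite (coord_vbasis Da) (coord_vbasis Db) pure_suml.
apply: rpred_sum => i _; rewrite pure_sumr; apply: rpred_sum => j _.
rewrite pureZl pureZr; do 2!apply: rpredZ; apply: memv_span.
by apply/allpairsP; exists ((vbasis D)`_i, (vbasis D)`_j); split=> //=;
  rewrite mem_nth ?size_tuple.
Qed.

Lemma subcoP D : subco D <-> forall a, a \in D -> scomul a \in tens_span D.
Proof.
split=> [/subvP sD a Da|sD]; first by rewrite -bos_comulE; apply: sD;
  exact: memv_img.
by apply/subvP => _ /memv_imgP[a Da ->]; rewrite [comul HB a]bos_comulE;
  exact: sD.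
Qed.

Lemma subco_scomul D a : subco D -> a \in D -> scomul a \in tens_span D.
Proof. by move=> /subcoP; apply. Qed.

Lemma contrR_scomul (A : {linear H -> H}) a :
  (forall b, scomul (A b) = tmap idfun A (scomul b)) ->
  contrR (fun b => seps (A b)) (scomul a) = A a.
Proof.
move=> hA; rewrite -[RHS]counr_scomul hA; move: (scomul a) => t.
elim/tens_ind: t => [c s t IHs IHt|x y]; first by rewrite !linearP /= IHs IHt.
by rewrite tmapE counrE (contrRE (@seps K gT M e H \o A)).
Qed.

Lemma subco_sder D k a : subco D -> a \in D -> sder k a \in D.
Proof.
move=> sD Da; rewrite -(contrR_scomul _ (scomul_sder k)).
exact: (tens_span_contrR (@seps K gT M e H \o sder k) (subco_scomul sD Da)).
Qed.

Lemma subco_sproj D g a : subco D -> a \in D -> sproj g a \in D.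
Proof.
move=> sD Da; rewrite -(contrR_scomul _ (scomul_sproj g)).
exact: (tens_span_contrR (@seps K gT M e H \o sproj g) (subco_scomul sD Da)).
Qed.

Lemma contrL_scomul (A : {linear H -> H}) (psi : {linear H -> K^o}) a :
  (forall b, scomul (A b) = tmap idfun A (scomul b)) ->
  A (contrL psi (scomul a)) = contrL psi (scomul (A a)).
Proof.
move=> ->; move: (scomul a) => t.
elim/tens_ind: t => [c s t IHs IHt|x y]; first by rewrite !linearP /= IHs IHt.
by rewrite tmapE !contrLE linearZ.
Qed.

Lemma seps_contrL (psi : {linear H -> K^o}) a :
  seps (contrL psi (scomul a)) = psi a.
Proof.
rewrite -[in RHS](counr_scomul a); move: (scomul a) => t.
elim/tens_ind: t => [c s t IHs IHt|x y]; first by rewrite !linearP /= IHs IHt.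
by rewrite contrLE counrE !linearZ /= [LHS]mulrC.
Qed.

Lemma scomul_sders ks a : scomul (sders ks a) = tmap idfun (sders ks) (scomul
  a).
Proof.
elim: ks a => [|k ks IHks] a.
  move: (scomul a) => t; elim/tens_ind: t => [c s t IHs IHt|x y].
    by rewrite linearP /= {1}IHs {1}IHt.
  by rewrite tmapE.
rewrite sders_cons IHks scomul_sder; move: (scomul a) => t.
elim/tens_ind: t => [c s t IHs IHt|x y]; first by rewrite !linearP /= IHs IHt.
by rewrite !tmapE.
Qed.

Lemma sders_sproj ks g a : exists h, sders ks (sproj g a) = sproj h (sders ks
  a).
Proof.
elim: ks g a => [|k ks IHks] g a; first by exists g.
by rewrite !sders_cons -sproj_sder; exact: IHks.
Qed.

(** Let [ks] be a sequence of maximal length with [sders ks a != 0]. A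
    functional that factors through [sders ks], applied to the first tensor
    factor of the coproduct of [a], leaves only the contribution of [- (x) sgrp
    g]. *)
Lemma subco_sgrp D g a : subco D -> a \in D -> a != 0 -> sproj g a = a ->
  sgrp g \in D.
Proof.
move=> sD Da a0 ga; have [N hN] := sders_finite a.
pose P n := `[< forall ks, (n <= size ks)%N -> sders ks a = 0 >].
have exP : exists n, P n by exists N; apply/asboolP.
case: (ex_minnP exP) => n /asboolP Pn nmin.
case: n Pn nmin => [|n] Pn nmin; first by rewrite [a](Pn [::]) ?eqxx in a0.
have {nmin} : ~~ P n by apply/negP => /nmin; rewrite ltnn.
move=> /asboolP/existsNP[ks /not_implyP[nks /eqP h0]].
set h := sders ks a in h0.
have hd k : sder k h = 0 by rewrite -sders_rcons Pn// size_rcons ltnS.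
have [g' g'0] : exists g', seps (sproj g' h) != 0.
  apply/existsP; apply: contra_neqT h0 => /existsPn hg; rewrite (sder0_grp hd).
  by apply: big1 => g' _; rewrite (eqP (negbNE (hg g'))) scale0r.
pose phi : {linear H -> K^o} := @seps K gT M e H \o (sproj g' \o sders ks).
pose r := contrL phi (scomul a).
have rD : r \in D by exact/tens_span_contrL/subco_scomul.
(* Were some derivative of [r] nonzero, [a] would survive a sequence of skew
   derivations longer than [ks]. *)
have rd k : sder k r = 0.
  rewrite /r (contrL_scomul _ _ (scomul_sder k)); apply: smash_sep => ms h'.
  rewrite (contrL_scomul _ _ (scomul_sproj h')).
  rewrite (contrL_scomul _ _ (scomul_sders ms)) seps_contrL /=.
  rewrite -sders_cat.
  have [h1 ->] := sders_sproj (ms ++ ks) h' (sder k a).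
  rewrite -sders_cons Pn ?linear0//= ltnS size_cat.
  exact: leq_trans nks (leq_addl _ _).
have rg : sproj g r = r by rewrite /r (contrL_scomul _ _ (scomul_sproj g)) /=
  ga.
have rE : r = (seps r : K) *: sgrp g.
  rewrite {1}(sder0_grp rd) (bigD1 g)//= rg big1 ?addr0// => h' /negPf h'g.
  by rewrite -rg sproj_sproj h'g linear0 scale0r.
have r0 : (seps r : K) != 0 by rewrite /r seps_contrL.
by rewrite -[sgrp g](scalerK r0) -rE rpredZ.
Qed.

Lemma sgrp_neq0 g : sgrp g != 0.
Proof.
apply/eqP => /(congr1 (@seps K gT M e H)) /eqP.
by rewrite seps_grp linear0 oner_eq0.
Qed.

Lemma subco_line g : subco <[sgrp g]>%VS.
Proof.
apply/subcoP => _ /vlineP[k ->]; rewrite linearZ /= scomul_grp rpredZ//.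
by apply: tens_span_pure; exact: memv_line.
Qed.

Lemma subco_has_sgrp D : subco D -> D != 0%VS -> exists g, sgrp g \in D.
Proof.
move=> sD D0; have Da := memv_pick D; have a0 : vpick D != 0 by rewrite vpick0.
set a := vpick D in Da a0.
have [g ga] : exists g, sproj g a != 0.
  apply/existsP; apply: contra_neqT a0 => /existsPn ag; rewrite (sproj_sum a).
  by apply: big1 => g _; exact/eqP/negbNE.
exists g; apply: (subco_sgrp (a := sproj g a)) => //; first exact: subco_sproj.
by rewrite sproj_sproj eqxx.
Qed.

Lemma simple_subcoP D : @simple_subcoalgebra K HB D <-> exists g,
  D = <[sgrp g]>%VS.
Proof.
split=> [[sD D0 Dmin]|[g ->]].
  have [g Dg] := subco_has_sgrp sD D0; exists g.
  have := Dmin _ (subco_line g); rewrite -memvE => /(_ Dg)[/eqP|<-//].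
  by rewrite -dimv_eq0 dim_vline sgrp_neq0.
split; first exact: subco_line.
  by rewrite -dimv_eq0 dim_vline sgrp_neq0.
move=> E sE ELg; have [->|E0] := eqVneq E 0%VS; [by left|right].
by apply/eqP; rewrite eqEdim ELg dim_vline sgrp_neq0 lt0n dimv_eq0.
Qed.

Lemma bosonization_pointed : pointed HB.
Proof. by move=> D /simple_subcoP[g ->]; rewrite dim_vline sgrp_neq0. Qed.

Lemma bosonization_coradical : @coradical_group_algebra K HB gT (theta 1).
Proof.
have E : theta 1 =1 sgrp by move=> g; rewrite sgrpE.
have cE : codom (theta 1) = codom sgrp by apply: eq_codom.
split.
- exact: theta_one.
- by move=> g h; rewrite !E -sgrpM.
- move=> g; rewrite E; split; first by rewrite [LHS]bos_comulE scomul_grp.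
  by rewrite [LHS]bos_counitE seps_grp.
- rewrite cE; apply/(@freeP _ _ _ (codom_tuple sgrp)) => k k0 i.
  have := congr1 (fun a : H => seps (sproj (enum_val i) a)) k0.
  rewrite !linear_sum linear0 (bigD1 i)//= big1 => [|j /negPf ji].
    rewrite nth_codom addr0 !linearZ /= sproj_grp eqxx seps_grp.
    by rewrite linear0 [_ *: _]mulr1.
  rewrite nth_codom !linearZ /= sproj_grp (inj_eq enum_val_inj) eq_sym ji.
  by rewrite !linear0.
- move=> x; rewrite cE; split=> [[Ds hDs]|xs].
    apply: subvP; elim: Ds hDs => [|D Ds IHDs] hDs;
      first by rewrite big_nil sub0v.
    rewrite big_cons subv_add IHDs ?andbT => [|D' D'Ds]; last first.
      by apply: hDs; rewrite inE D'Ds orbT.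
    have /simple_subcoP[g ->] := hDs D (mem_head _ _).
    by rewrite -memvE memv_span// codom_f.
  exists [seq <[u]>%VS | u <- codom sgrp].
    by move=> _ /mapP[_ /codomP[g ->] ->]; apply/simple_subcoP; exists g.
  by rewrite big_map -span_def.
Qed.

Lemma hdeg_support g : g \in yd_support M -> exists i : I, d i = g.
Proof.
rewrite inE -vpick0 => v0; have vg := memv_pick (yd_part M g).
have /existsP[j j0] : [exists j, coord (hvec e) j (vpick (yd_part M g)) != 0].
  apply: contra_neqT v0 => /existsPn j0; rewrite (hvec_expand e (vpick _)).
  by apply: big1 => j _; rewrite (eqP (negbNE (j0 j))) scale0r.
by exists j; exact: coord_part j0.
Qed.

(** A summand that contains [sgrp g] contains the whole component of [g], in
    particular the product of [sgrp g] with the [i]-th generator, whose skew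
    derivative is [sgrp (d i * g)]. As the degrees [d i] generate [G], one
    summand contains all grouplikes and leaves no room for the other. *)
Lemma bosonization_indecomposable : yd_indecomposable M ->
  coalgebra_indecomposable HB.
Proof.
move=> Mind [D [E [sD sE D0 E0 [DE dDE]]]].
have DE0 a : a \in D -> a \in E -> a = 0.
  move=> Da Ea; apply/eqP; rewrite -memv0 -(directv_addP dDE).
  by rewrite memv_cap Da.
wlog [g0 Dg0] : D E sD sE D0 E0 DE dDE DE0 / exists g, sgrp g \in D.
  by move=> th; apply: (th D E) => //; exact: subco_has_sgrp.
have Eg g : sgrp g \in D -> forall a, a \in E -> sproj g a = 0.
  move=> Dg a Ea; apply/eqP; apply: contraT => ga.
  have gE : sgrp g \in E.
    apply: (subco_sgrp (a := sproj g a)) => //; first exact: subco_sproj.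
    by rewrite sproj_sproj eqxx.
  by have := DE0 _ Dg gE; move/eqP; rewrite (negPf (sgrp_neq0 g)).
have Dstep i g : sgrp g \in D -> sgrp (d i * g)%g \in D.
  move=> Dg; have : sgen i * sgrp g \in (D + E)%VS by rewrite DE memvf.
  move=> /memv_addP[x Dx [y Ey xyE]].
  have xE : sgen i * sgrp g = sproj g x.
    have := congr1 (sproj g) xyE; rewrite sproj_gen sproj_grp eqxx => ->.
    by rewrite linearD /= (Eg g Dg y Ey) addr0.
  have := subco_sder i sD (subco_sproj g sD Dx).
  by rewrite -xE sder_gen eqxx scale1r sder_grp mulr0 addr0 sgrpM.
have Dall g : sgrp g \in D.
  have : (g * g0^-1)%g \in <<yd_support M>>%g by rewrite Mind inE.
  move=> /gen_prodgP[n [c cS gE]]; rewrite -(mulgKV g0 g) gE.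
  elim: n c cS {gE} => [|n IHn] c cS; first by rewrite big_ord0 mul1g.
  rewrite big_ord_recl -mulgA; have /hdeg_support[i <-] := cS ord0.
  by apply: Dstep; apply: IHn => i'; exact: cS.
move/negP: E0; apply; apply/eqP/subv_anti; rewrite sub0v andbT.
apply/subvP => a Ea; rewrite memv0 (sproj_sum a) big1// => g _.
exact: Eg.
Qed.

End Coradical.

(** * Finiteness from vanishing of long words *)

Section WordSpan.
Variables (K : fieldType) (gT : finGroupType) (M : ydModule K gT).
Variable e : hbasis M.

Local Notation I := 'I_(hsize e).
Local Notation word := {fmonom I}.
Local Notation T := (freemod K word).
Local Notation B := (nichols e).
Local Notation npi := (@npi K gT M e).

Lemma finite_dimensional_words (D : nat) :
  (forall s : seq I, (D <= size s)%N -> npi (fgen K (FMonom s : word)) = 0) ->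
  finite_dimensional B.
Proof.
move=> hD; pose X := [seq npi (fgen K (FMonom (tval t) : word)) |
   n <- iota 0 D, t <- enum {: n.-tuple I}].
exists X => v; rewrite -(nreprK v).
elim/freemod_ind: (nrepr v) => [|k x y [c xE] [c' yE]|w].
- by exists (fun=> 0); rewrite raddf0 big1// => i _; rewrite scale0r.
- exists (fun i => k * c i + c' i); rewrite linearP /= xE yE scaler_sumr
  -big_split.
  by apply: eq_bigr => i _ /=; rewrite scalerDl scalerA.
have [/hD|wD] := leqP D (size w).
  rewrite fmK => ->; exists (fun=> 0); rewrite big1// => i _; exact: scale0r.
have wX : npi (fgen K w) \in X.
  apply/allpairsPdep; exists (size w), (in_tuple w).
  by rewrite mem_iota mem_enum /= fmK; split.
exists (fun i : 'I_(size X) => (i == index (npi (fgen K w)) X :> nat)%:R).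
rewrite -index_mem in wX; rewrite (bigD1 (Ordinal wX))//= eqxx scale1r
  nth_index -?index_mem//.
by rewrite big1 ?addr0// => i; rewrite -val_eqE /= => /negPf ->;
  rewrite scale0r.
Qed.

End WordSpan.

Section QuasiCommutativeWords.
Variables (K : fieldType) (A : algType K) (F C : finType).
Variables (u : F -> A) (cmp : F -> C) (N : nat).
Hypothesis uC : forall f g, cmp f != cmp g ->
  exists c, u f * u g = c *: (u g * u f).
Hypothesis uN : forall c w, all (fun f => cmp f == c) w -> (N <= size w)%N ->
  \prod_(f <- w) u f = 0.

Lemma prod_extract c w : exists k,
  \prod_(f <- w) u f = k *: (\prod_(f <- w | cmp f == c) u f *
                             \prod_(f <- w | cmp f != c) u f).
Proof.
have swap f w' : cmp f != c -> exists k,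
    u f * \prod_(g <- w' | cmp g == c) u g =
      k *: (\prod_(g <- w' | cmp g == c) u g * u f).
  move=> fc; elim: w' => [|g w' [k IH]].
    by exists 1; rewrite !big_nil mulr1 mul1r scale1r.
  rewrite big_cons; case: eqP => [gc|_]; last by exists k.
  have [k' k'E] : exists k', u f * u g = k' *: (u g * u f) by apply: uC;
    rewrite gc.
  exists (k' * k); rewrite mulrA k'E -scalerAl -(mulrA (u g) (u f)) IH
    -scalerAr.
  rewrite scalerA.
  by rewrite mulrA.
elim: w => [|f w [k IH]]; first by exists 1; rewrite !big_nil mulr1 scale1r.
rewrite !big_cons; have [fc|fc] := boolP (cmp f == c); rewrite /= IH.
  by exists k; rewrite -scalerAr mulrA.
have [k' k'E] := swap f w fc.
by exists (k * k'); rewrite -scalerAr (mulrA (u f)) k'E -scalerAl scalerA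
  -(mulrA _ (u f)).
Qed.

(** By the pigeonhole principle some block has more than [N] letters in [w], and
    those can be moved to the front. *)
Lemma long_word_eq0 w : (#|C| * N < size w)%N -> \prod_(f <- w) u f = 0.
Proof.
move=> hw; have [c hc] : exists c, (N < count (fun f => cmp f == c) w)%N.
  apply/existsP; apply: contraLR hw => /existsPn hc; rewrite -leqNgt.
  have -> : size w = (\sum_c count (fun f => cmp f == c) w)%N.
    rewrite -sum1_size (eq_bigr (fun f => \sum_(c : C | cmp f == c) 1)%N) =>
      [|f _].
      by rewrite (exchange_big_dep predT)//=; apply: eq_bigr => c _;
        rewrite sum1_count.
    by rewrite (eq_bigl (pred1 (cmp f))) ?big_pred1_eq// => c; exact: eq_sym.
  rewrite -sum_nat_const; apply: leq_sum => c _; rewrite leqNgt; exact: hc.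
have [k ->] := prod_extract c w.
rewrite -big_filter (uN (c := c)) ?mul0r ?scaler0 ?filter_all// size_filter;
  exact: ltnW.
Qed.

End QuasiCommutativeWords.

(** * Relations between eigenvectors *)

Section Letters.
Variables (K : fieldType) (gT : finGroupType) (M : ydModule K gT).
Variable e : hbasis M.

Local Notation I := 'I_(hsize e).
Local Notation word := {fmonom I}.
Local Notation T := (freemod K word).
Local Notation B := (nichols e).
Local Notation d := (@hdeg _ _ _ e).
Local Notation npi := (@npi K gT M e).
Local Notation eps := (@fcoef K word mone).

Variables (F : finType) (iota : F -> T) (q : F -> F -> K) (lam : I -> F -> K).
Hypothesis iota_eps : forall f, eps (iota f) = 0.
Hypothesis iota_der : forall k f, tder k (iota f) = lam k f *: 1.
Hypothesis iota_act : forall k f f', lam k f != 0 ->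
  tact (d k) (iota f') = q f f' *: iota f'.

Local Notation mon w := (\prod_(f <- w) iota f).

Lemma tder_mon k f w : tder k (mon (f :: w)) =
  (lam k f * \prod_(f' <- w) q f f') *: mon w + iota f * tder k (mon w).
Proof.
rewrite big_cons tderM iota_der -scalerAl mul1r; congr (_ + _).
rewrite -scalerA; have [->|l0] := eqVneq (lam k f) 0; first by rewrite !scale0r.
congr (_ *: _); elim: w => [|g w IHw]; first by rewrite !big_nil tact1 scale1r.
by rewrite !big_cons tactM IHw (@iota_act k f)// -scalerAl -scalerAr scalerA.
Qed.

Lemma eps_mon f w : eps (mon (f :: w)) = 0.
Proof. by rewrite big_cons epsM iota_eps mul0r. Qed.

Local Notation u f := (npi (iota f)).

Lemma letterC f g : q f g * q g f = 1 -> u f * u g = q f g *: (u g * u f).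
Proof.
move=> qq; apply/eqP; rewrite -subr_eq0 -!rmorphM -linearZ -linearB;
  apply/eqP/npi_eq0.
have E a b : iota a * iota b = mon [:: a; b] by rewrite big_cons big_seq1.
apply: nichols_ideal_der => [|k].
  by rewrite !E linearB linearZ /= !eps_mon mulr0 subrr.
apply/npi_eq0; rewrite !E linearB linearZ /= !tder_mon !big_nil !big_seq1 tder1.
rewrite !mulr0 !addr0 !mulr1 -!scalerAr !mulr1 scalerDr !scalerA.
rewrite [q f g * (_ * _)]mulrCA qq mulr1 [lam k g *: _ + _]addrC.
by rewrite [lam k f * _]mulrC addrC subrr linear0.
Qed.

Lemma letterX f n : (0 < n)%N -> \sum_(i < n) q f f ^+ i = 0 -> u f ^+ n = 0.
Proof.
have mE m : mon (nseq m f) = iota f ^+ m by rewrite big_nseq iter_mulr_1.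
have qE m : \prod_(f' <- nseq m f) q f f' = q f f ^+ m.
  by rewrite big_nseq iter_mulr_1.
have der k m : tder k (iota f ^+ m) =
    (lam k f * \sum_(i < m) q f f ^+ i) *: iota f ^+ m.-1.
  elim: m => [|m IHm]; first by rewrite tder1 big_ord0 mulr0 scale0r.
  rewrite -mE (tder_mon k f (nseq m f)) qE mE IHm -scalerAr -exprS big_ord_recr.
  rewrite /= mulrDr scalerDl addrC; congr (_ + _).
  by case: m {IHm} => [|m //]; rewrite big_ord0 mulr0 !scale0r.
move=> n0 qn; rewrite -rmorphXn; apply/npi_eq0;
  apply: nichols_ideal_der => [|k].
  by case: n n0 {qn} => // n _; rewrite exprS epsM iota_eps mul0r.
by apply/npi_eq0; rewrite der qn mulr0 scale0r linear0.
Qed.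

(** Modulo the squares of the letters, the skew derivatives of [fgfg] and of
    [gfgf] lie in the span of [fgf] and [gfg]; they are proportional because [q
    f g ^+ 2 * q g f ^+ 2 = 1]. *)
Lemma letter_braid f g : q f f = -1 -> q g g = -1 -> q f g * q g f = -1 ->
  u f * u g * u f * u g = - (q f g ^+ 2) *: (u g * u f * u g * u f).
Proof.
move=> qf qg qq.
have sq h : q h h = -1 -> u h * u h = 0.
  by move=> qh; rewrite -expr2 letterX// !big_ord_recr big_ord0 /= qh add0r
    subrr.
have [uf ug] := (sq f qf, sq g qg).
have der a b k : q a a = -1 -> q b b = -1 -> u a * u a = 0 -> u b * u b = 0 ->
    npi (tder k (mon [:: a; b; a; b])) =
    - (lam k a * q a b ^+ 2) *: (u b * u a * u b) + lam k b *: (u a * u b * u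
      a).
  move=> qa qb ua ub.
  rewrite !tder_mon !big_cons !big_nil tder1 qa qb !mulr0 !addr0 !mulr1 !mulrDr.
  rewrite -!scalerAr !mulr1 !raddfD /= !linearZ /= !rmorphM /= ub.
  rewrite [u a * (u a * u b)]mulrA ua mul0r mulr0 !scaler0 !add0r !mulrA.
  by rewrite mulrN1 mulNr.
have E a b : u a * u b * u a * u b = npi (mon [:: a; b; a; b]).
  by rewrite !big_cons big_nil mulr1 !rmorphM /= !mulrA.
apply/eqP; rewrite -subr_eq0 scaleNr opprK !E -linearZ -linearD;
  apply/eqP/npi_eq0.
apply: nichols_ideal_der => [|k].
  by rewrite linearD linearZ /= !eps_mon mulr0 addr0.
apply/npi_eq0; rewrite linearD linearZ /= linearD linearZ /= !der// scalerDr
  !scalerA.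
have -> : q f g ^+ 2 * - (lam k g * q g f ^+ 2) = - lam k g.
  by rewrite mulrN mulrCA -exprMn qq sqrrN expr1n mulr1.
by rewrite [q f g ^+ 2 * _]mulrC !scaleNr addrA addrK addNr.
Qed.

(** Only alternating words survive, as the squares of the letters vanish; and
    rewriting [fgfg] as a multiple of [gfgf] in [fgfgf] creates a square. *)
Lemma letter_block f g w : q f f = -1 -> q g g = -1 -> q f g * q g f = -1 ->
  all (fun h => h \in [:: f; g]) w -> (5 <= size w)%N -> \prod_(h <- w) u h = 0.
Proof.
move=> qf qg qq wfg w5.
have sq h : h \in [:: f; g] -> u h * u h = 0.
  move=> hfg; have qh : q h h = -1 by move: hfg;
    rewrite !inE => /orP[/eqP->|/eqP->].
  by rewrite -expr2 letterX// !big_ord_recr big_ord0 /= qh add0r subrr.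
have qq' : q g f * q f g = -1 by rewrite mulrC.
have five a b : a \in [:: f; g] -> b \in [:: f; g] -> a != b ->
    u a * u b * u a * u b * u a = 0.
  move=> aS bS ab; have -> : u a * u b * u a * u b = - (q a b ^+ 2) *: (u b * u
    a * u b * u a).
    move: aS bS ab; rewrite !inE => /orP[]/eqP-> /orP[]/eqP->;
      rewrite ?eqxx// => _; exact: letter_braid.
  by rewrite -scalerAl -(mulrA (u b * u a * u b)) sq// mulr0 scaler0.
case: w wfg w5 => [//|a [//|b [//|c [//|a' [//|c' w]]]]] /=.
move=> /and5P[aS bS cS a'S /andP[c'S _]] _; rewrite !big_cons !mulrA.
have [<-|ab] := eqVneq a b; first by rewrite sq// !mul0r.
have [<-|bc] := eqVneq b c; first by rewrite -[u a * u b * u b]mulrA sq// mulr0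
  !mul0r.
have [<-|ca'] := eqVneq c a'.
  by rewrite -[u a * u b * u c * u c]mulrA sq// mulr0 !mul0r.
have [<-|a'c'] := eqVneq a' c'.
  by rewrite -[u a * u b * u c * u a' * u a']mulrA sq// mulr0 !mul0r.
have third x y z : x \in [:: f; g] -> y \in [:: f; g] -> z \in [:: f; g] ->
    x != y -> y != z -> z = x.
  by rewrite !inE => /orP[]/eqP-> /orP[]/eqP-> /orP[]/eqP->; rewrite ?eqxx.
have ac := third a b c aS bS cS ab bc; have ba' :=
  third b c a' bS cS a'S bc ca'.
have cc' := third c a' c' cS a'S c'S ca' a'c'.
by rewrite cc' ba' ac five// mul0r.
Qed.

End Letters.

(** * Nichols algebras with small blocks *)

Section Blocks.
Variables (K : fieldType) (gT : finGroupType) (M : ydModule K gT).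
Variable e : hbasis M.

Local Notation I := 'I_(hsize e).
Local Notation word := {fmonom I}.
Local Notation T := (freemod K word).
Local Notation d := (@hdeg _ _ _ e).
Local Notation npi := (@npi K gT M e).
Local Notation eps := (@fcoef K word mone).

Variables (F C : finType) (iota : F -> T) (q : F -> F -> K) (lam : I -> F -> K).
Variables (cmp : F -> C) (m : I -> F -> K).
Hypothesis iota_eps : forall f, eps (iota f) = 0.
Hypothesis iota_der : forall k f, tder k (iota f) = lam k f *: 1.
Hypothesis iota_act : forall k f f', lam k f != 0 ->
  tact (d k) (iota f') = q f f' *: iota f'.
Hypothesis tgen_iota : forall k, tgen k = \sum_f m k f *: iota f.

(** The blocks whose Nichols algebras are a quantum line, and that of Cartan
    type A_2 with all parameters equal to -1. *)
Definition block_A1 c := exists f n, [/\ (0 < n)%N,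
  \sum_(i < n) q f f ^+ i = 0 & forall h, cmp h = c -> h = f].

Definition block_A2 c := exists f g, [/\ q f f = -1, q g g = -1,
  q f g * q g f = -1 & forall h, cmp h = c -> h \in [:: f; g]].

Local Notation u f := (npi (iota f)).

Lemma block_nilpotent c : block_A1 c \/ block_A2 c -> exists N, forall w,
  all (fun f => cmp f == c) w -> (N <= size w)%N -> \prod_(f <- w) u f = 0.
Proof.
case=> [[f [n [n0 qn hc]]]|[f [g [qf qg qq hc]]]].
  exists n => w wc nw; rewrite (eq_big_seq (fun=> u f)) =>
    [|h /(allP wc)/eqP/hc -> //].
  rewrite big_const_seq count_predT iter_mulr_1 -(subnKC nw) exprD.
  by rewrite (letterX iota_eps iota_der iota_act) ?mul0r.
exists 5 => w wc w5; apply: (letter_block iota_eps iota_der iota_act qf qg qq)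
  => //.
by apply/allP => h /(allP wc)/eqP/hc.
Qed.

Lemma nichols_finite_dimensional :
  (forall f g, cmp f != cmp g -> q f g * q g f = 1) ->
  (forall c, block_A1 c \/ block_A2 c) -> finite_dimensional (nichols e).
Proof.
move=> qC hC; have [N hN] := boolp.choice (fun c => block_nilpotent (hC c)).
pose N0 := \max_c N c.
have long w : (#|C| * N0 < size w)%N -> \prod_(f <- w) u f = 0.
  apply: (@long_word_eq0 _ _ _ _ _ cmp) => [f g fg|c w' wc hw'].
    by exists (q f g); exact: (letterC iota_eps iota_der iota_act (qC _ _ fg)).
  by apply: (hN c) => //; apply: leq_trans hw'; exact: leq_bigmax.
apply: (@finite_dimensional_words _ _ _ _ (#|C| * N0).+1) => s hs.
rewrite -tgen_word -[npi _]mul1r.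
suff span y : (forall w, size w = size s -> y * \prod_(f <- w) u f = 0) ->
    y * npi (\prod_(k <- s) tgen k) = 0.
  by apply: span => w ws; rewrite mul1r long// ws.
elim: s y {hs} => [|k s IHs] y hy.
  by have := hy [::] erefl; rewrite !big_nil rmorph1.
rewrite big_cons rmorphM /= mulrA tgen_iota linear_sum mulr_sumr mulr_suml
  big1// => f _.
rewrite linearZ /= -scalerAr -scalerAl IHs ?scaler0// => w ws.
by have := hy (f :: w); rewrite big_cons mulrA /= ws => ->.
Qed.

End Blocks.

(** * Monomial Yetter-Drinfel'd modules *)

Section MonomialModule.
Variables (K : fieldType) (gT : finGroupType) (P : finType).
Variables (deg : P -> gT) (pi : gT -> P -> P) (c : gT -> P -> K).
Hypotheses (pi1 : forall p, pi 1%g p = p)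
  (piM : forall g h p, pi (g * h)%g p = pi g (pi h p))
  (c1 : forall p, c 1%g p = 1)
  (cM : forall g h p, c (g * h)%g p = c g (pi h p) * c h p)
  (deg_pi : forall g p, deg (pi g p) = (g * deg p * g^-1)%g).

Local Notation V := {ffun P -> K^o}.

Definition mvec (p : P) : V := [ffun p' => (p == p')%:R].

Lemma mvec_expand (v : V) : v = \sum_p (v p : K) *: mvec p.
Proof.
apply/ffunP => p; rewrite sum_ffunE (bigD1 p)//= !ffunE eqxx [_ *: _]mulr1.
by rewrite big1 ?addr0// => p' /negPf p'p; rewrite !ffunE p'p [_ *: _]mulr0.
Qed.

Definition mact0 g (v : V) : V := \sum_p (v p * c g p : K) *: mvec (pi g p).

Lemma mact0_is_linear g : linear (mact0 g).
Proof.
move=> k v w; rewrite /mact0 scaler_sumr -big_split; apply: eq_bigr => p _ /=.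
by rewrite !ffunE mulrDl scalerDl scalerA mulrA.
Qed.

HB.instance Definition _ g := GRing.isLinear.Build K V V _ (mact0 g)
  (mact0_is_linear g).

Definition mact g : 'End(V) := linfun (mact0 g).

Lemma mact_vec g p : mact g (mvec p) = c g p *: mvec (pi g p).
Proof.
rewrite lfunE /= /mact0 (bigD1 p)//= !ffunE eqxx mul1r big1 ?addr0// =>
  p' /negPf p'p.
by rewrite !ffunE eq_sym p'p mul0r scale0r.
Qed.

Lemma mvec_ext (f g : 'End(V)) : (forall p, f (mvec p) = g (mvec p)) -> f = g.
Proof.
move=> fg; apply/lfunP => v; rewrite (mvec_expand v) !linear_sum.
by apply: eq_bigr => p _; rewrite !linearZ /= fg.
Qed.

Lemma mact1 : mact 1%g = \1%VF.
Proof. by apply: mvec_ext => p; rewrite mact_vec pi1 c1 scale1r id_lfunE. Qed.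

Lemma mactM g h : mact (g * h)%g = (mact g \o mact h)%VF.
Proof.
apply: mvec_ext => p; rewrite comp_lfunE !mact_vec linearZ /= mact_vec.
by rewrite piM cM scalerA mulrC.
Qed.

Definition mpart g : {vspace V} := <<[seq mvec p | p <- enum P & deg p ==
  g]>>%VS.

Lemma mpartP g (v : V) : reflect (forall p, deg p != g ->
  v p = 0) (v \in mpart g).
Proof.
apply: (iffP idP) => [|v0].
  pose X := [seq mvec p | p <- enum P & deg p == g].
  move=> vX p pg; rewrite (@coord_span _ _ _ (in_tuple X) v vX).
  rewrite sum_ffunE big1// => i _; rewrite ffunE.
  have /mapP[p' + ->] := mem_nth 0 (ltn_ord i : (i < size X)%N).
  rewrite mem_filter ffunE => /andP[/eqP dp' _]; case: eqP => [p'p|_].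
    by rewrite -p'p dp' eqxx in pg.
  exact: mulr0.
rewrite (mvec_expand v); apply: memv_suml => p _.
have [pg|/v0 ->] := eqVneq (deg p) g; last by rewrite scale0r mem0v.
by apply/memvZ/memv_span/map_f; rewrite mem_filter pg eqxx mem_enum.
Qed.

Lemma mvec_part p : mvec p \in mpart (deg p).
Proof. by apply/mpartP => p'; rewrite ffunE; have [<-|//] := eqVneq p p';
  rewrite eqxx. Qed.

Lemma mpart_full : (\sum_g mpart g = fullv)%VS.
Proof.
apply/eqP; rewrite eqEsubv subvf; apply/subvP => v _.
rewrite (mvec_expand v); apply: memv_suml => p _; apply: memvZ.
by apply: subvP (mvec_part p); rewrite (sumv_sup (deg p)).
Qed.

Lemma mpart_direct : directv (\sum_g mpart g)%VS.
Proof.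
apply/directv_sum_independent => us usg us0 g _; apply/ffunP => p;
  rewrite ffunE.
have [pg|pg] := eqVneq (deg p) g; last by have /mpartP -> := usg g isT.
have := congr1 (fun v : V => v p) us0; rewrite sum_ffunE ffunE (bigD1 g)//=
  big1 ?addr0// => h hg.
by have /mpartP -> := usg h isT; rewrite // pg eq_sym.
Qed.

Lemma mact_part_sub g h : (mact g @: mpart h <= mpart (g * h * g^-1)%g)%VS.
Proof.
rewrite limg_span; apply/span_subvP => _ /mapP[_ /mapP[p + ->] ->].
rewrite mem_filter => /andP[/eqP <- _]; rewrite mact_vec; apply: memvZ.
by rewrite -deg_pi mvec_part.
Qed.

Lemma mact_part g h : (mact g @: mpart h)%VS = mpart (g * h * g^-1)%g.
Proof.
apply/eqP; rewrite eqEsubv mact_part_sub; apply/subvP => v vg.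
have -> : v = mact g (mact g^-1%g v).
  by rewrite -comp_lfunE -mactM mulgV mact1 id_lfunE.
apply: memv_img; have := subvP (mact_part_sub g^-1%g (g * h * g^-1)%g) _
  (memv_img _ vg).
by rewrite invgK -!mulgA mulKg mulVg mulg1.
Qed.

(** [G] permutes the basis [P] through [pi], up to the scalars [c]. *)
Definition monomial_module : ydModule K gT :=
  YDModule mpart_full mpart_direct mact1 mactM mact_part.

Local Notation M := monomial_module.

Definition mtuple : #|P|.-tuple V := [tuple mvec (enum_val i) | i < #|P|].

Lemma mtuple_basis : basis_of fullv mtuple.
Proof.
rewrite /basis_of; apply/andP; split.
  rewrite eqEsubv subvf; apply/subvP => v _.
  rewrite (mvec_expand v); apply: memv_suml => p _; apply/memvZ/memv_span.
  by apply/tnthP; exists (enum_rank p); rewrite tnth_mktuple enum_rankK.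
apply/freeP => k k0 i; have := congr1 (fun v : V => v (enum_val i)) k0.
have E (j : 'I_#|P|) : mtuple`_j = mvec (enum_val j) by rewrite -(tnth_nth 0)
  tnth_mktuple.
rewrite sum_ffunE ffunE (bigD1 i)//= big1 => [|j /negPf ji]; rewrite E !ffunE.
  by rewrite eqxx addr0 [_ *: _]mulr1.
by rewrite (inj_eq enum_val_inj) ji; exact: mulr0.
Qed.

Lemma mtuple_part i : tnth mtuple i \in yd_part M (deg (enum_val i)).
Proof. by rewrite tnth_mktuple; exact: mvec_part. Qed.

Definition monomial_hbasis : hbasis M :=
  @HBasis K gT M #|P| mtuple (fun i => deg (enum_val i)) mtuple_basis
    mtuple_part.

Local Notation e := monomial_hbasis.

Lemma monomial_indecomposable : <<[set deg p | p : P]>>%g = [set: gT] ->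
  yd_indecomposable M.
Proof.
move=> degT; apply/eqP; rewrite eqEsubset subsetT -degT genS//.
apply/subsetP => _ /imsetP[p _ ->]; rewrite inE;
  apply: contraTneq (mvec_part p) => /= ->.
rewrite memv0; apply/eqP => /(congr1 (fun v : V => v p)).
by rewrite !ffunE eqxx => /eqP; rewrite oner_eq0.
Qed.

Definition mgen (p : P) := @tgen K gT M e (enum_rank p).

Lemma tnth_hvec p : tnth (hvec e) (enum_rank p) = mvec p.
Proof. by rewrite tnth_mktuple enum_rankK. Qed.

Lemma tact_mgen g p : tact g (mgen p) = c g p *: mgen (pi g p).
Proof.
have aE j : @acoef K gT M e g (enum_rank p) j = c g p * (enum_rank (pi g p) ==
  j)%:R.
  rewrite /acoef tnth_hvec [yd_act M g _]mact_vec linearZ /= -tnth_hvec;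
    congr (_ * _).
  exact: (@coord_hvec K gT M e).
rewrite tact_tgen tact_genE (bigD1 (enum_rank (pi g p)))//= big1 ?addr0 =>
  [|j /negPf jp].
  by rewrite aE eqxx mulr1.
by rewrite aE eq_sym jp mulr0 scale0r.
Qed.

Lemma tder_mgen (k : 'I_#|P|) p : @tder K gT M e k (mgen p) = (enum_val k ==
  p)%:R.
Proof. by rewrite tder_gen -(inj_eq enum_val_inj) enum_rankK. Qed.

Lemma tgen_mgen (k : 'I_#|P|) : @tgen K gT M e k = mgen (enum_val k).
Proof. by rewrite /mgen enum_valK. Qed.

End MonomialModule.

(** * The module of a symplectic family *)

(** The commutator takes values in the group of order two generated by [ep] and
    is read as an alternating form [ncm] on [G]. The [x (i, false)], [x (i,
    true)] are hyperbolic pairs for this form, and the [z j] lie in its radical.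
    The module has basis vectors of degrees [x a] and [ep * x a], exchanged by
    the elements that do not commute with [x a] and scaled by [qc], and one
    basis vector of degree [z j], scaled by [chi j]. *)
Section SymplecticModule.
Variables (K : fieldType) (gT : finGroupType) (n m : nat).
Variables (x : 'I_n * bool -> gT) (z : 'I_m -> gT) (ep : gT).
Variables (qc : gT -> K) (chi : 'I_m -> gT -> K).

Definition ncm (g h : gT) : bool := (g * h != h * g)%g.

Hypotheses (char2 : 2%:R != 0 :> K) (ep_neq1 : ep != 1%g)
  (ep2 : (ep * ep = 1)%g) (epC : forall g, (ep * g = g * ep)%g)
  (commE : forall g h, ncm g h -> (g * h = ep * (h * g))%g)
  (zC : forall j g, (z j * g = g * z j)%g)
  (x_ncm : forall a b, ncm (x a) (x b) = (a.1 == b.1) && (a.2 != b.2))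
  (gen : <<[set x a | a : ('I_n * bool)%type] :|: [set z j | j : 'I_m]>>%g =
    [set: gT])
  (qc1 : qc 1%g = 1) (qcM : forall g h, qc (g * h)%g = qc g * qc h)
  (qc_x : forall a, qc (x a) = -1) (qc_z : forall j, qc (z j) = 1)
  (qc_ep : qc ep = 1)
  (chi1 : forall j, chi j 1%g = 1)
  (chiM : forall j g h, chi j (g * h)%g = chi j g * chi j h)
  (chi_x : forall j a, chi j (x a) = 1)
  (chi_ep : forall j, chi j ep = 1)
  (chi_z : forall j k, j != k -> chi j (z k) = 1)
  (chi_zz : forall j, exists N, (0 < N)%N /\ \sum_(i < N) chi j (z j) ^+ i = 0).

Lemma commE' g h : (g * h = ep ^+ ncm g h * (h * g))%g.
Proof.
by case E: (ncm g h); [exact: commE|rewrite mul1g; apply/eqP/negPn;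
  rewrite -/(ncm g h) E].
Qed.

(** This is where centrality of [ep] and [ep * ep = 1] enter: the exponents of
    [ep] add up modulo two. *)
Lemma ncmM g h y : ncm (g * h)%g y = ncm g y (+) ncm h y.
Proof.
have E : (g * h * y = ep ^+ ncm g y * (ep ^+ ncm h y * (y * (g * h))))%g.
  rewrite -mulgA (commE' h y) !mulgA.
  have -> : (g * ep ^+ ncm h y = ep ^+ ncm h y * g)%g.
    by case: (ncm h y); rewrite /= ?expg1 ?expg0 ?mulg1 ?mul1g.
  rewrite -!mulgA [(g * (y * h))%g]mulgA (commE' g y) !mulgA;
    congr (_ * _ * _ * _)%g.
  by rewrite -!expgD addnC.
have H : ncm (g * h)%g y = (ep ^+ ncm g y * ep ^+ ncm h y != 1)%g.
  by rewrite {1}/ncm E mulgA -(inj_eq (mulIg (y * (g * h))^-1%g)) mulgK mulgV.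
rewrite H; case: (ncm g y); case: (ncm h y);
  by rewrite /= ?expg1 ?expg0 ?ep2 ?mulg1 ?mul1g ?eqxx ?ep_neq1.
Qed.

Lemma ncm1 y : ncm 1%g y = false.
Proof. by rewrite /ncm mul1g mulg1 eqxx. Qed.

Lemma ncm_ep y : ncm ep y = false.
Proof. by rewrite /ncm epC eqxx. Qed.

Lemma ncm_z j y : ncm (z j) y = false.
Proof. by rewrite /ncm zC eqxx. Qed.

Definition sletter : finType := ('I_n * bool * bool + 'I_m)%type.

Definition sbase (p : sletter) : gT :=
  match p with inl (a, _) => x a | inr j => z j end.
Definition sdeg (p : sletter) : gT :=
  match p with inl (a, s) => (ep ^+ s * x a)%g | inr j => z j end.
Definition spi (g : gT) (p : sletter) : sletter :=
  match p with inl (a, s) => inl (a, s (+) ncm g (x a)) | inr j => inr j end.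
Definition sc (g : gT) (p : sletter) : K :=
  match p with inl _ => qc g | inr j => chi j g end.

Lemma spi1 p : spi 1%g p = p.
Proof. by case: p => [[a s]|j] //=; rewrite ncm1 addbF. Qed.

Lemma spiM g h p : spi (g * h)%g p = spi g (spi h p).
Proof. by case: p => [[a s]|j] //=; rewrite ncmM [ncm g _ (+) _]addbC addbA.
  Qed.

Lemma sc1 p : sc 1%g p = 1.
Proof. by case: p => [[a s]|j] /=. Qed.

Lemma scM g h p : sc (g * h)%g p = sc g (spi h p) * sc h p.
Proof. by case: p => [[a s]|j] /=. Qed.

Lemma sdeg_pi g p : sdeg (spi g p) = (g * sdeg p * g^-1)%g.
Proof.
case: p => [[a s]|j] /=; last by rewrite -zC mulgK.
have -> : (g * (ep ^+ s * x a) = ep ^+ s * (g * x a))%g.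
  by rewrite !mulgA; congr (_ * _)%g; case: (s);
    rewrite /= ?expg1 ?expg0 ?epC ?mulg1 ?mul1g.
rewrite (commE' g (x a)) -!mulgA mulgV mulg1 mulgA; congr (_ * _)%g.
by case: (s); case: (ncm g (x a)); rewrite /= ?expg1 ?expg0 ?ep2 ?mulg1 ?mul1g.
Qed.

Local Notation M := (monomial_module spi1 spiM sc1 scM sdeg_pi).
Local Notation e := (monomial_hbasis spi1 spiM sc1 scM sdeg_pi).
Local Notation mg := (mgen spi1 spiM sc1 scM sdeg_pi).
Local Notation T := (freemod K {fmonom 'I_(hsize e)}).

Lemma symplectic_indecomposable : yd_indecomposable M.
Proof.
apply: monomial_indecomposable; apply/eqP;
  rewrite eqEsubset subsetT -gen genS//.
apply/subsetP => g; rewrite inE => /orP[] /imsetP[a _ ->]; apply/imsetP.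
  by exists (inl (a, false)); rewrite //= mul1g.
by exists (inr a).
Qed.

(** As [ep] acts trivially, each pair of basis vectors of degrees [x a] and [ep
    * x a] splits into two eigenvectors for the whole group. *)
Definition siota (f : sletter) : T :=
  match f with
  | inl (a, b) => mg (inl (a, false)) + (-1) ^+ b *: mg (inl (a, true))
  | inr j => mg (inr j)
  end.

Definition spsi (f : sletter) (g : gT) : K :=
  match f with
  | inl (a, b) => qc g * (-1) ^+ (b && ncm g (x a))
  | inr j => chi j g
  end.

Lemma tact_siota g f : tact g (siota f) = spsi f g *: siota f.
Proof.
case: f => [[a b]|j] /=; last by rewrite tact_mgen.
rewrite linearD linearZ /= !tact_mgen /= -!scalerA scalerDr !scalerA.
case: (ncm g (x a)); rewrite ?andbF ?andbT /= ?mulr1 ?mul1r.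
  by rewrite -expr2 sqrr_sign scale1r [RHS]scalerDr scalerA addrC (mulrC _ (qc
    g)).
by rewrite expr0 scale1r [RHS]scalerDr scalerA (mulrC _ (qc g)).
Qed.

Lemma spsi_deg f k s : spsi f (ep ^+ (s : bool) * k)%g = spsi f k.
Proof.
case: s; rewrite ?expg0 ?mul1g// expg1.
by case: f => [[a b]|j] /=; rewrite ?qcM ?qc_ep ?chiM ?chi_ep ?mul1r ?ncmM
  ?ncm_ep.
Qed.

Definition sq f f' := spsi f' (sbase f).

Definition sdual (p f : sletter) : K :=
  match p, f with
  | inl (a, s), inl (a', b) => (a == a')%:R * (-1) ^+ (s && b)
  | inr j, inr j' => (j == j')%:R
  | _, _ => 0
  end.

Lemma tder_siota (k : 'I_(hsize e)) f :
  tder k (siota f) = sdual (enum_val (k : 'I_#|sletter|)) f *: 1.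
Proof.
case: f => [[a b]|j] /=; last first.
  rewrite tder_mgen -scaler_nat; congr (_ *: _).
  by case: (enum_val _) => [[a' s]|j'].
rewrite linearD linearZ /= !tder_mgen; case: (enum_val _) => [[a' s]|j'] /=;
  last first.
  by rewrite scaler0 addr0 scale0r.
have E s' : (inl (a', s) == inl (a, s') :> sletter) = (a' == a) && (s == s') by
  [].
rewrite !E {E}; case: (a' == a); case: s => /=;
  rewrite ?mul1r ?mul0r ?scale0r ?scaler0 ?add0r ?addr0//.
by rewrite scale1r.
Qed.

Lemma tact_sdual (k : 'I_(hsize e)) f f' :
  sdual (enum_val (k : 'I_#|sletter|)) f != 0 ->
  tact (hdeg k) (siota f') = sq f f' *: siota f'.
Proof.
rewrite tact_siota /= => k0; congr (_ *: _); rewrite /sq.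
case: (enum_val _) k0 => [[a s]|j]; case: f => [[a' b]|j'] /=; rewrite ?eqxx//.
  by have [<- _|] := eqVneq a a'; [exact: spsi_deg|rewrite mul0r eqxx].
by have [<- _|] := eqVneq j j'; rewrite ?eqxx.
Qed.

Lemma tgen_siota (k : 'I_(hsize e)) :
  tgen k = \sum_f (if f is inl _ then 2%:R^-1 else 1)
     * sdual (enum_val (k : 'I_#|sletter|)) f *: siota f.
Proof.
rewrite tgen_mgen; case: (enum_val _) => [[a s]|j]; last first.
  rewrite (bigD1 (inr j))//= eqxx mul1r scale1r big1 ?addr0// => -[[a b]|j'].
    by rewrite mulr0 scale0r.
  by rewrite eqE /= => /negPf; rewrite eq_sym => ->; rewrite mulr0 scale0r.
have tf : inl (a, true) != inl (a, false) :> sletter by apply/eqP => -[].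
rewrite (bigD1 (inl (a, false)))//= (bigD1 (inl (a,
  true)) tf) /= [X in _ = _ + (_ + X)]big1 => [|[[a' b]|j']]; last first.
- by rewrite mulr0 scale0r.
- have [<-|_] := eqVneq a a'; first by case: b; rewrite eqxx ?andbF.
  by rewrite /= mul0r mulr0 scale0r.
rewrite addr0 eqxx andbF andbT expr0 !mul1r mulr1 scale1r -scalerA -scalerDr.
rewrite expr1 scaleN1r; case: s => /=.
  rewrite expr1 scaleN1r opprB [X in _ + X]addrC addrACA addrN add0r.
  by rewrite -mulr2n -scaler_nat scalerA mulVf// scale1r.
rewrite expr0 scale1r addrACA addrN addr0.
by rewrite -mulr2n -scaler_nat scalerA mulVf// scale1r.
Qed.

Lemma sqE f f' : sq f f' = match f, f' with
  | inl (a, _), inl (a', b') => - (-1) ^+ (b' && ncm (x a) (x a'))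
  | inl _, inr _ => 1
  | inr _, inl _ => 1
  | inr j, inr j' => chi j' (z j)
  end.
Proof.
case: f f' => [[a b]|j] [[a' b']|j'] //=; rewrite /sq /=.
- by rewrite qc_x mulN1r.
- by rewrite qc_z ncm_z andbF mul1r.
Qed.

(** For letters over a noncommuting pair [sq f g * sq g f] is -1 or 1 according
    to whether their signs differ or agree. So each hyperbolic pair carries two
    blocks of type A_2, which the sum of [t] and [b] tells apart. *)
Definition sblock (f : sletter) : ('I_n * bool + 'I_m)%type :=
  match f with inl ((i, t), b) => inl (i, t (+) b) | inr j => inr j end.

Lemma sblockC f g : sblock f != sblock g -> sq f g * sq g f = 1.
Proof.
rewrite !sqE; case: f g => [[[i t] b]|j] [[[i' t'] b']|j'] //=;
  rewrite ?mulr1//.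
  rewrite !x_ncm /= mulrNN -signr_addb.
  have [<-|ii'] := eqVneq i i'; rewrite ?andbF//= ?mulr1//.
  by rewrite eqE /= eqE /= eqxx; case: t; case: t'; case: b; case: b'.
by rewrite eqE /= => jj'; rewrite !chi_z ?mulr1// eq_sym.
Qed.

Lemma sblock_ok c : block_A1 sq sblock c \/ block_A2 sq sblock c.
Proof.
case: c => [[i s]|j].
  right; exists (inl ((i, false), s)), (inl ((i, true), ~~ s));
    rewrite !sqE !x_ncm /= !eqxx /= !andbF.
  rewrite !andbT; split=> //; first by rewrite mulrNN -signr_addb; case: s.
  move=> [[[i' t] b]|//] /= [-> <-]; rewrite !inE.
  by case: t; case: b; rewrite /= ?eqxx ?orbT.
left; have [N [N0 hN]] := chi_zz j; exists (inr j), N; split=> //.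
by move=> [[[? ?] ?]|j'] //= [->].
Qed.

Lemma eps_siota f : fcoef mone (siota f) = 0.
Proof.
have E p : fcoef mone (mg p) = 0 by rewrite /mgen -[tgen _]mulr1 eps_tgen.
by case: f => [[a b]|j] /=; rewrite ?linearD ?linearZ /= !E ?mulr0 ?addr0.
Qed.

Theorem symplectic_nichols : finite_dimensional (nichols e).
Proof.
exact: (nichols_finite_dimensional eps_siota tder_siota tact_sdual tgen_siota
  sblockC sblock_ok).
Qed.

Theorem symplectic_module_exists : exists (N : ydModule K gT) (b : hbasis N),
  yd_indecomposable N /\ finite_dimensional (nichols b).
Proof.
exists M, e; split; [exact: symplectic_indecomposable|exact:
  symplectic_nichols].
Qed.

End SymplecticModule.

(** * Dual bases of finite abelian groups *)

Section AbelianDuals.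
Variables (K : closedFieldType) (aT : finGroupType).
Implicit Types (Q A B : {group aT}) (y : aT).

Definition char_on Q (f : aT -> K) :=
  f 1%g = 1 /\ {in Q &, forall y y', f (y * y')%g = f y * f y'}.

(** In characteristic zero this says that [f y] is a root of unity other than 1;
    it makes the [N]-th power of a letter with parameter [f y] vanish. *)
Definition nontrivial_at (f : aT -> K) y :=
  exists N, (0 < N)%N /\ \sum_(i < N) f y ^+ i = 0.

Lemma geometric_root n : (1 < n)%N -> exists zeta : K,
  \sum_(i < n) zeta ^+ i = 0.
Proof.
move=> n1; pose p : {poly K} := \poly_(i < n) 1.
have /closed_rootP[zeta /rootP pz] : size p != 1%N.
  by rewrite size_poly_eq ?oner_eq0// -(prednK (ltnW n1)) eqSS -lt0n -ltnS
    prednK// ltnW.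
exists zeta; rewrite -[RHS]pz horner_poly; apply: eq_bigr => i _.
by rewrite mul1r.
Qed.

Lemma cycle_char y : y != 1%g -> exists f, char_on <[y]> f /\ nontrivial_at f y.
Proof.
move=> y1; have /geometric_root[zeta hz] : (1 < #[y]%g)%N.
  by rewrite ltn_neqAle eq_sym order_eq1 y1 order_gt0.
have zN : zeta ^+ #[y]%g = 1.
  by apply/eqP; rewrite -subr_eq0 subrX1 hz mulr0.
have zmod i j : (y ^+ i = y ^+ j)%g -> zeta ^+ i = zeta ^+ j.
  move/eqP; rewrite eq_expg_mod_order => /eqP ij.
  by rewrite -(expr_mod i zN) -(expr_mod j zN) ij.
pose f u := if [pick i : 'I_#[y]%g | (y ^+ i == u)%g] is Some i then zeta ^+ i
  else 1.
have fE i : f (y ^+ i)%g = zeta ^+ i.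
  rewrite /f; case: pickP => [j /eqP/zmod //|no].
  have := no (Ordinal (ltn_pmod i (order_gt0 y))).
  by rewrite /= expg_mod_order eqxx.
have fy : f y = zeta by rewrite -[y in f y]expg1 fE.
exists f; split; last by exists #[y]%g; rewrite order_gt0 fy.
split; first by rewrite -(expg0 y) fE.
by move=> _ _ /cycleP[i ->] /cycleP[j ->]; rewrite -expgD !fE exprD.
Qed.

Lemma dprod_char (A B Q : {group aT}) f : (A \x B = Q)%g -> char_on A f ->
  exists F, [/\ char_on Q F, {in A, F =1 f} & {in B, forall y, F y = 1}].
Proof.
rewrite dprodC => /[dup] dBA /dprodP[_ BAQ cAB tiBA] [f1 fM].
have compl : A \in [complements to B in Q]%g by apply/complP; split.
have nBQ : (B <| Q)%g by rewrite -BAQ -cent_joinEr// normalYl cents_norm.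
exists (f \o remgr B A); split.
- split=> [|y y' Qy Qy'] /=; first by rewrite remgr1.
  rewrite (remgrM compl nBQ)// fM// mem_remgr// BAQ//.
- by move=> y Ay; rewrite /= (remgr_id tiBA).
- by move=> y By; rewrite /= remgr1.
Qed.

(** The [a j] generate the factors of a decomposition into cyclic groups, and [f
    j] is a nontrivial character of the [j]-th factor extended by the
    projection. *)
Lemma abelian_dual_basis Q : abelian Q -> exists m
    (a : 'I_m -> aT) (f : 'I_m -> aT -> K),
  [/\ <<[set a j | j : 'I_m]>>%g = Q, forall j, char_on Q (f j),
      forall j, nontrivial_at (f j) (a j) & forall j k, j != k ->
        f j (a k) = 1].
Proof.
move=> /abelian_structure[b + _]; elim: b Q => [|y b IHb] Q.
  rewrite big_nil => Q1; exists 0%N, (fun=> 1%g), (fun _ _ => 1).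
  split=> [|[]//|[]//|[]//].
  rewrite -Q1; apply/eqP; rewrite eqEsubset gen_subG sub1G andbT.
  by apply/subsetP => u /imsetP[[j j0] _ _].
rewrite big_cons => dQ; have [[_ B _ dB] _ _ _] := dprodP dQ.
have [m [a [f [aB fB fa fak]]]] := IHb _ dB; rewrite dB in dQ.
have [y1|y1] := eqVneq y 1%g.
  exists m, a, f; have -> : Q = B; last by [].
  by apply: val_inj; rewrite /= -dQ y1 cycle1 dprod1g.
have [f0 [f0c f0n]] := cycle_char y1.
have [F0 [F0Q F0y F0B]] := dprod_char dQ f0c.
have [F FP] : exists F : 'I_m -> aT -> K, forall j,
    [/\ char_on Q (F j), {in B, F j =1 f j} & {in <[y]>%g, forall u,
      F j u = 1}].
  have [F FP] := boolp.choice (fun j => dprod_char (etrans (dprodC _ _) dQ) (fB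
    j)).
  by exists F.
have aB' j : a j \in B by rewrite -aB mem_gen// imset_f.
pose a' (j : 'I_m.+1) := if unlift ord0 j is Some j' then a j' else y.
pose F' (j : 'I_m.+1) := if unlift ord0 j is Some j' then F j' else F0.
exists m.+1, a', F'; split=> [|j|j|j k].
- have [_ yBQ _ _] := dprodP dQ; apply/eqP; rewrite eqEsubset gen_subG;
  apply/andP; split.
    apply/subsetP => _ /imsetP[j _ ->]; rewrite /a' -yBQ.
    by case: unliftP => [j' _|_]; apply/mulsgP;
      [exists 1%g (a j') | exists y 1%g];
        rewrite ?mul1g ?mulg1 ?group1 ?cycle_id.
  rewrite -yBQ mul_subG//; first by rewrite cycle_subG mem_gen//;
    apply/imsetP; exists ord0; rewrite ?/a' ?unlift_none.
  rewrite -aB gen_subG; apply/subsetP => _ /imsetP[j _ ->]; rewrite mem_gen//.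
  by apply/imsetP; exists (lift ord0 j); rewrite // /a' liftK.
- by rewrite /F'; case: unliftP => [j' _|_] //; have [] := FP j'.
- rewrite /F' /a'; case: unliftP => [j' _|_].
    have [_ Ff _] := FP j'; have [N [N0 hN]] := fa j'; exists N; split=> //.
    by rewrite Ff.
  by have [N [N0 hN]] := f0n; exists N; rewrite F0y ?cycle_id.
- rewrite /F' /a'; case: unliftP => [j' ->|->]; case: unliftP => [k' ->|->];
  rewrite ?eqxx// => jk.
  + by have [_ Ff _] := FP j'; rewrite Ff// fak.
  + by have [_ _ ->] := FP j'; rewrite ?cycle_id.
  + by rewrite F0B.
Qed.

End AbelianDuals.

(** * Hyperbolic pairs for the commutator form *)

Section SymplecticFamily.
Variables (gT : finGroupType) (ep : gT).
Hypotheses (ep_neq1 : ep != 1%g)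
  (ep2 : (ep * ep = 1)%g) (epC : forall g, (ep * g = g * ep)%g)
  (commE : forall g h : gT, ncm g h -> (g * h = ep * (h * g))%g).

Let nM := ncmM ep_neq1 ep2 epC commE.

Lemma ncmC (g h : gT) : ncm g h = ncm h g.
Proof. by rewrite /ncm eq_sym. Qed.

Lemma ncmMr (g h y : gT) : ncm y (g * h)%g = ncm y g (+) ncm y h.
Proof. by rewrite ncmC nM !(ncmC _ y). Qed.

Lemma ncmxx (g : gT) : ncm g g = false.
Proof. by rewrite /ncm eqxx. Qed.

Lemma ncm_cent (g h : gT) : (h \in 'C[g]%g) = ~~ ncm g h.
Proof. by rewrite /ncm negbK; apply/cent1P/eqP. Qed.

Definition symplectic n (x : 'I_n * bool -> gT) :=
  forall a b, ncm (x a) (x b) = (a.1 == b.1) && (a.2 != b.2).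

(** Gram-Schmidt for the commutator form, whose values lie in a group of order
    two: a noncommuting pair splits off its common centralizer. *)
Lemma symplectic_family (C : {group gT}) : exists n (x : 'I_n * bool -> gT),
  [/\ symplectic x, forall a, x a \in C &
      forall g, g \in C -> exists h, [/\ h \in <<[set x a | a : ('I_n *
        bool)%type]>>%g,
         (h^-1 * g)%g \in C & forall y, y \in C -> ~~ ncm (h^-1 * g)%g y]].
Proof.
have [k] := ubnP #|C|; elim: k C => // k IHk C; rewrite ltnS => Ck.
have [/existsP[a /existsP[b /and3P[Ca Cb ab]]]|no] :=
    boolP [exists a, [exists b, [&& a \in C, b \in C & ncm a b]]]; last first.
  exists 0%N, (fun=> 1%g); split=> [[[]]//|[[]]//|g Cg].
  exists 1%g; rewrite group1 invg1 mul1g; split=> // y Cy.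
  apply: contra no => gy; apply/existsP; exists g; apply/existsP; exists y.
  by rewrite Cg Cy.
pose C' := (C :&: 'C[a] :&: 'C[b])%G.
have C'P y : (y \in C') = [&& y \in C, ~~ ncm a y & ~~ ncm b y].
  by rewrite 2!in_setI !ncm_cent andbA.
have /IHk[n [x [xs xC' xg]]] : (#|C'| < k)%N.
  apply: leq_trans Ck; apply: proper_card; rewrite properE; apply/andP; split.
    by apply/subsetP => u; rewrite C'P => /andP[].
  by apply/subsetPn; exists a; rewrite // C'P Ca ncmxx ncmC ab.
pose x' (p : 'I_n.+1 * bool) :=
  if unlift ord0 p.1 is Some i then x (i, p.2) else if p.2 then b else a.
have x0 t : x' (ord0, t) = if t then b else a by rewrite /x' unlift_none.
have xl i t : x' (lift ord0 i, t) = x (i, t) by rewrite /x' liftK.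
exists n.+1, x'; split=> [[i t] [j s]|[i t]|g Cg].
- have nab p : (ncm a (x p) = false) * (ncm b (x p) = false).
    by have := xC' p; rewrite C'P => /and3P[_ /negPf-> /negPf->].
  case: (unliftP ord0 i) => [i' ->|->]; case: (unliftP ord0 j) => [j' ->|->];
    rewrite ?xl ?x0 /=.
  + by rewrite xs (inj_eq (@lift_inj _ ord0)).
  + by rewrite ncmC; case: s; rewrite nab.
  + by case: t; rewrite nab.
  + by case: t; case: s; rewrite ?ncmxx//= ncmC.
- case: (unliftP ord0 i) => [i' ->|->]; rewrite ?xl ?x0; last by case: t.
  by have := xC' (i', t); rewrite C'P => /andP[].
set L := <<_>>%g.
have xL p : x' p \in L by rewrite mem_gen// imset_f.
have [aL bL] : a \in L /\ b \in L.
  by have := (xL (ord0, false), xL (ord0, true)); rewrite !x0 => -[].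
(* [c y] has the same commutators with [a] and [b] as [y] has. *)
pose c y := (a ^+ ncm b y * b ^+ ncm a y)%g.
have cX (u v : gT) (t : bool) : ncm u (v ^+ t)%g = t && ncm u v.
  case: t; first by rewrite expg1. by rewrite (expg0 v) ncmC (ncm1 u).
have cC y : y \in C -> c y \in C by move=> Cy; rewrite groupM ?groupX.
have cC' y : y \in C -> (c y * y)%g \in C'.
  move=> Cy; rewrite C'P groupM ?cC//= !ncmMr !cX !ncmxx (ncmC b a) ab !andbT
    !andbF.
  by rewrite addbF addFb !addbb.
have [h [hL hC' hz]] := xg _ (cC' g Cg).
have subL : <<[set x p | p : ('I_n * bool)%type]>>%g \subset L.
  rewrite gen_subG; apply/subsetP => _ /imsetP[[i t] _ ->].
  by rewrite -xl xL.
have cL : c g \in L by rewrite groupM ?groupX.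
have E : (((c g)^-1 * h)^-1 * g = h^-1 * (c g * g))%g by rewrite (invMg _ h)
  invgK -mulgA.
exists ((c g)^-1 * h)%g; rewrite E; split.
- by apply: groupM; [rewrite groupV|exact: (subsetP subL)].
- by move: hC'; rewrite C'P => /and3P[].
move=> y Cy; set z := (h^-1 * _)%g.
have zab : ~~ ncm z a /\ ~~ ncm z b.
  by move: hC'; rewrite C'P ![ncm _ z]ncmC => /and3P[].
have := hz _ (cC' y Cy); rewrite -/z !ncmMr !cX.
by rewrite (negPf zab.1) (negPf zab.2) !andbF.
Qed.

End SymplecticFamily.

(** * Groups with commutator subgroup of order two *)

Section CommutatorOfOrderTwo.
Variables (K : closedFieldType) (gT : finGroupType).
Hypothesis char2 : 2%:R != 0 :> K.
Hypothesis hG : [~: [set: gT], [set: gT]]%g \isog [set: 'Z_2].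

Lemma commutator_elt : exists ep : gT, [/\ ep != 1%g, (ep * ep = 1)%g,
  forall g, (ep * g = g * ep)%g, forall g h : gT, ncm g h ->
    (g * h = ep * (h * g))%g
  & [~: [set: gT], [set: gT]]%g = [set 1%g; ep]].
Proof.
set D := [~: _, _]%g.
have cD : #|D| = 2 by rewrite (card_isog hG) cardsT card_ord.
have [ep epE] : exists ep, (D :\ 1%g) = [set ep].
  by apply/cards1P; have := cardsD1 1%g D; rewrite group1 cD add1n => -[<-].
have ep1 : ep != 1%g by have := set11 ep; rewrite -epE !inE => /andP[].
have DE : D = [set 1%g; ep] by rewrite -epE setD1K.
have epD : ep \in D by rewrite DE !inE eqxx orbT.
have D1 g : g \in D -> g != 1%g -> g = ep by rewrite DE !inE => /orP[->|/eqP].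
have epJ g : (ep ^ g = ep)%g.
  apply: D1; last by rewrite conjg_eq1.
  have /normalP[_ nD] : (D <| [set: gT])%g by apply: der_normal 1%N _.
  by rewrite -(nD g (in_setT g)) memJ_conjg.
exists ep; split=> // [|g|g h gh].
- apply/eqP; apply: contraT => /(D1 _ (groupM epD epD)).
  by move/(canRL (mulgK ep)); rewrite mulgV => /eqP; rewrite (negPf ep1).
- by rewrite conjgC epJ.
have cgh : [~ g^-1, h^-1]%g = (g * h * (h * g)^-1)%g.
  by rewrite commgEl conjgE !invgK invMg !mulgA.
have -> : ep = (g * h * (h * g)^-1)%g; last by rewrite mulgKV.
rewrite -cgh; symmetry; apply: D1; first by rewrite mem_commg ?in_setT.
by rewrite cgh -eq_mulgV1.
Qed.

(** The family [x] is a symplectic basis modulo the center, so [G] is the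
    product of its center with the subgroup [H] generated by [x]; the [z j] lift
    a dual basis of [G / H] to the center. The product [w] of the whole family
    fails to commute with every [x a], so [qc], the sign of commutation with
    [w], is -1 on the [x a] and 1 on the center. *)
Lemma indecomposable_module_exists : exists (M : ydModule K gT) (e : hbasis M),
  yd_indecomposable M /\ finite_dimensional (nichols e).
Proof.
have [ep [ep1 ep2 epC commE DE]] := commutator_elt.
have [n [x [xs _ xg]]] := symplectic_family ep1 ep2 epC commE [group of [set:
  gT]].
pose cM := ncmM ep1 ep2 epC commE; pose cMr := ncmMr ep1 ep2 epC commE.
have {xg} split_g g : exists h z, [/\ g = (h * z)%g,
    h \in <<[set x a | a : ('I_n * bool)%type]>>%g & forall y, ncm z y = false].
  have [h [hH _ hz]] := xg g (in_setT g); exists h, (h^-1 * g)%g; split=> //.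
    by rewrite mulKVg.
  by move=> y; apply: negbTE; apply: hz; rewrite in_setT.
set H := <<_>>%g in split_g.
have xH a : x a \in H by rewrite mem_gen// imset_f.
have [g0 [g1 g01]] : exists g0 g1 : gT, ncm g0 g1.
  suff : [exists g : gT, exists h : gT, ncm g h].
    by move=> /existsP[g /existsP[h gh]]; exists g, h.
  apply: contraT => no; suff D1 : [~: [set: gT], [set: gT]]%g = 1%g.
    by have := set22 1%g ep; rewrite -DE D1 inE (negPf ep1).
  apply/commG1P/subsetP => g _; apply/centP => h _; apply/eqP.
  apply: contraR no => gh; apply/existsP; exists g; apply/existsP; exists h.
  exact: gh.
have epH : ep \in H.
  have [h0 [z0 [E0 h0H z0C]]] := split_g g0;
    have [h1 [z1 [E1 h1H z1C]]] := split_g g1.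
  have h01 : ncm h0 h1.
    by move: g01; rewrite E0 E1 cM z0C addbF cMr (ncmC h0 z1) z1C addbF.
  have -> : ep = (h0 * h1 * (h1 * h0)^-1)%g by rewrite (commE _ _ h01) mulgK.
  by rewrite !(groupM, groupV).
have DH : ([~: [set: gT], [set: gT]] \subset H)%g.
  by rewrite DE; apply/subsetP => g /set2P[]->; rewrite ?group1.
have nH : (<<[set x a | a : ('I_n * bool)%type]>> <| [set: gT])%g.
  by apply: sub_der1_normal; rewrite ?subsetT// derg1.
have nHg g : g \in 'N(H)%g by have /andP[_ /subsetP] := nH; apply;
  rewrite in_setT.
have abQ : abelian ([set: gT] / H)%g by apply: sub_der1_abelian; rewrite derg1.
have [m [a [f [aQ fQ fa fak]]]] := @abelian_dual_basis K _ [group of ([set: gT]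
  / H)%g] abQ.
have aP j : exists z, (forall y, ncm z y = false) /\ coset H z = a j.
  have : a j \in ([set: gT] / H)%g by rewrite -aQ mem_gen// imset_f.
  move=> /morphimP[g _ _ ->]; have [h [z [-> hH zC]]] := split_g g.
  by exists z; split=> //; rewrite morphM ?nHg//= (coset_id hH) mul1g.
have [z zP] := boolp.choice aP.
have Qc g : coset H g \in ([set: gT] / H)%g by rewrite mem_quotient ?in_setT.
pose chi j g := f j (coset H g).
pose w := (\prod_(i < n) (x (i, false) * x (i, true)))%g.
pose qc g : K := (-1) ^+ ncm g w.
have wE y : ncm y w = \big[addb/false]_(i < n) (ncm y (x (i,
  false)) (+) ncm y (x (i, true))).
  rewrite /w (big_morph (ncm y) (id1 := false) (op1 := addb)).
  - by apply: eq_bigr => i _; rewrite cMr.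
  - by move=> g h; rewrite cMr.
  - by rewrite ncmC ncm1.
have xw b : ncm (x b) w = true.
  rewrite wE (bigD1 b.1)//= big1 => [|i /negPf ib]; rewrite !xs /= ?eqxx.
    by case: (b.2).
  by rewrite eq_sym ib.
have zw j : ncm (z j) w = false by have [->] := zP j.
apply: (@symplectic_module_exists K gT n m x z ep qc chi) => //.
- by move=> j g; apply/eqP/negPn; have [/(_ g)] := zP j; rewrite /ncm => ->.
- set L := <<_>>%g.
  have HL : H \subset L by apply: genS; apply: subsetUl.
  apply/eqP; rewrite eqEsubset subsetT -(quotientSGK _ HL);
    last by have /andP[] := nH.
  apply: (@subset_trans _ _ (mem <<[set a j | j : 'I_m]>>%g));
    first by rewrite aQ.
  rewrite gen_subG; apply/subsetP => _ /imsetP[j _ ->].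
  have [_ <-] := zP j; apply: mem_quotient; apply: mem_gen.
  by rewrite inE (imset_f z) ?orbT.
- by rewrite /qc ncm1.
- by move=> g h; rewrite /qc cM signr_addb.
- by move=> b; rewrite /qc xw.
- by move=> j; rewrite /qc zw.
- by rewrite /qc ncm_ep.
- by move=> j; rewrite /chi morph1; have [] := fQ j.
- by move=> j g h; rewrite /chi morphM ?nHg//=; have [_ fM] := fQ j;
  rewrite fM ?Qc.
- by move=> j b; rewrite /chi coset_id ?xH//; have [] := fQ j.
- by move=> j; rewrite /chi (coset_id epH); have [] := fQ j.
- by move=> j k jk; rewrite /chi; have [_ ->] := zP k; apply: fak.
- by move=> j; rewrite /chi; have [_ ->] := zP j; apply: fa.
Qed.

End CommutatorOfOrderTwo.

(* For R : realType, R[i] is the field of complex numbers. *)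
Theorem corollary5p13 (R : realType) (gT : finGroupType)
    (hG : [~: [set: gT], [set: gT]]%g \isog [set: 'Z_2]) :
  exists (M : ydModule R[i] gT) (e : hbasis M),
    [/\ yd_indecomposable M,
        finite_dimensional (nichols e) &
        exists (H : hopfAlgebra R[i]) (theta : nichols e -> gT -> H),
          [/\ is_bosonization theta,
              pointed H,
              coalgebra_indecomposable H &
              coradical_group_algebra (theta 1)]].
Proof.
have char2 : 2%:R != 0 :> R[i] by rewrite Num.Theory.pnatr_eq0.
have [M [e [Mind Mfd]]] := indecomposable_module_exists char2 hG.
exists M, e; split=> //.
exists (bosonization (concrete_smash Mfd)),
  (@theta _ _ _ _ (concrete_smash Mfd)).
split.
- exact: bosonizationP.
- exact: bosonization_pointed.
- exact: bosonization_indecomposable.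
- exact: bosonization_coradical.
Qed.
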